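(* Let $1<\sigma<\infty$ and $1\le\tau\le\infty$. Given an inner function $\theta$ and a measure space $(X,\mathfrak A,\mu)$, suppose that $T:K^1_{\theta^2}\to L^0(\mu)$ is a solid sublinear operator. Assume also that $T$ maps $K^{\sigma}_\theta$ boundedly into $L^{\tau}(\mu)$. Then $T$ maps $K^p_\theta$ boundedly into $L^q(\mu)$ whenever $\sigma<p<\infty$ and $p/q=\sigma/\tau$.
   Context: Let $\mathbb D$ be the open unit disk, $\mathbb T$ the unit circle, $m$ normalized Lebesgue measure on $\mathbb T$. $H^p$ denotes the usual Hardy space on $\mathbb D$; its members are identified with their nontangential boundary values on $\mathbb T$, so that $H^p$ is a subspace of $L^p(\mathbb T,m)$, with norm $\|\cdot\|_p$. $H^p_0:=\{f\in H^p:f(0)=0\}$. A function $\theta\in H^\infty$ is inner if $|\theta|=1$ a.e. on $\mathbb T$. For an inner function $\theta$ and $1\le p\le\infty$, $$K^p_\theta:=H^p\cap\theta\,\overline{H^p_0}=\{f\in H^p:\ \overline z\,\overline f\,\theta\in H^p\}$$ (bar denotes complex conjugation, products taken a.e. on $\mathbb T$). The same definition applied to the inner function $\theta^2$ gives $K^p_{\theta^2}$, and $K^p_\theta\subset K^1_{\theta^2}$. For a measure space $(X,\mathfrak A,\mu)$, $L^q(\mu)=L^q(X,\mathfrak A,\mu)$ and $L^0(\mu)$ is the space of $\mathfrak A$-measurable functions on $X$. If $\tau=\infty$, the relation $p/q=\sigma/\tau$ is understood to mean $q=\infty$. ''$T$ maps $K^p_\theta$ boundedly into $L^q(\mu)$''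 means that there is a constant $C$ with $\|Tf\|_{L^q(\mu)}\le C\|f\|_p$ for all $f\in K^p_\theta$. Let $\mathcal E_1,\mathcal E_2$ be vector spaces of complex-valued functions living on sets $X_1$, $X_2$, respectively. An operator $T:\mathcal E_1\to\mathcal E_2$ is sublinear if $$|T(f+g)|\le|Tf|+|Tg|\quad\text{and}\quad|T(\lambda f)|=|\lambda||Tf|$$ for all $f,g\in\mathcal E_1$ and $\lambda\in\mathbb C$. An operator $T:\mathcal E_1\to\mathcal E_2$ is solid if (i) there exists a constant $\gamma>0$ such that $|Tf|^2\le\gamma|T(f^2)|$ for every $f\in\mathcal E_1$ satisfying $f^2\in\mathcal E_1$; and (ii) $|TF|\le|TG|$ whenever $F,G\in\mathcal E_1$ are functions with $|F|\le|G|$ on $X_1$. The inequalities between values of $T$ hold pointwise on $X_2$, everywhere or almost everywhere. Here $\mathcal E_1=K^1_{\theta^2}$, with $X_1$ being either $\mathbb D$ (inequality $|F|\le|G|$ everywhere) or $\mathbb T$ (inequality $m$-a.e.), and $\mathcal E_2=L^0(\mu)$ with $X_2=X$ (inequalities $\mu$-a.e.). *)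

(* Defs.v *)
From HB Require Import structures.
From mathcomp Require Import all_boot all_order all_algebra.
From mathcomp Require Import complex.
From mathcomp Require Import all_classical all_reals all_analysis.

Set Implicit Arguments.
Unset Strict Implicit.
Unset Printing Implicit Defensive.
Import Order.TTheory GRing.Theory Num.Theory.
Import numFieldNormedType.Exports.

Local Open Scope classical_set_scope.
Local Open Scope ring_scope.
Local Open Scope complex_scope.

Lemma two_pi_gt0 (R : realType) : (0 : R) < 2 * pi.
Proof. by rewrite mulr_gt0// pi_gt0. Qed.

(** The circle is parametrised by [t |-> e^{it}], [0 <= t <= 2 pi]; normalized
    Lebesgue measure [m] becomes the uniform probability on [[0, 2 pi]], and a
    function on the circle becomes a function of [t]. *)
Definition cis (R : realType) (t : R) : R[i] := cos t +i* sin t.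

Definition circle_measure (R : realType) : probability (measurableTypeR R) R :=
  uniform_prob (two_pi_gt0 R).

(** A function on the disk is encoded by its extension by [0] to all of [R[i]],
    so that two functions agreeing on the disk are equal. *)
Definition holomorphic_on_disk (R : realType) (f : R[i] -> R[i]) : Prop :=
  (forall z : R[i], `|z| < 1 -> derivable (f : R[i]^o -> R[i]^o) z 1) /\
  (forall z : R[i], ~ (`|z| < 1) -> f z = 0).

Definition Lp_norm d (X : measurableType d) (R : realType)
    (mu : {measure set X -> \bar R}) (p : \bar R) (u : X -> R[i]) : \bar R :=
  Lnorm mu p (fun x => (ComplexField.Normc.normc (u x))%:E).

Definition hardy (R : realType) (p : \bar R) (f : R[i] -> R[i]) : Prop :=
  holomorphic_on_disk f /\
  exists M : R, forall r : R, 0 <= r < 1 ->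
    (Lp_norm (circle_measure R) p (fun t => f (r%:C * cis t)%R) <= M%:E)%E.

Definition stolz (R : realType) (zeta : R[i]) (alpha : R) : set R[i] :=
  [set z | `|z| < 1 /\ `|z - zeta| < alpha%:C * (1 - `|z|)].

Definition nontangential_limit (R : realType) (f : R[i] -> R[i])
    (zeta l : R[i]) : Prop :=
  forall alpha : R, 1 < alpha ->
    f z @[z --> within (stolz zeta alpha) (nbhs (zeta : R[i]^o))] --> (l : R[i]^o).

(** The value is irrelevant at points without a nontangential limit; for
    functions in a Hardy space these form a null set, by Fatou's theorem. *)
Definition boundary (R : realType) (f : R[i] -> R[i]) (t : R) : R[i] :=
  xget 0 (nontangential_limit f (cis t)).

Definition hardy_norm (R : realType) (p : \bar R) (f : R[i] -> R[i]) : \bar R :=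
  Lp_norm (circle_measure R) p (boundary f).

Definition inner (R : realType) (theta : R[i] -> R[i]) : Prop :=
  hardy +oo%E theta /\
  \forall t \ae circle_measure R, `|boundary theta t| = 1.

Definition model_space (R : realType) (p : \bar R) (theta : R[i] -> R[i]) :
    set (R[i] -> R[i]) :=
  [set f | hardy p f /\ exists h : R[i] -> R[i],
    [/\ hardy p h, h 0 = 0 &
     \forall t \ae circle_measure R,
       boundary f t = boundary theta t * (boundary h t)^*]].

Variant base_set := Disk | Circle.

Definition dominated (R : realType) (X1 : base_set) (F G : R[i] -> R[i]) : Prop :=
  match X1 with
  | Disk => forall z : R[i], `|z| < 1 -> `|F z| <= `|G z|
  | Circle => \forall t \ae circle_measure R, `|boundary F t| <= `|boundary G t|
  end.

(** Operators are total functions of which only the values on [E] matter. *)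
Definition maps_to_L0 (R : realType) d (X : measurableType d)
    (E : set (R[i] -> R[i])) (T : (R[i] -> R[i]) -> X -> R[i]) : Prop :=
  forall f, E f ->
    measurable_fun setT (fun x => complex.Re (T f x)) /\
    measurable_fun setT (fun x => complex.Im (T f x)).

Definition sublinear (R : realType) d (X : measurableType d)
    (mu : {measure set X -> \bar R}) (E : set (R[i] -> R[i]))
    (T : (R[i] -> R[i]) -> X -> R[i]) : Prop :=
  (forall f g, E f -> E g ->
     \forall x \ae mu, `|T (f \+ g) x| <= `|T f x| + `|T g x|) /\
  (forall (lambda : R[i]) f, E f ->
     \forall x \ae mu, `|T (fun z => lambda * f z) x| = `|lambda| * `|T f x|).

Definition solid (R : realType) d (X : measurableType d)
    (mu : {measure set X -> \bar R}) (X1 : base_set) (E : set (R[i] -> R[i]))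
    (T : (R[i] -> R[i]) -> X -> R[i]) : Prop :=
  (exists2 gamma : R, 0 < gamma &
     forall f, E f -> E (f \* f) ->
       \forall x \ae mu, `|T f x| ^+ 2 <= gamma%:C * `|T (f \* f) x|) /\
  (forall F G, E F -> E G -> dominated X1 F G ->
     \forall x \ae mu, `|T F x| <= `|T G x|).

Definition maps_boundedly (R : realType) d (X : measurableType d)
    (mu : {measure set X -> \bar R}) (theta : R[i] -> R[i]) (p q : \bar R)
    (T : (R[i] -> R[i]) -> X -> R[i]) : Prop :=
  exists C : R, forall f, model_space p theta f ->
    (Lp_norm mu q (T f) <= C%:E * hardy_norm p f)%E.

(* Main.v *)
(** For [f] in [K^{2s}], [1 < s], the function [f^2] splits as [g + theta h] with [g] and
    [h] in [K^s] of norm [O(||f||^2)]: project [f^2] by [w |-> A - theta A'], which is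
    bounded on [L^s] by M. Riesz' theorem. As [|theta| <= 1], solidity and sublinearity
    give [|T f|^2 <= gamma |T (f^2)| <= gamma (|T g| + |T h|)], so a bound from
    [K^s] to [L^{rho s}] yields one from [K^{2s}] to [L^{2 rho s}].
    Between the exponents [2^n sigma] and [2^{n+1} sigma] one interpolates the sublinear
    operator [w |-> T (P w)] on [L^p] of the circle: cut [w] into dyadic levels [w_k] and
    apply the two bounds to [sum_k +- c_k w_k], [c_k] geometric; averaging over the
    signs controls [T w_k] by [min (A 2^{- k a}, B 2^{k b})], which is summable. The
    same interpolation and a doubling argument give M. Riesz' theorem itself from [L^2]. *)

Require Import Defs.
From HB Require Import structures.
From mathcomp Require Import all_boot all_order all_algebra.
From mathcomp Require Import complex.
From mathcomp Require Import all_classical all_reals all_analysis.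
From mathcomp Require Import measurable_realfun ring lra.
Import Order.TTheory GRing.Theory Num.Theory.
Import numFieldNormedType.Exports.

Set Implicit Arguments.
Unset Strict Implicit.
Unset Printing Implicit Defensive.

Local Open Scope classical_set_scope.
Local Open Scope ring_scope.
Local Open Scope complex_scope.

(** The operator acts on a space of holomorphic functions only, is not assumed linear or continuous,
    and its inequalities hold off null sets that depend on the functions. Duality and analytic
    families are thus out of reach for it: each argument uses finitely many functions at a time, and
    limits are taken afterwards, by Fatou's lemma on truncations. Squaring alone reaches only the
    exponents [2^n sigma]. Composing with a projection that fixes the model space gives an operator
    on all of [L^p], where a function may be cut by size without leaving the domain. The ratio [rho]
    of target to source exponent stays [tau / sigma] throughout, and [rho s >= 1] lets a power of a
    mean over signs be bounded by the mean of powers. The condition [1 < sigma] enters through M.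
    Riesz' theorem, which fails at exponent 1. A second obstacle is the passage from the disk to the
    circle: a Hardy function is recovered from its boundary function by a strictly convex integral
    functional in place of weak compactness, and Poisson integrals then carry identities between the
    two sides. *)

Notation Re := complex.Re.
Notation Im := complex.Im.

Notation N := ComplexField.Normc.normc.
Notation cj := conjc.

(** * Complex numbers and integrals *)

Section normc_theory.
Context {R : realType}.
Implicit Types (z w : R[i]) (x t : R).

Lemma normE z : `|z| = (N z)%:C. Proof. by []. Qed.

Lemma N_ge0 z : 0 <= N z.
Proof. by rewrite -lecR -normE normr_ge0. Qed.

Lemma ND z w : N (z + w) <= N z + N w.
Proof. by rewrite -lecR rmorphD/= -!normE ler_normD. Qed.

Lemma NN z : N (- z) = N z.
Proof. by apply: complexI; rewrite -!normE normrN. Qed.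

Lemma NB z w : N (z - w) <= N z + N w.
Proof. by rewrite (le_trans (ND _ _))// NN. Qed.

Lemma NBC z w : N (z - w) = N (w - z).
Proof. by rewrite -NN opprB. Qed.

Lemma N_leB z w : N z - N w <= N (z - w).
Proof. by rewrite lerBlDr (le_trans _ (ND _ _))// subrK. Qed.

Lemma NM z w : N (z * w) = N z * N w.
Proof. exact: ComplexField.Normc.normcM. Qed.

Lemma NX z n : N (z ^+ n) = N z ^+ n.
Proof.
elim: n => [|n ih]; first by rewrite !expr0 ComplexField.Normc.normc1.
by rewrite !exprS NM ih.
Qed.

Lemma NV z : N z^-1 = (N z)^-1.
Proof. exact: ComplexField.Normc.normcV. Qed.

Lemma N0 : N (0 : R[i]) = 0. Proof. exact: ComplexField.Normc.normc0. Qed.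
Lemma N1 : N (1 : R[i]) = 1. Proof. exact: ComplexField.Normc.normc1. Qed.

Lemma N_eq0 z : (N z == 0) = (z == 0).
Proof.
by apply/eqP/eqP => [/ComplexField.Normc.eq0_normc//|->]; exact: N0.
Qed.

Lemma N_gt0 z : (0 < N z) = (z != 0).
Proof. by rewrite lt_def N_eq0 N_ge0 andbT. Qed.

Lemma NR x : N (x%:C) = `|x|.
Proof. by rewrite /= expr0n addr0 sqrtr_sqr. Qed.

Lemma Nsq z : N z ^+ 2 = Re z ^+ 2 + Im z ^+ 2.
Proof. by case: z => a b /=; rewrite sqr_sqrtr// addr_ge0 ?sqr_ge0. Qed.

Lemma Nconj z : N (cj z) = N z.
Proof. by case: z => a b /=; rewrite sqrrN. Qed.

Lemma normRe z : `|Re z| <= N z.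
Proof.
rewrite -(@ler_pXn2r _ 2)// ?nnegrE ?N_ge0//.
by rewrite Nsq real_normK ?num_real// lerDl sqr_ge0.
Qed.

Lemma normIm z : `|Im z| <= N z.
Proof.
rewrite -(@ler_pXn2r _ 2)// ?nnegrE ?N_ge0//.
by rewrite Nsq real_normK ?num_real// lerDr sqr_ge0.
Qed.

Lemma N_leReIm z : N z <= `|Re z| + `|Im z|.
Proof.
rewrite {1}[z]complexE (le_trans (ND _ _))// NM !NR.
suff -> : N ('i%C : R[i]) = 1 by rewrite mul1r.
by rewrite /= expr0n add0r expr1n sqrtr1.
Qed.

Lemma ReD z w : Re (z + w) = Re z + Re w. Proof. by case: z; case: w. Qed.
Lemma ImD z w : Im (z + w) = Im z + Im w. Proof. by case: z; case: w. Qed.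
Lemma ReN z : Re (- z) = - Re z. Proof. by case: z. Qed.
Lemma ImN z : Im (- z) = - Im z. Proof. by case: z. Qed.
Lemma ReM z w : Re (z * w) = Re z * Re w - Im z * Im w.
Proof. by case: z; case: w. Qed.
Lemma ImM z w : Im (z * w) = Re z * Im w + Im z * Re w.
Proof. by case: z; case: w. Qed.
Lemma Reconj z : Re (cj z) = Re z. Proof. by case: z. Qed.
Lemma Imconj z : Im (cj z) = - Im z. Proof. by case: z. Qed.
Lemma complex_eq z w : Re z = Re w -> Im z = Im w -> z = w.
Proof. by case: z; case: w => ? ? ? ? /= -> ->. Qed.

Lemma mul_conj z : z * (cj z) = ((N z) ^+ 2)%:C.
Proof.
by rewrite Nsq; apply: complex_eq; rewrite ?ReM ?ImM Reconj Imconj/=; ring.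
Qed.

Lemma conjD z w : (cj (z + w)) = (cj z) + (cj w). Proof. exact: rmorphD. Qed.
Lemma conjM z w : (cj (z * w)) = (cj z) * (cj w). Proof. exact: rmorphM. Qed.
Lemma conjN z : (cj (- z)) = - (cj z). Proof. exact: rmorphN. Qed.
Lemma conjB z w : (cj (z - w)) = (cj z) - (cj w). Proof. exact: rmorphB. Qed.
Lemma conjV z : (cj (z^-1)) = (cj z)^-1. Proof. exact: fmorphV. Qed.
Lemma conj0 : (cj (0 : R[i])) = 0. Proof. exact: rmorph0. Qed.
Lemma conj1 : (cj (1 : R[i])) = 1. Proof. exact: rmorph1. Qed.
Lemma conjR x : (cj (x%:C)) = x%:C. Proof. by rewrite /= oppr0. Qed.
Lemma conjKc z : (cj (cj z)) = z. Proof. by case: z => a b /=; rewrite opprK. Qed.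

Lemma Ncis t : N (cis t) = 1.
Proof. by rewrite /cis /= cos2Dsin2 sqrtr1. Qed.

Lemma cisD x t : cis (x + t) = cis x * cis t.
Proof.
by apply: complex_eq; rewrite ?ReM ?ImM /= ?cosD ?sinD //; ring.
Qed.

Lemma cisN t : cis (- t) = (cj (cis t)).
Proof. by rewrite /cis cosN sinN. Qed.

Lemma cis_neq0 t : cis t != 0 :> R[i].
Proof. by rewrite -N_gt0 Ncis. Qed.

Lemma cisM_conj t : cis t * (cj (cis t)) = 1.
Proof. by rewrite mul_conj Ncis expr1n. Qed.

Lemma cis2pi t : cis (t + 2 * pi) = cis t.
Proof. by rewrite cisD /cis mulr_natl cos2pi sin2pi mulr1. Qed.

End normc_theory.

(** * Extended integrals of nonnegative functions *)

Section eint.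
Context d (X : measurableType d) (R : realType).
Variable mu : {measure set X -> \bar R}.
Implicit Types (f g : X -> R).
Local Open Scope ereal_scope.

Definition eint f : \bar R := \int[mu]_x (f x)%:E.

Lemma eint_ge0 f : (forall x, 0 <= f x)%R -> 0 <= eint f.
Proof. by move=> f0; apply: integral_ge0 => x _; rewrite lee_fin. Qed.

Lemma eint_le_ae f g : measurable_fun setT f -> measurable_fun setT g ->
  (forall x, 0 <= f x)%R -> (forall x, 0 <= g x)%R ->
  (\forall x \ae mu, (f x <= g x)%R) -> eint f <= eint g.
Proof.
move=> mf mg f0 g0 fg; apply: ae_ge0_le_integral => //.
- by move=> x _; rewrite lee_fin.
- exact/measurable_EFinP.
- by move=> x _; rewrite lee_fin.
- exact/measurable_EFinP.
- by apply: filterS fg => x fgx _; rewrite lee_fin.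
Qed.

Lemma eint_le f g : measurable_fun setT f -> measurable_fun setT g ->
  (forall x, 0 <= f x)%R -> (forall x, f x <= g x)%R -> eint f <= eint g.
Proof.
move=> mf mg f0 fg; apply: eint_le_ae => //.
  by move=> x; exact: le_trans (fg x).
exact: aeW.
Qed.

Lemma eint_eq_ae f g : measurable_fun setT f -> measurable_fun setT g ->
  (forall x, 0 <= f x)%R -> (forall x, 0 <= g x)%R ->
  (\forall x \ae mu, f x = g x) -> eint f = eint g.
Proof.
move=> mf mg f0 g0 fg; apply/eqP; rewrite eq_le; apply/andP; split.
  by apply: eint_le_ae => //; apply: filterS fg => x ->.
by apply: eint_le_ae => //; apply: filterS fg => x ->.
Qed.

Lemma eintD f g : measurable_fun setT f -> measurable_fun setT g ->
  (forall x, 0 <= f x)%R -> (forall x, 0 <= g x)%R ->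
  eint (fun x => f x + g x)%R = eint f + eint g.
Proof.
move=> mf mg f0 g0; rewrite /eint -ge0_integralD//.
- by move=> x _; rewrite lee_fin.
- exact/measurable_EFinP.
- by move=> x _; rewrite lee_fin.
- exact/measurable_EFinP.
Qed.

Lemma eintZ (c : R) f : measurable_fun setT f -> (0 <= c)%R ->
  (forall x, 0 <= f x)%R -> eint (fun x => c * f x)%R = c%:E * eint f.
Proof.
move=> mf c0 f0; rewrite /eint -ge0_integralZl//.
- exact/measurable_EFinP.
- by move=> x _; rewrite lee_fin.
Qed.

Lemma eint_sum (I : Type) (r : seq I) (F : I -> X -> R) :
  (forall i, measurable_fun setT (F i)) -> (forall i x, 0 <= F i x)%R ->
  eint (fun x => \sum_(i <- r) F i x)%R = \sum_(i <- r) eint (F i).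
Proof.
move=> mF F0; rewrite /eint.
under eq_integral do rewrite -sumEFin.
rewrite (@ge0_integral_sum _ _ _ mu _ measurableT _ (fun i x => (F i x)%:E))//.
  by move=> i; exact/measurable_EFinP.
by move=> i x _; rewrite lee_fin.
Qed.

Lemma eint_integrable f : measurable_fun setT f -> (forall x, 0 <= f x)%R ->
  eint f < +oo -> mu.-integrable setT (EFin \o f).
Proof.
move=> mf f0 fi; apply/integrableP; split; first exact/measurable_EFinP.
by under eq_integral do rewrite /= ger0_norm//.
Qed.

End eint.

(** * Integrals of complex functions over the circle *)

Section complex_integral.
Context {R : realType}.
Notation C := R[i].
Local Notation m := (circle_measure R).
Local Notation T := (measurableTypeR R).
Implicit Types (u w : T -> C) (f : R -> R) (c : C).

Lemma circle_setT : (m setT = 1)%E. Proof. exact: probability_setT. Qed.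

Definition cmeas d (X : measurableType d) (w : X -> C) : Prop :=
  measurable_fun setT (fun x => Re (w x)) /\
  measurable_fun setT (fun x => Im (w x)).

Section cmeas.
Context d (X : measurableType d).

Lemma cmeas_cst c : cmeas (fun _ : X => c).
Proof. by split; exact: measurable_cst. Qed.

Lemma cmeas_comp d' (Y : measurableType d') (g : Y -> X) (w : X -> C) :
  measurable_fun setT g -> cmeas w -> cmeas (w \o g).
Proof.
move=> mg [mr mi]; split; [exact: (measurableT_comp mr)|].
exact: (measurableT_comp mi).
Qed.

Lemma cmeasD (w w' : X -> C) : cmeas w -> cmeas w' -> cmeas (fun x => w x + w' x).
Proof.
move=> [a b] [a' b']; split.
  by under eq_fun do rewrite ReD; exact: measurable_funD.
by under eq_fun do rewrite ImD; exact: measurable_funD.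
Qed.

Lemma cmeasN (w : X -> C) : cmeas w -> cmeas (fun x => - w x).
Proof.
move=> [a b]; split.
  by under eq_fun do rewrite ReN; exact: measurable_funN.
by under eq_fun do rewrite ImN; exact: measurable_funN.
Qed.

Lemma cmeasB (w w' : X -> C) : cmeas w -> cmeas w' -> cmeas (fun x => w x - w' x).
Proof. by move=> mw mw'; apply: cmeasD => //; exact: cmeasN. Qed.

Lemma cmeasM (w w' : X -> C) : cmeas w -> cmeas w' -> cmeas (fun x => w x * w' x).
Proof.
move=> [a b] [a' b']; split.
  under eq_fun do rewrite ReM.
  by apply: measurable_funB; exact: measurable_funM.
under eq_fun do rewrite ImM.
by apply: measurable_funD; exact: measurable_funM.
Qed.

Lemma cmeas_conj (w : X -> C) : cmeas w -> cmeas (fun x => (cj (w x))).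
Proof.
move=> [a b]; split; first by under eq_fun do rewrite Reconj.
by under eq_fun do rewrite Imconj; exact: measurable_funN.
Qed.

Lemma cmeasR (f : X -> R) : measurable_fun setT f -> cmeas (fun x => (f x)%:C).
Proof. by move=> mf; split => //=; exact: measurable_cst. Qed.

Lemma cmeas_N (w : X -> C) : cmeas w -> measurable_fun setT (fun x => N (w x)).
Proof.
move=> [a b].
have -> : (fun x => N (w x)) =
    (fun x => (Re (w x) ^+ 2 + Im (w x) ^+ 2) `^ (2^-1)).
  apply/funext => x; rewrite -Nsq powR12_sqrt ?sqr_ge0//.
  by rewrite sqrtr_sqr ger0_norm// N_ge0.
apply: (measurableT_comp (@measurable_powR R (2^-1))).
by apply: measurable_funD; exact: measurable_funX.
Qed.

Lemma cmeas_Npow (p : R) (w : X -> C) : cmeas w ->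
  measurable_fun setT (fun x => N (w x) `^ p).
Proof.
move=> mw; apply: (measurableT_comp (@measurable_powR R p)).
exact: cmeas_N.
Qed.

End cmeas.

Definition cL1 w := m.-integrable setT (EFin \o (fun t => Re (w t))) /\
  m.-integrable setT (EFin \o (fun t => Im (w t))).

Definition cint w : C := (\int[m]_t Re (w t)) +i* (\int[m]_t Im (w t)).

Lemma cL1_meas w : cL1 w -> cmeas w.
Proof.
by move=> [a b]; split; apply/measurable_EFinP;
  [exact: (measurable_int _ a)|exact: (measurable_int _ b)].
Qed.

Lemma cL1_N w : cL1 w -> m.-integrable setT (EFin \o (fun t => N (w t))).
Proof.
move=> w1; have mw := cL1_meas w1; case: w1 => a b.
have := integrableD measurableT (integrable_abse a) (integrable_abse b).
apply: le_integrable => //.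
  by apply/measurable_EFinP; exact: cmeas_N.
move=> t _ /=; rewrite lee_fin ger0_norm ?N_ge0//.
by rewrite (le_trans (N_leReIm _))// ler_norm.
Qed.

Lemma cL1P w : cmeas w -> (eint m (fun t => N (w t)) < +oo)%E -> cL1 w.
Proof.
move=> mw wi.
have wN : m.-integrable setT (EFin \o (fun t => N (w t))).
  by apply: eint_integrable => //; [exact: cmeas_N|move=> t; exact: N_ge0].
split; apply: (le_integrable _ _ _ wN) => //.
- by apply/measurable_EFinP; case: mw.
- by move=> t _; rewrite /= lee_fin (ger0_norm (N_ge0 _)) normRe.
- by apply/measurable_EFinP; case: mw.
- by move=> t _; rewrite /= lee_fin (ger0_norm (N_ge0 _)) normIm.
Qed.

Lemma cL1_bnd w M : cmeas w -> (forall t, N (w t) <= M) -> cL1 w.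
Proof.
move=> mw wM; apply: cL1P => //.
apply: (@le_lt_trans _ _ (eint m (fun=> M))).
  by apply: eint_le => //; [exact: cmeas_N|move=> t; exact: N_ge0].
by rewrite /eint integral_cst// [X in (_ * X)%E]circle_setT mule1 ltry.
Qed.

Lemma cL1_cst c : cL1 (fun=> c).
Proof. by apply: (@cL1_bnd _ (N c)) => //; exact: cmeas_cst. Qed.

Lemma cL1D u w : cL1 u -> cL1 w -> cL1 (fun t => u t + w t).
Proof.
move=> [a b] [a' b']; split.
  have := integrableD measurableT a a'; apply: eq_integrable => // t _ /=.
  by rewrite ReD.
have := integrableD measurableT b b'; apply: eq_integrable => // t _ /=.
by rewrite ImD.
Qed.

Lemma cL1M_bnd u w M : cmeas u -> (forall t, N (u t) <= M) -> cL1 w ->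
  cL1 (fun t => u t * w t).
Proof.
move=> mu uM w1; have mw := cL1_meas w1.
apply: cL1P; first exact: cmeasM.
apply: (@le_lt_trans _ _ (eint m (fun t => `|M| * N (w t)))).
  apply: eint_le => //.
  - by apply: cmeas_N; exact: cmeasM.
  - by apply: measurable_funM => //; exact: cmeas_N.
  - by move=> t; exact: N_ge0.
  - by move=> t; rewrite NM ler_wpM2r ?N_ge0// (le_trans (uM t))// ler_norm.
rewrite eintZ//; [|exact: cmeas_N|by move=> t; exact: N_ge0].
have /= := integrable_fin_num measurableT (cL1_N w1).
rewrite -/(eint m _) => /fineK <-; exact: ltry.
Qed.

Lemma cL1Z c w : cL1 w -> cL1 (fun t => c * w t).
Proof. by apply: (@cL1M_bnd _ _ (N c)) => //; exact: cmeas_cst. Qed.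

Lemma cL1N w : cL1 w -> cL1 (fun t => - w t).
Proof. by move=> /(cL1Z (-1)); under eq_fun do rewrite mulN1r. Qed.

Lemma cL1B u w : cL1 u -> cL1 w -> cL1 (fun t => u t - w t).
Proof. by move=> u1 w1; apply: cL1D => //; exact: cL1N. Qed.

Lemma cL1_conj w : cL1 w -> cL1 (fun t => (cj (w t))).
Proof.
move=> w1; have := cL1_N w1 => wN; have mw := cL1_meas w1.
apply: cL1P; first exact: cmeas_conj.
under eq_fun do rewrite Nconj.
have /= := integrable_fin_num measurableT wN.
by rewrite -/(eint m _) => /fineK <-; exact: ltry.
Qed.

Lemma cintD u w : cL1 u -> cL1 w ->
  cint (fun t => u t + w t) = cint u + cint w.
Proof.
move=> [a b] [a' b']; rewrite /cint; apply: complex_eq; rewrite ?ReD ?ImD /=.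
  by under eq_Rintegral do rewrite ReD; rewrite RintegralD.
by under eq_Rintegral do rewrite ImD; rewrite RintegralD.
Qed.

Lemma cintZ c w : cL1 w -> cint (fun t => c * w t) = c * cint w.
Proof.
move=> [a b]; have iZ (k : R) (f : R -> R) : m.-integrable setT (EFin \o f) ->
    m.-integrable setT (EFin \o (fun t => k * f t)).
  by move=> fi; have := integrableZl measurableT k fi; apply: eq_integrable.
apply: complex_eq; rewrite ?ReM ?ImM /=.
  under eq_Rintegral do rewrite ReM.
  by rewrite RintegralB ?RintegralZl//; exact: iZ.
under eq_Rintegral do rewrite ImM.
by rewrite RintegralD ?RintegralZl//; exact: iZ.
Qed.

Lemma cint_ext u w : u =1 w -> cint u = cint w.
Proof. by move=> uw; congr cint; apply/funext. Qed.

Lemma cint_cst c : cint (fun=> c) = c.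
Proof.
rewrite /cint !Rintegral_cst//; move: circle_setT => /= ->; rewrite !mulr1.
by case: c.
Qed.

Lemma cintN w : cL1 w -> cint (fun t => - w t) = - cint w.
Proof.
by move=> w1; rewrite -mulN1r -cintZ//; apply: cint_ext => t; rewrite mulN1r.
Qed.

Lemma cintB u w : cL1 u -> cL1 w ->
  cint (fun t => u t - w t) = cint u - cint w.
Proof. by move=> u1 w1; rewrite cintD ?cintN//; exact: cL1N. Qed.

Lemma cint_conj w : cL1 w -> cint (fun t => (cj (w t))) = (cj (cint w)).
Proof.
move=> [a b]; apply: complex_eq; rewrite ?Reconj ?Imconj /=.
  by under eq_Rintegral do rewrite Reconj.
under eq_Rintegral do rewrite Imconj -mulN1r.
by rewrite RintegralZl// mulN1r.
Qed.

(** Multiplying by the conjugate [c] of the integral rotates its value onto the positive axis, where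
    it is the integral of a real part. *)
Lemma le_cint w : cL1 w -> N (cint w) <= \int[m]_t N (w t).
Proof.
move=> w1.
have [/eqP|I0] := eqVneq (N (cint w)) 0.
  by move/eqP => ->; apply: Rintegral_ge0 => t _; exact: N_ge0.
have Ig : 0 < N (cint w) by rewrite lt_def I0 N_ge0.
rewrite -(ler_pM2l Ig) -expr2.
pose c := (cj (cint w)).
have -> : N (cint w) ^+ 2 = Re (cint (fun t => c * w t)).
  by rewrite cintZ// mulrC mul_conj.
have -> : N (cint w) = N c by rewrite Nconj.
rewrite -RintegralZl//; last exact: cL1_N.
apply: le_Rintegral => //.
- by case: (cL1Z c w1).
- have := integrableZl measurableT (N c) (cL1_N w1); exact: eq_integrable.
- by move=> t _; apply: (le_trans (ler_norm _)); rewrite (le_trans (normRe _))// NM.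
Qed.

Lemma le_cint_eint w : cL1 w -> ((N (cint w))%:E <= eint m (fun t => N (w t)))%E.
Proof.
move=> w1; have := le_cint w1; rewrite -lee_fin => /le_trans; apply.
rewrite /Rintegral fineK//.
exact: (integrable_fin_num measurableT (cL1_N w1)).
Qed.

End complex_integral.

(** * Goursat's theorem and mean values *)

Section interval_integral.
Context {R : realType}.
Local Notation mu := (@lebesgue_measure R).
Implicit Types (f g : R -> R) (a b c k : R).

Definition Iab a b f : R := \int[mu]_(x in `[a, b]) f x.

Definition ctson a b f := forall x, a <= x <= b -> {for x, continuous f}.

Lemma ctson_int a b f : ctson a b f -> mu.-integrable `[a, b] (EFin \o f).
Proof.
move=> cf; apply: continuous_compact_integrable; first exact: segment_compact.
apply: continuous_in_subspaceT => x; rewrite inE /= in_itv /= => xab.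
exact: cf.
Qed.

Lemma ctsonB a b f g : ctson a b f -> ctson a b g ->
  ctson a b (fun x => f x - g x).
Proof. by move=> cf cg x xab; apply: continuousB; [exact: cf|exact: cg]. Qed.

Lemma Iab_split a b c f : a <= c -> c <= b -> ctson a b f ->
  Iab a b f = Iab a c f + Iab c b f.
Proof.
move=> ac cb cf; suff <- : Iab a b f - Iab a c f = Iab c b f by rewrite addrC subrK.
rewrite /Iab Rintegral_itvB ?bnd_simp//; last exact: ctson_int.
rewrite Rintegral_itv_obnd_cbnd//.
apply: integrableS (ctson_int cf) => //.
by apply: subset_itvr; rewrite bnd_simp.
Qed.

Lemma IabB a b f g : ctson a b f -> ctson a b g ->
  Iab a b (fun x => f x - g x) = Iab a b f - Iab a b g.
Proof. by move=> cf cg; rewrite /Iab RintegralB//; exact: ctson_int. Qed.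

Lemma Iab_near_cst a b f k (K : R) : a <= b -> ctson a b f ->
  (forall x, a <= x <= b -> `|f x - k| <= K) ->
  `|Iab a b f - k * (b - a)| <= K * (b - a).
Proof.
move=> ab cf fK.
have cst r : Iab a b (fun=> r) = r * (b - a).
  rewrite /Iab Rintegral_cst//.
  have E : (lebesgue_measure (`[a, b]%classic : set R) = (b - a)%:E)%E.
    rewrite lebesgue_measure_itv /= lte_fin.
    by move: ab; rewrite le_eqVlt => /predU1P[->|->//]; rewrite ltxx subrr.
  by congr (_ * _); exact: (congr1 fine E).
have ck r : ctson a b (fun=> r) by move=> x _; exact: cvg_cst.
rewrite -cst -IabB// -(cst K).
rewrite /Iab (le_trans (le_normr_Rintegral _ _))//; first exact/ctson_int/ctsonB.
apply: le_Rintegral => //.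
- exact: (integrable_norm (ctson_int (ctsonB cf (ck k)))).
- exact: (ctson_int (ck K)).
Qed.

End interval_integral.

(** Nested intervals in two variables at once: [P n x y] is meant to speak of the rectangle with
    corner [(x, y)] and sides [w / 2^n], [h / 2^n], and the point found lies in one such rectangle
    for every [n]. With [w = 0] only the second variable is bisected, as in [uniform_circle]. *)
Lemma bisection {R : realType} (P : nat -> R -> R -> Prop) (w h x0 y0 : R) :
  0 <= w -> 0 <= h ->
  P 0%N x0 y0 ->
  (forall n x y, P n x y -> exists x' y',
     [/\ P n.+1 x' y', x <= x' <= x + w / 2 ^+ n.+1 &
                       y <= y' <= y + h / 2 ^+ n.+1]) ->
  exists xs ys, forall n, exists x y,
     [/\ P n x y, x <= xs <= x + w / 2 ^+ n & y <= ys <= y + h / 2 ^+ n].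
Proof.
move=> w0 h0 P0 Pstep.
have step (s : nat * (R * R)) : exists s' : R * R,
    P s.1 s.2.1 s.2.2 -> [/\ P s.1.+1 s'.1 s'.2,
      s.2.1 <= s'.1 <= s.2.1 + w / 2 ^+ s.1.+1 &
      s.2.2 <= s'.2 <= s.2.2 + h / 2 ^+ s.1.+1].
  have [p|np] := pselect (P s.1 s.2.1 s.2.2).
    by have [x' [y' H]] := Pstep _ _ _ p; exists (x', y').
  by exists (0, 0) => p.
have [F HF] := choice step.
pose S := fix S n := if n is k.+1 then F (k, S k) else (x0, y0).
have PS n : P n (S n).1 (S n).2.
  by elim: n => [//|n ih]; have [] := HF (n, S n) ih.
have halves (c : R) n : c / 2 ^+ n = c / 2 ^+ n.+1 + c / 2 ^+ n.+1.
  rewrite exprS invfM mulrCA -mulrDl.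
  by rewrite (_ : 2^-1 + 2^-1 = 1 :> R) ?mul1r//; lra.
have lim1 (X : nat -> R) (c : R) : 0 <= c ->
    (forall n, X n <= X n.+1 <= X n + c / 2 ^+ n.+1) ->
    exists xs, forall n, X n <= xs <= X n + c / 2 ^+ n.
  move=> c0 HX.
  have nd n k : X n <= X (n + k)%N.
    elim: k => [|k ih]; first by rewrite addn0.
    by rewrite addnS (le_trans ih)//; have /andP[] := HX (n + k)%N.
  have ni n k : X (n + k)%N + c / 2 ^+ (n + k) <= X n + c / 2 ^+ n.
    elim: k => [|k ih]; first by rewrite addn0.
    rewrite (le_trans _ ih)// addnS (halves c (n + k)%N) addrA lerD2r.
    by have /andP[] := HX (n + k)%N.
  have ub n k : X k <= X n + c / 2 ^+ n.
    have cp j : 0 <= c / 2 ^+ j by rewrite divr_ge0.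
    have [nk|kn] := leqP n k.
      by rewrite -(subnKC nk) (le_trans _ (ni n (k - n)%N))// lerDl.
    by rewrite (le_trans (nd k (n - k)%N))// subnKC ?(ltnW kn)// lerDl.
  have hs : has_sup (range X).
    split; first by exists (X 0%N); exists 0%N.
    by exists (X 0%N + c / 2 ^+ 0) => _ [k _ <-]; exact: ub.
  exists (sup (range X)) => n; apply/andP; split.
    by apply: ub_le_sup; [exact: hs.2|exists n].
  by apply: ge_sup; [exact: hs.1|move=> _ [k _ <-]; exact: ub].
have [xs Hx] : exists xs, forall n, (S n).1 <= xs <= (S n).1 + w / 2 ^+ n.
  by apply: lim1 => // n; have [] := HF (n, S n) (PS n).
have [ys Hy] : exists ys, forall n, (S n).2 <= ys <= (S n).2 + h / 2 ^+ n.
  by apply: lim1 => // n; have [] := HF (n, S n) (PS n).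
by exists xs, ys => n; exists (S n).1, (S n).2; split.
Qed.

Lemma dist_itv {R : realType} (x l z z' : R) :
  x <= z <= x + l -> x <= z' <= x + l -> `|z - z'| <= l.
Proof. by move=> /andP[? ?] /andP[? ?]; rewrite ler_norml; apply/andP; split; lra. Qed.

Section goursat.
Context {R : realType}.
Variables (u v : R -> R -> R).

(** Differentiability together with the single Cauchy-Riemann equation
    [u_y = - v_x], which is all that Goursat's argument uses. *)
Definition half_CR (x0 y0 : R) := exists p q r : R, forall e : R, 0 < e ->
  exists2 del : R, 0 < del & forall x y, `|x - x0| < del -> `|y - y0| < del ->
   `|v x y - v x0 y0 - (p * (x - x0) + q * (y - y0))|
      <= e * (`|x - x0| + `|y - y0|) /\
   `|u x y - u x0 y0 - (r * (x - x0) - p * (y - y0))|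
      <= e * (`|x - x0| + `|y - y0|).

Lemma half_CR_cont x0 y0 : half_CR x0 y0 ->
  [/\ {for x0, continuous (fun x => u x y0)} &
      {for y0, continuous (fun y => v x0 y)}].
Proof.
move=> [p [q [r H]]]; have [del del0 {}H] := H 1 ltr01.
have aux (f : R -> R) (z0 c : R) : (forall z, `|z - z0| < del ->
    `|f z - f z0 - c * (z - z0)| <= `|z - z0|) -> {for z0, continuous f}.
  move=> Hf; apply/cvgrPdist_lt => e e0.
  have k0 : 0 < `|c| + 1 by rewrite ltr_wpDl.
  have m0 : 0 < Num.min del (e / (`|c| + 1)) by rewrite lt_min del0 divr_gt0.
  near=> z.
  have : `|z - z0| < Num.min del (e / (`|c| + 1)).
    rewrite distrC; near: z; exact: (@cvgr_dist_lt _ _ _ _ _ idfun z0).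
  rewrite lt_min ltr_pdivlMr// => /andP[z1 z2].
  have := Hf z z1 => Hz.
  rewrite distrC (_ : f z - f z0 = (f z - f z0 - c * (z - z0)) + c * (z - z0));
    last by rewrite subrK.
  rewrite (le_lt_trans (ler_normD _ _))// (le_lt_trans _ z2)//.
  by rewrite normrM; lra.
split.
  apply: (aux _ _ r) => x xd.
  have := (H x y0 xd); rewrite subrr normr0 => /(_ del0)[_].
  by rewrite mulr0 subr0 addr0 mul1r.
apply: (aux _ _ q) => y yd.
have := (H x0 y); rewrite subrr normr0 => /(_ del0 yd)[].
by rewrite mulr0 !add0r mul1r.
Unshelve. all: by end_near. Qed.

(** The counterclockwise integral of [v dy - u dx], that is, minus the real part of the integral of
    [(u + i v) dz]; the relation [u_y = - v_x] makes this form closed. *)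
Definition boundQ (a b c d : R) : R :=
  Iab c d (fun y => v b y - v a y) + Iab a b (fun x => u x d - u x c).

Definition CR_on a b c d :=
  forall x y, a <= x <= b -> c <= y <= d -> half_CR x y.

Lemma CR_onS a b c d a' b' c' d' : a <= a' -> b' <= b -> c <= c' -> d' <= d ->
  CR_on a b c d -> CR_on a' b' c' d'.
Proof.
move=> aa bb cc dd H x y /andP[? ?] /andP[? ?]; apply: H; apply/andP; split.
all: by [exact: le_trans aa _|exact: le_trans bb|exact: le_trans cc _|exact: le_trans dd].
Qed.

Lemma CR_on_ctu a b c d y : CR_on a b c d -> c <= y <= d ->
  ctson a b (fun x => u x y).
Proof. by move=> H ycd x xab; have [] := half_CR_cont (H _ _ xab ycd). Qed.

Lemma CR_on_ctv a b c d x : CR_on a b c d -> a <= x <= b ->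
  ctson c d (fun y => v x y).
Proof. by move=> H xab y ycd; have [] := half_CR_cont (H _ _ xab ycd). Qed.

Lemma boundQ_splitx a b c d e : a <= e -> e <= b -> c <= d -> CR_on a b c d ->
  boundQ a b c d = boundQ a e c d + boundQ e b c d.
Proof.
move=> ae eb cd H; have ab := le_trans ae eb; rewrite /boundQ.
rewrite (@Iab_split _ a b e)//; last first.
  by apply: ctsonB; apply: (CR_on_ctu H); rewrite ?lexx ?cd.
have H1 : CR_on a e c d by apply: CR_onS H.
have H2 : CR_on e b c d by apply: CR_onS H.
rewrite !IabB//; last first.
all: try by [apply: (CR_on_ctv H); rewrite ?lexx ?ab ?ae ?eb|
  apply: (CR_on_ctu H1); rewrite ?lexx ?cd|apply: (CR_on_ctu H2); rewrite ?lexx ?cd].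
by ring.
Qed.

Lemma boundQ_splity a b c d e : c <= e -> e <= d -> a <= b -> CR_on a b c d ->
  boundQ a b c d = boundQ a b c e + boundQ a b e d.
Proof.
move=> ce ed ab H; have cd := le_trans ce ed; rewrite /boundQ.
rewrite (@Iab_split _ c d e)//; last first.
  by apply: ctsonB; apply: (CR_on_ctv H); rewrite ?lexx ?ab.
rewrite (@IabB _ a b (u^~ d) (u^~ c)) ?(@IabB _ a b (u^~ d) (u^~ e))
  ?(@IabB _ a b (u^~ e) (u^~ c));
  try (by apply: (CR_on_ctu H); rewrite ?lexx ?cd ?ce ?ed).
by ring.
Qed.

(** Goursat's quartering: some quarter keeps at least a fourth of the boundary integral, while at
    the limit point the linear parts of [u] and [v] cancel and leave [o] of the squared size, which
    the factor [4^n] cannot compensate. *)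
Lemma goursat (a b c d : R) : a <= b -> c <= d -> CR_on a b c d ->
  boundQ a b c d = 0.
Proof.
move=> ab cd H; apply/eqP; rewrite -normr_eq0; apply/eqP.
set q0 := `|_|.
pose w := b - a; pose h := d - c.
have w0 : 0 <= w by rewrite subr_ge0.
have h0 : 0 <= h by rewrite subr_ge0.
pose P n x y := [/\ q0 <= 4 ^+ n * `|boundQ x (x + w / 2 ^+ n) y (y + h / 2 ^+ n)|,
  a <= x, x + w / 2 ^+ n <= b, c <= y & y + h / 2 ^+ n <= d].
have p2 n : (0 : R) < 2 ^+ n by rewrite exprn_gt0.
have halves (k : R) n : k / 2 ^+ n = k / 2 ^+ n.+1 + k / 2 ^+ n.+1.
  rewrite exprS invfM mulrCA -mulrDl.
  by rewrite (_ : 2^-1 + 2^-1 = 1 :> R) ?mul1r//; lra.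
have [||xs [ys Hs]] := @bisection R P w h a c w0 h0.
- rewrite /P !expr0 !divr1 mul1r /w /h; split=> //; rewrite ?subrKC//.
- move=> n x y [qn ax xb cy yd].
  have wn : 0 <= w / 2 ^+ n.+1 by rewrite divr_ge0// ltW.
  have hn : 0 <= h / 2 ^+ n.+1 by rewrite divr_ge0// ltW.
  move: qn xb yd; rewrite (halves w n) (halves h n) !addrA.
  set wn' := w / _ in wn *; set hn' := h / _ in hn * => qn xb yd.
  have HC : CR_on x (x + wn' + wn') y (y + hn' + hn') by apply: CR_onS H.
  have e1 : boundQ x (x + wn' + wn') y (y + hn' + hn') =
     (boundQ x (x + wn') y (y + hn') + boundQ x (x + wn') (y + hn') (y + hn' + hn'))
     + (boundQ (x + wn') (x + wn' + wn') y (y + hn') +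
        boundQ (x + wn') (x + wn' + wn') (y + hn') (y + hn' + hn')).
    rewrite (@boundQ_splitx _ _ _ _ (x + wn')) ?lerDl//; last by rewrite -addrA lerDl addr_ge0.
    rewrite (@boundQ_splity _ _ _ _ (y + hn')) ?lerDl//; last first.
      by apply: CR_onS HC; rewrite ?lexx ?lerDl.
    rewrite (@boundQ_splity (x + wn') _ _ _ (y + hn')) ?lerDl//.
    by apply: CR_onS HC; rewrite ?lexx ?lerDl.
  rewrite e1 in qn.
  have : [\/ q0 <= 4 ^+ n.+1 * `|boundQ x (x + wn') y (y + hn')|,
     q0 <= 4 ^+ n.+1 * `|boundQ x (x + wn') (y + hn') (y + hn' + hn')|,
     q0 <= 4 ^+ n.+1 * `|boundQ (x + wn') (x + wn' + wn') y (y + hn')| |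
     q0 <= 4 ^+ n.+1 * `|boundQ (x + wn') (x + wn' + wn') (y + hn') (y + hn' + hn')|].
    move: qn; rewrite exprS.
    move: (boundQ x (x + wn') y (y + hn')) => A.
    move: (boundQ x (x + wn') (y + hn') _) => B.
    move: (boundQ (x + wn') _ y (y + hn')) => A'.
    move: (boundQ (x + wn') _ (y + hn') _) => B'.
    move=> qn; move: qn.
    have := ler_normD (A + B) (A' + B'); have := ler_normD A B.
    have := ler_normD A' B'.
    have : (0 : R) < 4 ^+ n by rewrite exprn_gt0.
    move: (4 ^+ n) => k k0 i1 i2 i3 i4.
    have {}i4 : q0 <= k * (`|A| + `|B| + (`|A'| + `|B'|)).
      by rewrite (le_trans i4)// ler_pM2l//; lra.
    have [?|j1] := leP q0 (4 * k * `|A|); first by constructor 1.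
    have [?|j2] := leP q0 (4 * k * `|B|); first by constructor 2.
    have [?|j3] := leP q0 (4 * k * `|A'|); first by constructor 3.
    have [?|j4] := leP q0 (4 * k * `|B'|); first by constructor 4.
    exfalso; lra.
  have bx1 : a <= x + wn' by rewrite (le_trans ax)// lerDl.
  have bx2 : x + wn' <= b by rewrite (le_trans _ xb)// lerDl.
  have by1 : c <= y + hn' by rewrite (le_trans cy)// lerDl.
  have by2 : y + hn' <= d by rewrite (le_trans _ yd)// lerDl.
  by case=> K; [exists x, y|exists x, (y + hn')|exists (x + wn'), y|
     exists (x + wn'), (y + hn')]; split; rewrite ?lexx ?lerDl ?wn ?hn//; split.
have rs : half_CR xs ys.
  have [x [y [[_ ? ? ? ?] /andP[x1 x2] /andP[y1 y2]]]] := Hs 0%N.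
  apply: H; apply/andP; split.
  - exact: le_trans x1.
  - exact: le_trans x2 _.
  - exact: le_trans y1.
  - exact: le_trans y2 _.
case: rs => p [q [r rs]].
(* The vertical sides contribute [p * wn * hn] and the horizontal ones its opposite, up to an error
   of order [e (wn + hn)^2]; the factor [4^n] turns [wn] and [hn] back into [w] and [h]. *)
have key e : 0 < e -> q0 <= e * (2 * (w + h) ^+ 2).
  move=> e0; have [del del0 {}rs] := rs e e0.
  have [n nd] : exists n, (w + h) / 2 ^+ n < del.
    exists (Num.bound ((w + h) / del)).
    rewrite ltr_pdivrMr// mulrC -ltr_pdivrMr//.
    have k0 : 0 <= (w + h) / del by apply: divr_ge0; [exact: addr_ge0|exact: ltW].
    apply: (lt_le_trans (archi_boundP k0)).
    rewrite -natrX ler_nat; exact/ltnW/ltn_expl.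
  have [x [y [[qn ? ? ? ?] /andP[x1 x2] /andP[y1 y2]]]] := Hs n.
  move: qn x2 y2 nd; rewrite [(w + h) / _]mulrDl.
  have -> : (4 : R) ^+ n = 2 ^+ n * 2 ^+ n.
    by rewrite -exprMn; congr (_ ^+ _); lra.
  have wn0 : 0 <= w / 2 ^+ n by rewrite divr_ge0// ltW.
  have hn0 : 0 <= h / 2 ^+ n by rewrite divr_ge0// ltW.
  move=> qn x2 y2 nd; apply: (le_trans qn).
  have HC : CR_on x (x + w / 2 ^+ n) y (y + h / 2 ^+ n) by apply: CR_onS H.
  set wn := w / _ in wn0 x2 nd HC *; set hn := h / _ in hn0 y2 nd HC *.
  have xsx : x <= xs <= x + wn by rewrite x1.
  have ysy : y <= ys <= y + hn by rewrite y1.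
  have bx z : x <= z <= x + wn -> `|z - xs| < del /\ `|z - xs| <= wn.
    move=> zx; have D := dist_itv zx xsx; split=> //.
    by apply: le_lt_trans nd; apply: (le_trans D); rewrite lerDl.
  have bY z : y <= z <= y + hn -> `|z - ys| < del /\ `|z - ys| <= hn.
    move=> zy; have D := dist_itv zy ysy; split=> //.
    by apply: le_lt_trans nd; apply: (le_trans D); rewrite lerDr.
  have xx : x <= x <= x + wn by rewrite lexx lerDl.
  have xw : x <= x + wn <= x + wn by rewrite lexx lerDl wn0.
  have yy : y <= y <= y + hn by rewrite lexx lerDl.
  have yh : y <= y + hn <= y + hn by rewrite lexx lerDl hn0.
  have I1 : `|Iab y (y + hn) (fun t => v (x + wn) t - v x t) - p * wn * hn|
      <= 2 * e * (wn + hn) * hn.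
    have := @Iab_near_cst R y (y + hn) (fun t => v (x + wn) t - v x t)
      (p * wn) (2 * e * (wn + hn)); rewrite (_ : y + hn - y = hn); last lra.
    apply.
    - by rewrite lerDl.
    - by apply: ctsonB; exact: (CR_on_ctv HC).
    - move=> t ty; have [t1 t2] := bY t ty.
      have [s1 s2] := bx _ xx; have [r1 r2] := bx _ xw.
      have [k1 _] := rs _ _ s1 t1; have [k2 _] := rs _ _ r1 t1.
      have {}k1 := le_trans k1 (ler_wpM2l (ltW e0) (lerD s2 t2)).
      have {}k2 := le_trans k2 (ler_wpM2l (ltW e0) (lerD r2 t2)).
      have := le_trans (ler_normB _ _) (lerD k2 k1).
      by congr (`|_| <= _); ring.
  have I2 : `|Iab x (x + wn) (fun t => u t (y + hn) - u t y) - (- p * hn) * wn|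
      <= 2 * e * (wn + hn) * wn.
    have := @Iab_near_cst R x (x + wn) (fun t => u t (y + hn) - u t y)
      (- p * hn) (2 * e * (wn + hn)); rewrite (_ : x + wn - x = wn); last lra.
    apply.
    - by rewrite lerDl.
    - by apply: ctsonB; exact: (CR_on_ctu HC).
    - move=> t tx; have [t1 t2] := bx t tx.
      have [s1 s2] := bY _ yy; have [r1 r2] := bY _ yh.
      have [_ k1] := rs _ _ t1 s1; have [_ k2] := rs _ _ t1 r1.
      have {}k1 := le_trans k1 (ler_wpM2l (ltW e0) (lerD t2 s2)).
      have {}k2 := le_trans k2 (ler_wpM2l (ltW e0) (lerD t2 r2)).
      have := le_trans (ler_normB _ _) (lerD k2 k1).
      by congr (`|_| <= _); ring.
  have Qn : `|boundQ x (x + wn) y (y + hn)| <= 2 * e * (wn + hn) ^+ 2.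
    rewrite /boundQ; move: I1 I2; move: (Iab y _ _) (Iab x _ _) => i1 i2.
    rewrite !ler_norml => /andP[? ?] /andP[? ?]; apply/andP; split; lra.
  have k20 : 0 <= (2 : R) ^+ n * 2 ^+ n by apply: mulr_ge0; exact: ltW.
  apply: (le_trans (ler_wpM2l k20 Qn)).
  have -> : w = wn * 2 ^+ n by rewrite /wn divfK// gt_eqF.
  have -> : h = hn * 2 ^+ n by rewrite /hn divfK// gt_eqF.
  by rewrite le_eqVlt; apply/orP; left; apply/eqP; ring.
apply/eqP; rewrite eq_le normr_ge0 andbT; apply/ler_addgt0Pl => e e0.
rewrite addr0; have k0 : 0 < 2 * (w + h) ^+ 2 + 1.
  by rewrite ltr_wpDl// mulr_ge0// sqr_ge0.
rewrite (le_trans (key (e / (2 * (w + h) ^+ 2 + 1)) _)) ?divr_gt0//.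
rewrite mulrAC ler_pdivrMr// ler_wpM2l ?(ltW e0)//.
by rewrite lerDl.
Qed.

End goursat.

(** * Complex differentiability and logarithmic coordinates *)

Section complex_diff.
Context {R : realType}.
Notation C := R[i].
Implicit Types (f g h : C -> C) (z : C).

(** The increment form of [derivable], with real [e] and radii, so that no quotient by the increment
    appears in estimates. *)
Definition cdiff f z := exists d : C, forall e : R, 0 < e ->
  exists2 del : R, 0 < del & forall k, N k < del ->
    N (f (z + k) - f z - d * k) <= e * N k.

Definition ccont f z := forall e : R, 0 < e ->
  exists2 del : R, 0 < del & forall k, N k < del -> N (f (z + k) - f z) < e.

Lemma posC (e : C) : 0 < e -> exists2 r : R, 0 < r & e = r%:C.
Proof.
case: e => a b; rewrite ltcE /= => /andP[/eqP -> a0].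
by exists a.
Qed.

Lemma cvgC_P (T : Type) (F : set_system T) (FF : Filter F) (f : T -> C) (l : C) :
  f x @[x --> F] --> (l : C^o) <->
  forall e : R, 0 < e -> \forall x \near F, N (l - f x) < e.
Proof.
split=> [/(@cvgrPdist_lt _ C^o _ _ FF f l) H e e0|H].
  have e0' : 0 < e%:C by rewrite ltcR.
  by have := H _ e0'; apply: filterS => x; rewrite normE ltcR.
apply/(@cvgrPdist_lt _ C^o _ _ FF f l) => e /posC[r r0 ->].
by have := H r r0; apply: filterS => x; rewrite normE ltcR.
Qed.

Lemma nbhsC_P z (A : set C) : nbhs (z : C^o) A <->
  exists2 del : R, 0 < del & forall k, N k < del -> A (z + k).
Proof.
split=> [/nbhs_ballP[e /= /posC[r r0 ->] H]|[r r0 H]].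
  exists r => // k kr; apply: H.
  by rewrite -ball_normE /ball_ /= opprD addrA subrr add0r normrN normE ltcR.
apply/nbhs_ballP; exists r%:C; first by rewrite /= ltcR.
move=> y; rewrite -ball_normE /ball_ /= normE ltcR => yr.
have -> : y = z + (y - z) by rewrite addrC subrK.
by apply: H; rewrite NBC.
Qed.

Lemma derivable_cdiff f z : derivable (f : C^o -> C^o) z 1 <-> cdiff f z.
Proof.
split.
  move=> /cvg_ex[/= d /cvgC_P H]; exists d => e e0.
  have := H e e0; rewrite /dnbhs withinE => -[V /nbhsC_P[del del0 HV] EV].
  exists del => // k kd.
  have [->|k0] := eqVneq k 0; first by rewrite addr0 subrr mulr0 subr0 N0 mulr0.
  have := HV k kd; rewrite add0r => Vk.
  have : (V `&` [set x | x != 0]) k by [].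
  rewrite -EV => -[/= + _].
  rewrite scaler1 /shift /= (addrC k z) NBC -[_ *: _]/(_ * _) => Hk.
  rewrite (_ : _ - _ - d * k = k * (k^-1 * (f (z + k) - f z) - d)); last first.
    by rewrite mulrBr mulrA divff// mul1r (mulrC k).
  by rewrite NM mulrC ler_wpM2r ?N_ge0// ltW.
move=> [d H]; apply/cvg_ex; exists d; apply/cvgC_P => e e0.
have e2 : 0 < e / 2 by rewrite divr_gt0.
have [del del0 Hd] := H _ e2.
rewrite near_withinE /=; apply/nbhsC_P; exists del => // k kd; rewrite add0r => k0.
rewrite scaler1 /shift /= (addrC k z) NBC -[_ *: _]/(_ * _).
have := Hd k kd.
rewrite (_ : _ - _ - d * k = k * (k^-1 * (f (z + k) - f z) - d)); last first.
  by rewrite mulrBr mulrA divff// mul1r (mulrC k).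
rewrite NM mulrC ler_pM2r ?N_gt0// => /le_lt_trans; apply.
by rewrite ltr_pdivrMr// ltr_pMr// ltr1n.
Qed.

Lemma cdiff_cont f z : cdiff f z -> ccont f z.
Proof.
move=> [d H] e e0; have [del del0 Hd] := H 1 ltr01.
have k0 : 0 < 1 + N d by rewrite ltr_wpDr ?N_ge0.
exists (Num.min del (e / (1 + N d))); first by rewrite lt_min del0 divr_gt0.
move=> k; rewrite lt_min ltr_pdivlMr// => /andP[k1 k2].
have := Hd k k1; rewrite mul1r => H1.
rewrite -(subrK (d * k) (f (z + k) - f z)).
by rewrite (le_lt_trans (ND _ _))// NM; lra.
Qed.

Lemma cdiff_cst c z : cdiff (fun=> c) z.
Proof. by apply/derivable_cdiff; exact: derivable_cst. Qed.

Lemma cdiff_id z : cdiff id z.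
Proof. by apply/derivable_cdiff; exact: derivable_id. Qed.

Lemma cdiffD f g z : cdiff f z -> cdiff g z -> cdiff (fun x => f x + g x) z.
Proof. by move=> /derivable_cdiff df /derivable_cdiff dg; apply/derivable_cdiff/derivableD. Qed.

Lemma cdiffB f g z : cdiff f z -> cdiff g z -> cdiff (fun x => f x - g x) z.
Proof. by move=> /derivable_cdiff df /derivable_cdiff dg; apply/derivable_cdiff/derivableB. Qed.

Lemma cdiffM f g z : cdiff f z -> cdiff g z -> cdiff (fun x => f x * g x) z.
Proof.
move=> /derivable_cdiff df /derivable_cdiff dg; apply/derivable_cdiff.
exact: (derivableM df dg).
Qed.

Lemma cdiffV f z : f z != 0 -> cdiff f z -> cdiff (fun x => (f x)^-1) z.
Proof.
move=> f0 /derivable_cdiff df; apply/derivable_cdiff.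
exact: (derivableV f0 df).
Qed.

Lemma cdiff_near f g z : (exists2 del : R, 0 < del &
    forall k, N k < del -> f (z + k) = g (z + k)) -> cdiff f z -> cdiff g z.
Proof.
move=> [del del0 fg] [d H]; exists d => e e0; have [del' del'0 H'] := H e e0.
exists (Num.min del del'); first by rewrite lt_min del0.
move=> k; rewrite lt_min => /andP[k1 k2].
rewrite -fg//; have := fg 0; rewrite N0 addr0 => <-//.
exact: H'.
Qed.

(** The first order expansion of [exp (a + i b)] at [0], assembled from the real derivatives of
    [expR], [cos] and [sin]. The auxiliary [ee] is capped at 1 and also bounds [a] and [b], so that
    products of two increments are absorbed. *)
Lemma polar_expansion (e : R) : 0 < e -> exists2 del : R, 0 < del &
  forall a b : R, `|a| < del -> `|b| < del ->
   N ((expR a)%:C * cis b - 1 - (a +i* b)) <= e * (`|a| + `|b|).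
Proof.
move=> e0.
have D (F : R -> R) (dF : R) : is_derive (0 : R) (1 : R) F dF -> forall e : R, 0 < e ->
    exists2 del : R, 0 < del & forall a, `|a| < del -> `|F a - F 0 - dF * a| <= e * `|a|.
  move=> [dF1 <-] e1 e10.
  have [dd ddE] : exists2 dd, dd = 'D_1 F 0 &
      (h^-1 *: ((F \o shift 0) (h *: 1) - F 0) @[h --> 0^'] --> dd).
    by exists ('D_1 F 0).
  rewrite -ddE => /cvgrPdist_le /(_ e1 e10).
  rewrite /dnbhs withinE => -[V /nbhs_ballP[del /= del0 HV] EV].
  exists del => // a ad.
  have [->|a0] := eqVneq a 0; first by rewrite subrr mulr0 subr0 normr0 mulr0.
  have Va : V a.
    by apply: HV; rewrite -ball_normE /ball_ /= sub0r normrN.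
  have : (V `&` [set x | x != 0]) a by [].
  rewrite -EV => -[/= + _].
  rewrite -[_ *: 1]/(_ * 1) mulr1 /shift /= addr0 -[_ *: _]/(_ * _) => Ha.
  rewrite (_ : _ - _ - _ * a = a * (a^-1 * (F a - F 0) - dd)); last first.
    by rewrite mulrBr mulrA divff// mul1r (mulrC a).
  by rewrite normrM mulrC ler_wpM2r// distrC.
have [ee [ee0 ee8 ee1]] : exists ee : R, [/\ 0 < ee, ee <= e / 8 & ee <= 1].
  exists (Num.min (e / 8) 1).
  by rewrite lt_min !ge_min !lexx ?orbT divr_gt0//=.
have [d1 d10 H1] := D _ _ (is_derive_expR 0) ee ee0.
have [d2 d20 H2] := D _ _ (is_derive_cos 0) ee ee0.
have [d3 d30 H3] := D _ _ (is_derive_sin 0) ee ee0.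
exists (Num.min ee (Num.min d1 (Num.min d2 d3))).
  by rewrite !lt_min ee0 d10 d20 d30.
move=> a b; rewrite !lt_min => /and4P[ae ad1 _ _] /and4P[be _ bd2 bd3].
have := H1 a ad1; rewrite expR0 mul1r => K1.
have := H2 b bd2; rewrite cos0 sin0 oppr0 mul0r subr0 => K2.
have := H3 b bd3; rewrite sin0 cos0 mul1r subr0 => K3.
have c1 : `|cos b| <= 1 by rewrite ler_norml cos_geN1 cos_le1.
apply: (le_trans (N_leReIm _)).
rewrite !ReD !ImD !ReN !ImN ReM ImM /= mul0r subr0 mul0r addr0 oppr0 addr0.
have -> : expR a * cos b - 1 - a =
   (expR a - 1 - a) * cos b + (1 + a) * (cos b - 1) by ring.
have -> : expR a * sin b - b =
   (expR a - 1 - a) * sin b + a * sin b + (sin b - b) by ring.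
have na := normr_ge0 a; have nb := normr_ge0 b.
have A1 : `|(expR a - 1 - a) * cos b + (1 + a) * (cos b - 1)| <=
    ee * `|a| + 2 * (ee * `|b|).
  apply: (le_trans (ler_normD _ _)); rewrite !normrM lerD//.
    by rewrite -[leRHS]mulr1 ler_pM.
  rewrite ler_pM//; apply: (le_trans (ler_normD _ _)); rewrite normr1; lra.
have sb : `|sin b| <= 2 * `|b|.
  rewrite -(subrK b (sin b)); apply: (le_trans (ler_normD _ _)).
  have : ee * `|b| <= 1 * `|b| by rewrite ler_wpM2r.
  lra.
have A2 : `|(expR a - 1 - a) * sin b + a * sin b + (sin b - b)| <=
    ee * `|a| + ee * (2 * `|b|) + ee * `|b|.
  apply: (le_trans (ler_normD _ _)); rewrite lerD//.
  apply: (le_trans (ler_normD _ _)); rewrite !normrM lerD//.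
    rewrite -[leRHS]mulr1 ler_pM// ler_norml sin_geN1 sin_le1//.
  by rewrite ler_pM// ltW.
have ea : ee * `|a| <= e / 8 * `|a| by rewrite ler_wpM2r.
have eb : ee * `|b| <= e / 8 * `|b| by rewrite ler_wpM2r.
have := mulr_ge0 (ltW e0) na; have := mulr_ge0 (ltW e0) nb; lra.
Qed.

(** The exponential of [x + i t]: circles around [0] become vertical segments, so the theorem for
    rectangles applies to annuli. *)
Definition polar (x t : R) : C := (expR x)%:C * cis t.

Lemma N_polar x t : N (polar x t) = expR x.
Proof. by rewrite /polar NM Ncis NR mulr1 ger0_norm// expR_ge0. Qed.

Lemma polar_diff h x0 t0 : cdiff h (polar x0 t0) ->
  exists kappa : C, forall e : R, 0 < e -> exists2 del : R, 0 < del &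
    forall x t, `|x - x0| < del -> `|t - t0| < del ->
    N (h (polar x t) - h (polar x0 t0) - kappa * ((x - x0) +i* (t - t0))) <=
    e * (`|x - x0| + `|t - t0|).
Proof.
set z0 := polar x0 t0; move=> [d Hd]; exists (d * z0) => e e0.
have Nz : 0 < N z0 by rewrite N_polar expR_gt0.
pose e1 := Num.min 1 (e / 2 / (1 + N d * N z0)).
have q0 : 0 < 1 + N d * N z0 by rewrite ltr_wpDr// mulr_ge0// N_ge0.
have e10 : 0 < e1 by rewrite lt_min ltr01 !divr_gt0.
have [d1 d10 H1] := polar_expansion e10.
pose e2 := e / 4 / N z0.
have e20 : 0 < e2 by rewrite !divr_gt0.
have [d2 d20 H2] := Hd e2 e20.
exists (Num.min d1 (d2 / (4 * N z0))).
  by rewrite lt_min d10 divr_gt0// mulr_gt0.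
move=> x t; rewrite !lt_min => /andP[xd1 xd2] /andP[td1 td2].
have := H1 _ _ xd1 td1.
set a := x - x0 in xd1 xd2 *; set b := t - t0 in td1 td2 *.
pose E := (expR a)%:C * cis b - 1.
rewrite -/E => HE.
have kE : polar x t = z0 + z0 * E.
  rewrite /E /z0 /polar mulrBr mulr1 addrC subrK.
  rewrite (_ : x = x0 + a) 1?(_ : t = t0 + b); [|by rewrite /a /b addrC subrK..].
  by rewrite expRD cisD rmorphM /= mulrACA.
have na := normr_ge0 a; have nb := normr_ge0 b.
have NE : N E <= 2 * (`|a| + `|b|).
  rewrite -(subrK (a +i* b) E); apply: (le_trans (ND _ _)).
  have : N (a +i* b) <= `|a| + `|b| by exact: N_leReIm.
  have : e1 * (`|a| + `|b|) <= 1 * (`|a| + `|b|).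
    by rewrite ler_wpM2r ?addr_ge0// ge_min lexx.
  lra.
have NzE : N (z0 * E) <= 2 * N z0 * (`|a| + `|b|).
  by rewrite NM -mulrA mulrCA ler_wpM2l ?N_ge0.
have Nd2 : N (z0 * E) < d2.
  apply: (le_lt_trans NzE); move: xd2 td2.
  rewrite !ltr_pdivlMr ?mulr_gt0// => ? ?; lra.
have := H2 _ Nd2; rewrite -kE => K2.
rewrite (_ : _ - _ - _ = (h (polar x t) - h z0 - d * (z0 * E)) +
    d * z0 * (E - (a +i* b))); last by ring.
apply: (le_trans (ND _ _)).
have K3 : N (d * z0 * (E - (a +i* b))) <= e / 2 * (`|a| + `|b|).
  rewrite (NM (d * z0)) (NM d); apply: (@le_trans _ _ ((1 + N d * N z0) * (e1 * (`|a| + `|b|)))).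
    by rewrite ler_pM// ?mulr_ge0 ?N_ge0// lerDr.
  rewrite mulrA ler_wpM2r ?addr_ge0// mulrC -ler_pdivlMr//.
  by rewrite ge_min lexx orbT.
have K4 : e2 * N (z0 * E) <= e / 2 * (`|a| + `|b|).
  apply: (le_trans (ler_wpM2l (ltW e20) NzE)).
  rewrite /e2 le_eqVlt; apply/orP; left; apply/eqP; field.
  by rewrite gt_eqF.
lra.
Qed.

(** The two pairs are the components of [h] and of [i h]; one equation for each gives both
    components of an integral over a circle. *)
Lemma polar_half_CR h x0 t0 : cdiff h (polar x0 t0) ->
  half_CR (fun x t => Re (h (polar x t))) (fun x t => Im (h (polar x t))) x0 t0
  /\ half_CR (fun x t => - Im (h (polar x t))) (fun x t => Re (h (polar x t))) x0 t0.
Proof.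
move=> /polar_diff[k Hk]; split.
  exists (Im k), (Re k), (Re k) => e e0; have [del del0 H] := Hk e e0.
  exists del => // x t xd td; have {}H := H x t xd td.
  split; apply: (le_trans _ H).
    by apply: le_trans (normIm _); rewrite !ImD !ImN ImM /= [Im k * _ + _]addrC.
  by apply: le_trans (normRe _); rewrite !ReD !ReN ReM.
exists (Re k), (- Im k), (- Im k) => e e0; have [del del0 H] := Hk e e0.
exists del => // x t xd td; have {}H := H x t xd td.
split; apply: (le_trans _ H).
  by apply: le_trans (normRe _); rewrite !ReD !ReN ReM /= mulNr.
apply: le_trans (normIm _); rewrite -normrN !ImD !ImN ImM /=.
by rewrite le_eqVlt; apply/orP; left; apply/eqP; congr `|_|; ring.
Qed.

End complex_diff.

(** * Mean values over circles *)

Section mean_value.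
Context {R : realType}.
Notation C := R[i].
Notation T := (measurableTypeR R).
Local Notation m := (circle_measure R).

Definition cctn (w : R -> C) := continuous (fun t => Re (w t)) /\
  continuous (fun t => Im (w t)).

Lemma cctnP (w : R -> C) : cctn w <->
  forall t (e : R), 0 < e -> \forall s \near t, N (w t - w s) < e.
Proof.
split.
  move=> [cr ci] t e e0; have e2 : 0 < e / 2 by rewrite divr_gt0.
  near=> s; apply: (le_lt_trans (N_leReIm _)); rewrite (splitr e).
  rewrite ReD ReN ImD ImN ltrD//; near: s.
    exact: (@cvgr_dist_lt _ _ _ _ _ _ _ (cr t) _ e2).
  exact: (@cvgr_dist_lt _ _ _ _ _ _ _ (ci t) _ e2).
move=> H; split=> t; apply/cvgrPdist_lt => e e0.
  have := H t e e0; apply: filterS => s; apply: le_lt_trans.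
  by rewrite -ReN -ReD normRe.
have := H t e e0; apply: filterS => s; apply: le_lt_trans.
by rewrite -ImN -ImD normIm.
Unshelve. all: by end_near. Qed.

Lemma cctn_meas (w : T -> C) : cctn w -> cmeas w.
Proof. by move=> [a b]; split; exact: continuous_measurable_fun. Qed.

Lemma cctn_comp (h : C -> C) (g : R -> C) :
  (forall t, ccont h (g t)) -> cctn g -> cctn (fun t => h (g t)).
Proof.
move=> hc /cctnP gc; apply/cctnP => t e e0; have [del del0 H] := hc t e e0.
have := gc t del del0; apply: filterS => s gs.
rewrite NBC -(subrKC (g t) (g s)); apply: H.
by rewrite NBC.
Qed.

Lemma cctn_cst c : cctn (fun=> c).
Proof. by split => t; exact: cvg_cst. Qed.

Lemma cctnM u w : cctn u -> cctn w -> cctn (fun t => u t * w t).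
Proof.
move=> [a b] [a' b']; split.
  under eq_fun do rewrite ReM.
  by move=> t; apply: cvgB; apply: cvgM; [exact: a|exact: a'|exact: b|exact: b'].
under eq_fun do rewrite ImM.
by move=> t; apply: cvgD; apply: cvgM; [exact: a|exact: b'|exact: b|exact: a'].
Qed.

Lemma cctn_cis : cctn (@cis R).
Proof. by split; [exact: continuous_cos|exact: continuous_sin]. Qed.

Lemma cctn_conj w : cctn w -> cctn (fun t => (cj (w t))).
Proof.
move=> [a b]; split; first by under eq_fun do rewrite Reconj.
under eq_fun do rewrite Imconj.
by move=> t; apply: cvgN; exact: b.
Qed.

Lemma cctn_circle r : cctn (fun t => r%:C * cis t).
Proof. by apply: cctnM; [exact: cctn_cst|exact: cctn_cis]. Qed.

Lemma N_circle r t : 0 <= r -> N (r%:C * cis t : C) = r.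
Proof. by move=> r0; rewrite NM Ncis NR mulr1 ger0_norm. Qed.

Lemma circle_cst (c : R) : \int[m]_t c = c.
Proof.
rewrite Rintegral_cst// -[RHS]mulr1; congr (_ * _).
exact: (congr1 fine circle_setT).
Qed.

Lemma cis_repr (t : R) : exists2 t' : R, 0 <= t' <= 2 * pi & cis t' = cis t.
Proof.
have c1 : -1 <= cos t <= 1 by rewrite cos_geN1 cos_le1.
have pi0 := @pi_ge0 R.
have a0 := acos_ge0 c1; have a1 := acos_lepi c1.
have ca := acosK c1.
have sa : sin (acos (cos t)) = `|sin t|.
  by rewrite sin_acos// -sin2cos2 sqrtr_sqr.
have [s0|s0] := leP 0 (sin t).
  exists (acos (cos t)); first by rewrite a0/=; lra.
  by rewrite /cis ca sa ger0_norm.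
exists (2 * pi - acos (cos t)); first by apply/andP; split; lra.
rewrite addrC cis2pi cisN /cis ca sa ltr0_norm//=.
by rewrite opprK.
Qed.

Lemma circ_bnd (g : C -> C) : cctn (fun t => g (cis t)) ->
  exists2 M : R, 0 <= M & forall t, N (g (cis t)) <= M.
Proof.
move=> /cctnP gc; have h0 : 0 <= 2 * pi :> R by rewrite mulr_ge0// pi_ge0.
have [|c cI cM] := @EVT_max R (fun t => N (g (cis t))) 0 (2 * pi) h0.
  apply: continuous_subspaceT => t; apply/cvgrPdist_lt => e e0.
  have := gc t e e0; apply: filterS => s; apply: le_lt_trans.
  rewrite ler_norml; apply/andP; split; last exact: N_leB.
  by rewrite lerNl opprB NBC N_leB.
exists (N (g (cis c))); first exact: N_ge0.
move=> t; have [t' tI <-] := cis_repr t.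
by apply: cM; rewrite in_itv.
Qed.

Lemma circle_Iab (f : R -> R) : continuous f ->
  \int[m]_t f t = (2 * pi)^-1 * Iab 0 (2 * pi) f.
Proof.
move=> cf.
have mf : measurable_fun setT (f : T -> R) by exact: continuous_measurable_fun.
have mp : measurable_fun setT (EFin \o (f : T -> R)) by exact/measurable_EFinP.
have fi : (@lebesgue_measure R).-integrable `[0, (2 * pi)] (EFin \o f).
  by apply: ctson_int => x _; exact: cf.
have mI : measurable (`[0%R, 2 * pi]%classic : set T) by exact: measurable_itv.
have p1 := integrable_pos_fin_num mI fi.
have n1 := integrable_neg_fin_num mI fi.
rewrite /Iab /Rintegral [in RHS]integralE [in LHS]integralE.
rewrite /circle_measure !integral_uniform//.
- rewrite subr0 -muleBr//; last by rewrite fin_num_adde_defr.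
  by rewrite fineM// fin_numB; apply/andP; split.
- by apply: measurable_funeneg.
- by apply: measurable_funepos.
Qed.

(** Compactness by bisection: if no radius [del] served the whole circle, none would serve the arcs
    of some nested sequence, against continuity at their common point. *)
Lemma uniform_circle (h : C -> C) (r0 e : R) : 0 <= r0 -> r0 < 1 -> 0 < e ->
  (forall z, N z < 1 -> ccont h z) ->
  exists2 del : R, 0 < del & forall r, `|r - r0| < del ->
   forall t, 0 <= t <= 2 * pi -> N (h (r%:C * cis t) - h (r0%:C * cis t)) <= e.
Proof.
move=> r00 r01 e0 hc; apply: contrapT => nH.
pose Q (del a b : R) := forall r, `|r - r0| < del ->
   forall t, a <= t <= b -> N (h (r%:C * cis t) - h (r0%:C * cis t)) <= e.
pose P n (x y : R) := ~ exists2 del : R, 0 < del & Q del y (y + 2 * pi / 2 ^+ n).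
have h0 : 0 <= 2 * pi :> R by rewrite mulr_ge0// pi_ge0.
have halves (k : R) n : k / 2 ^+ n = k / 2 ^+ n.+1 + k / 2 ^+ n.+1.
  rewrite exprS invfM mulrCA -mulrDl.
  by rewrite (_ : 2^-1 + 2^-1 = 1 :> R) ?mul1r//; lra.
have [||xs [ts Hs]] := @bisection R P 0 (2 * pi) 0 0 (lexx _) h0.
- by rewrite /P expr0 divr1 add0r.
- move=> n x y Pn; exists x.
  have hn : 0 <= 2 * pi / 2 ^+ n.+1 :> R by rewrite divr_ge0// exprn_ge0.
  have [P1|/contrapT[d1 d10 Q1]] := pselect (P n.+1 x y).
    by exists y; split=> //; rewrite ?mul0r ?addr0 ?lexx ?lerDl.
  exists (y + 2 * pi / 2 ^+ n.+1); split; last 2 first.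
    by rewrite mul0r addr0 lexx.
    by rewrite lexx lerDl hn.
  move=> [d2 d20 Q2]; apply: Pn; exists (Num.min d1 d2); first by rewrite lt_min d10.
  move=> r; rewrite lt_min => /andP[r1 r2] t /andP[t1]; rewrite halves addrA => t2.
  have [tt|tt] := leP t (y + 2 * pi / 2 ^+ n.+1).
    by apply: Q1 => //; rewrite t1.
  by apply: Q2 => //; rewrite (ltW tt).
have z01 : N (r0%:C * cis ts : C) < 1 by rewrite N_circle.
have e2 : 0 < e / 2 by rewrite divr_gt0.
have [del del0 H] := hc _ z01 _ e2.
have d2 : 0 < del / 2 by rewrite divr_gt0.
have /cctnP /(_ ts _ d2) /nbhs_ballP[eta /= eta0 Heta] := cctn_cis.
have {}Heta t : `|t - ts| < eta -> N (cis t - cis ts : C) < del / 2.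
  by move=> tt; rewrite NBC; apply: Heta; rewrite -ball_normE /ball_/= distrC.
have [n nd] : exists n, 2 * pi / 2 ^+ n < eta.
  exists (Num.bound ((2 * pi) / eta)).
  rewrite ltr_pdivrMr ?exprn_gt0// [eta * _]mulrC -ltr_pdivrMr//.
  have k0 : 0 <= (2 * pi) / eta by apply: divr_ge0; [exact: h0|exact: ltW].
  apply: (lt_le_trans (archi_boundP k0)).
  rewrite -natrX ler_nat; exact/ltnW/ltn_expl.
have [x [y [Pn _ /andP[y1 y2]]]] := Hs n.
apply: Pn; exists (del / 2) => // r rd t /andP[t1 t2].
have tts : `|t - ts| < eta by rewrite ltr_norml; apply/andP; split; lra.
have Nt := Heta _ tts.
have key r' : `|r' - r0| < del / 2 ->
   N (h (r'%:C * cis t) - h (r0%:C * cis ts)) < e / 2.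
  move=> r'd; rewrite -(subrKC (r0%:C * cis ts) (r'%:C * cis t)); apply: H.
  rewrite (_ : r'%:C * cis t - r0%:C * cis ts =
    (r' - r0)%:C * cis t + r0%:C * (cis t - cis ts)); last first.
    by rewrite rmorphB /=; ring.
  apply: (le_lt_trans (ND _ _)); rewrite (splitr del).
  apply: ltr_leD; first by rewrite NM Ncis NR mulr1.
  rewrite NM NR ger0_norm// (le_trans _ (ltW Nt))// ler_piMl ?N_ge0//.
  exact: ltW.
have k1 := key r rd; have k2 : N (h (r0%:C * cis t) - h (r0%:C * cis ts)) < e / 2.
  by apply: key; rewrite subrr normr0.
rewrite (_ : h (r%:C * cis t) - _ = (h (r%:C * cis t) - h (r0%:C * cis ts))
   - (h (r0%:C * cis t) - h (r0%:C * cis ts))); last by ring.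
by apply: (le_trans (NB _ _)); lra.
Qed.

(** [r0] is an exceptional radius across which constancy is carried by continuity alone; the value
    at [0] is reached in the same way. *)
Lemma mean_const (M : R -> R) (r0 : R) :
  (forall a, 0 <= a < 1 -> forall e : R, 0 < e -> exists2 del : R, 0 < del &
     forall r, 0 <= r < 1 -> `|r - a| < del -> `|M r - M a| <= e) ->
  (forall a b, 0 < a -> a <= b -> b < 1 -> ~~ (a <= r0 <= b) -> M a = M b) ->
  forall r, 0 <= r < 1 -> M r = M 0.
Proof.
move=> Mc Mb.
have eqe (x y : R) : (forall e : R, 0 < e -> `|x - y| <= e) -> x = y.
  move=> H; apply/eqP; rewrite -subr_eq0 -normr_eq0 eq_le normr_ge0 andbT.
  by apply/ler_addgt0Pl => e e0; rewrite addr0 H.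
have left a b : 0 <= a -> b <= 1 -> ~~ (a < r0 < b) ->
    forall x, a < x -> x < b -> M x = M a.
  move=> a0 b1 nr x ax xb; apply: eqe => e e0.
  have a01 : 0 <= a < 1 by rewrite a0 (lt_le_trans _ b1)// (lt_trans ax).
  have [del del0 H] := Mc a a01 e e0.
  pose y := Num.min x (a + del / 2).
  have ay : a < y by rewrite lt_min ax ltrDl divr_gt0.
  have yx : y <= x by rewrite ge_min lexx.
  have yd : y <= a + del / 2 by rewrite ge_min lexx orbT.
  rewrite -(Mb y x)//; last 3 first.
  - exact: le_lt_trans ay.
  - exact: lt_le_trans b1.
  - apply: contra nr => /andP[yr rx]; rewrite (lt_le_trans ay yr).
    exact: le_lt_trans xb.
  apply: H; last by rewrite ger0_norm ?subr_ge0 ?(ltW ay)//; lra.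
  by rewrite (le_trans a0 (ltW ay)) (lt_le_trans _ b1)// (le_lt_trans yx).
have right b : 0 < b -> b < 1 -> b = r0 -> M b = M 0.
  move=> b0 b1 br; apply: eqe => e e0.
  have b01 : 0 <= b < 1 by rewrite (ltW b0).
  have [del del0 H] := Mc b b01 e e0.
  pose y := Num.max (b / 2) (b - del / 2).
  have yb : y < b by rewrite gt_max; apply/andP; split; lra.
  have y0 : 0 < y by rewrite lt_max divr_gt0.
  have yd : b - del / 2 <= y by rewrite le_max lexx orbT.
  rewrite -(left 0 b _ _ _ y)//; last 2 first.
  - exact: ltW.
  - by rewrite br ltxx andbF.
  rewrite distrC; apply: H; first by rewrite (ltW y0) (lt_trans yb).
  by rewrite ler0_norm ?subr_le0 ?(ltW yb)//; lra.
move=> r /andP[]; rewrite le_eqVlt => /predU1P[<-//|r00] r1.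
have [rr|rr|rr] := ltgtP r r0.
- apply: (left 0 (Num.min r0 1)) => //.
  + by rewrite ge_min lexx orbT.
  + by rewrite lt_min ltxx !andbF.
  + by rewrite lt_min rr.
- have [r0n|r0p] := leP r0 0.
    by apply: (left 0 1) => //; rewrite ltNge r0n.
  rewrite (left r0 1 _ _ _ r)//; first by apply: right => //; exact: lt_trans r1.
  + exact: ltW.
  + by rewrite ltxx.
- by rewrite rr; apply: right => //; rewrite -rr.
Qed.

Lemma polar_ln r t : 0 < r -> r%:C * cis t = polar (ln r) t :> C.
Proof. by move=> r0; rewrite /polar lnK. Qed.

(** Goursat's theorem on [[ln a, ln b] x [0, 2 pi]]: the sides [t = 0] and [t = 2 pi] cancel by
    periodicity, and the other two are the integrals over the circles of radius [a] and [b]. *)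
Lemma Iab_circle_const (h : C -> C) (a b : R) : 0 < a -> a <= b -> b < 1 ->
  (forall z, a <= N z <= b -> cdiff h z) ->
  Iab 0 (2 * pi) (fun t => Re (h (a%:C * cis t))) =
    Iab 0 (2 * pi) (fun t => Re (h (b%:C * cis t))) /\
  Iab 0 (2 * pi) (fun t => Im (h (a%:C * cis t))) =
    Iab 0 (2 * pi) (fun t => Im (h (b%:C * cis t))).
Proof.
move=> a0 ab b1 hd; have b0 := lt_le_trans a0 ab.
have h0 : 0 <= 2 * pi :> R by rewrite mulr_ge0// pi_ge0.
have lab : ln a <= ln b by rewrite ler_ln.
have pab x t : ln a <= x <= ln b -> cdiff h (polar x t).
  move=> /andP[ax xb]; apply: hd; rewrite N_polar.
  by rewrite -(lnK a0) -[in X in _ && X](lnK b0) !ler_expR ax.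
have key (u v : R -> R -> R) :
    (forall x t, ln a <= x <= ln b -> half_CR u v x t) ->
    (forall x, u x (2 * pi) = u x 0) ->
    Iab 0 (2 * pi) (v (ln a)) = Iab 0 (2 * pi) (v (ln b)).
  move=> uv per.
  have CR : CR_on u v (ln a) (ln b) 0 (2 * pi) by move=> x t xab _; exact: uv.
  have := goursat lab h0 CR; rewrite /boundQ.
  rewrite IabB; [|by apply: (CR_on_ctv CR); rewrite lexx lab..].
  have -> : (fun x => u x (2 * pi) - u x 0) = (fun=> 0).
    by apply/funext => x; rewrite per subrr.
  rewrite {3}/Iab Rintegral_cst// mul0r addr0 => /eqP.
  by rewrite subr_eq0 => /eqP.
have per x : polar x (2 * pi) = polar x 0 :> C.
  by rewrite /polar -[2 * pi]add0r cis2pi.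
split.
  have := key (fun x t => - Im (h (polar x t))) (fun x t => Re (h (polar x t))).
  move=> /= K; transitivity (Iab 0 (2 * pi) (fun t => Re (h (polar (ln a) t)))).
    by congr Iab; apply/funext => t; rewrite -polar_ln.
  rewrite K; first by congr Iab; apply/funext => t; rewrite -polar_ln.
    by move=> x t xab; have [] := polar_half_CR (pab x t xab).
  by move=> x; rewrite per.
have := key (fun x t => Re (h (polar x t))) (fun x t => Im (h (polar x t))).
move=> /= K; transitivity (Iab 0 (2 * pi) (fun t => Im (h (polar (ln a) t)))).
  by congr Iab; apply/funext => t; rewrite -polar_ln.
rewrite K; first by congr Iab; apply/funext => t; rewrite -polar_ln.
  by move=> x t xab; have [] := polar_half_CR (pab x t xab).
by move=> x; rewrite per.
Qed.

(** Differentiability may fail on one circle, because Cauchy's formula applies this to a difference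
    quotient, of which only continuity is known at its removable singularity. *)
Lemma mean_value (h : C -> C) (r0 : R) :
  (forall z, N z < 1 -> ccont h z) ->
  (forall z, N z < 1 -> N z != r0 -> cdiff h z) ->
  forall r, 0 <= r < 1 -> cint (fun t => h (r%:C * cis t)) = h 0.
Proof.
move=> hc hd r r01.
have h0 : 0 <= 2 * pi :> R by rewrite mulr_ge0// pi_ge0.
have ctn a : 0 <= a < 1 -> cctn (fun t => h (a%:C * cis t)).
  move=> /andP[a0 a1]; apply: (@cctn_comp h (fun t => a%:C * cis t)); last exact: cctn_circle.
  by move=> t; apply: hc; rewrite N_circle.
have K (pr : C -> R) : (forall x y, `|pr x - pr y| <= N (x - y)) ->
    (forall a, 0 <= a < 1 -> continuous (fun t => pr (h (a%:C * cis t)))) ->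
    (forall a b : R, 0 < a -> a <= b -> b < 1 -> ~~ (a <= r0 <= b) ->
      Iab 0 (2 * pi) (fun t => pr (h (a%:C * cis t))) =
      Iab 0 (2 * pi) (fun t => pr (h (b%:C * cis t)))) ->
    \int[m]_t pr (h (r%:C * cis t)) = pr (h 0).
  move=> prl prc prI; rewrite circle_Iab; last exact: prc.
  rewrite (@mean_const (fun a => Iab 0 (2 * pi) (fun t => pr (h (a%:C * cis t)))) r0)//.
    rewrite (_ : (fun t => _) = fun=> pr (h 0)); last first.
      by apply/funext => t; rewrite mul0r.
    rewrite -circle_Iab; last by move=> x; exact: cvg_cst.
    exact: circle_cst.
  move=> a /andP[a0 a1] e e0.
  have q0 : 0 < e / (2 * pi + 1) by rewrite divr_gt0// ltr_wpDl.
  have [del del0 H] := uniform_circle a0 a1 q0 hc.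
  exists del => // b b01 bd.
  have ca x y c : 0 <= c < 1 -> ctson x y (fun t => pr (h (c%:C * cis t))).
    by move=> c01 t _; exact: prc.
  rewrite -IabB; [|exact: ca|by apply: ca; rewrite a0].
  have := @Iab_near_cst R 0 (2 * pi) (fun t => pr (h (b%:C * cis t)) - pr (h (a%:C * cis t))) 0
     (e / (2 * pi + 1)) h0; rewrite mul0r !subr0 => /(_ _ _)/le_trans; apply.
  - by apply: ctsonB; apply: ca => //; rewrite a0.
  - by move=> x xx; rewrite subr0 (le_trans (prl _ _))// H.
  - rewrite mulrAC ler_pdivrMr ?ltr_wpDl// ler_wpM2l ?(ltW e0)//.
    by rewrite lerDl.
have cc a b : 0 < a -> a <= b -> b < 1 -> ~~ (a <= r0 <= b) ->
   forall z, a <= N z <= b -> cdiff h z.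
  move=> a0 ab b1 nr z /andP[az zb]; apply: hd; first exact: le_lt_trans b1.
  by apply: contra nr => /eqP <-; rewrite az.
apply: complex_eq; rewrite /cint /=.
  apply: K; first by move=> x y; rewrite -ReN -ReD normRe.
    by move=> a /ctn[].
  by move=> a b a0 ab b1 nr; have [] := Iab_circle_const a0 ab b1 (cc a b a0 ab b1 nr).
apply: K; first by move=> x y; rewrite -ImN -ImD normIm.
  by move=> a /ctn[].
by move=> a b a0 ab b1 nr; have [] := Iab_circle_const a0 ab b1 (cc a b a0 ab b1 nr).
Qed.

Lemma mean_value_holo (h : C -> C) :
  (forall z, N z < 1 -> cdiff h z) ->
  forall r, 0 <= r < 1 -> cint (fun t => h (r%:C * cis t)) = h 0.
Proof.
(* No point has modulus [-1], so no circle is exceptional. *)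
move=> hd; apply: (@mean_value h (-1)) => [z z1|z z1 _]; last exact: hd.
by apply: cdiff_cont; exact: hd.
Qed.

End mean_value.

(** * The Cauchy kernel *)

Section cauchy.
Context {R : realType}.
Notation C := R[i].
Notation T := (measurableTypeR R).
Local Notation m := (circle_measure R).
Implicit Types (f g h : C -> C) (z : C).

Lemma cdiff_scale f a z : cdiff f (a * z) -> cdiff (fun x => f (a * x)) z.
Proof.
move=> [d H]; exists (d * a) => e e0.
have k0 : 0 < 1 + N a by rewrite ltr_pwDl ?N_ge0.
have [del del0 Hd] := H (e / (1 + N a)) (divr_gt0 e0 k0).
exists (del / (1 + N a)); first by rewrite divr_gt0.
move=> k; rewrite ltr_pdivlMr// => kd.
have aN : N (a * k) <= N k * (1 + N a) by rewrite NM mulrC ler_wpM2l ?N_ge0// lerDr.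
have := Hd (a * k) (le_lt_trans aN kd).
rewrite -mulrDr (mulrA d) => H3; apply: (le_trans H3).
rewrite mulrAC ler_pdivrMr// -mulrA ler_wpM2l//.
exact: ltW.
Qed.

Lemma holo_scale f (r : R) z : (forall z, N z < 1 -> cdiff f z) -> 0 <= r <= 1 ->
  N z < 1 -> cdiff (fun x => f (r%:C * x)) z.
Proof.
move=> fd /andP[r0 r1] z1; apply: cdiff_scale; apply: fd.
by rewrite NM NR ger0_norm// (le_lt_trans _ z1)// ler_piMl ?N_ge0.
Qed.

(** On the circle, [ck z t = e^{it} / (e^{it} - z)] is the Cauchy kernel. *)
Definition ck (z : C) (t : T) : C := (1 - z * (cj (cis t)))^-1.

Lemma N_1B z : 1 - N z <= N (1 - z).
Proof. by have := N_leB 1 z; rewrite N1. Qed.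

Lemma sub1_neq0 z : N z < 1 -> 1 - z != 0.
Proof. by move=> z1; rewrite -N_gt0 (lt_le_trans _ (N_1B z))// subr_gt0. Qed.

Lemma N_mcis z t : N (z * (cj (cis t))) = N z.
Proof. by rewrite NM Nconj Ncis mulr1. Qed.

Lemma ck_neq0 z t : N z < 1 -> 1 - z * (cj (cis t)) != 0.
Proof. by move=> z1; apply: sub1_neq0; rewrite N_mcis. Qed.

Lemma N_ck z t : N z < 1 -> N (ck z t) <= (1 - N z)^-1.
Proof.
move=> z1; rewrite /ck NV lef_pV2 ?posrE ?subr_gt0//.
  by rewrite -(N_mcis z t) N_1B.
by rewrite N_gt0 ck_neq0.
Qed.

Lemma cdiff_inv1B (a z : C) : N (a * z) < 1 -> cdiff (fun x => (1 - a * x)^-1) z.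
Proof.
move=> az; apply: (@cdiffV _ (fun x => 1 - a * x)); first exact: sub1_neq0.
apply: cdiffB; first exact: cdiff_cst.
by apply: cdiffM; [exact: cdiff_cst|exact: cdiff_id].
Qed.

Lemma cctn_ck z : N z < 1 -> cctn (ck z).
Proof.
move=> z1; apply: (@cctn_comp _ (fun x => (1 - z * x)^-1) (fun t => (cj (cis t)))).
  by move=> t; apply: cdiff_cont; apply: cdiff_inv1B; rewrite N_mcis.
by apply: cctn_conj; exact: cctn_cis.
Qed.

Lemma holo_cctn f r : (forall z, N z < 1 -> cdiff f z) -> 0 <= r < 1 ->
  cctn (fun t => f (r%:C * cis t)).
Proof.
move=> fd /andP[r0 r1]; apply: (@cctn_comp _ f (fun t => r%:C * cis t)); last exact: cctn_circle.
by move=> t; apply: cdiff_cont; apply: fd; rewrite N_circle.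
Qed.

Lemma holo_bnd f r : (forall z, N z < 1 -> cdiff f z) -> 0 <= r < 1 ->
  exists2 M : R, 0 <= M & forall t, N (f (r%:C * cis t)) <= M.
Proof. by move=> fd r01; apply: (@circ_bnd _ (fun x => f (r%:C * x))); exact: holo_cctn. Qed.

Lemma holo_cL1 f r : (forall z, N z < 1 -> cdiff f z) -> 0 <= r < 1 ->
  cL1 (fun t => f (r%:C * cis t)).
Proof.
move=> fd r01; have [M _ fM] := holo_bnd fd r01.
by apply: (cL1_bnd _ fM); apply: cctn_meas; exact: holo_cctn.
Qed.

Lemma cL1_ckM z w : N z < 1 -> cL1 w -> cL1 (fun t => ck z t * w t).
Proof.
move=> z1; apply: (@cL1M_bnd _ (ck z) _ (1 - N z)^-1).
  by apply: cctn_meas; exact: cctn_ck.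
by move=> t; exact: N_ck.
Qed.

(** The conjugate kernel is [1 / (1 - conj z * e^{it})], which is holomorphic beyond the closed disk
    in the variable [e^{it}], so the mean value property evaluates the product at the centre. *)
Lemma cint_ck_conj f r z : (forall z, N z < 1 -> cdiff f z) -> 0 <= r < 1 ->
  N z < 1 -> cint (fun t => (cj (ck z t)) * f (r%:C * cis t)) = f 0.
Proof.
move=> fd /andP[r0 r1] z1.
(* Rescaling by an [s] strictly between [max r |z|] and 1 places the integral on a circle inside the
   disk while both factors stay holomorphic. *)
pose s := (Num.max r (N z) + 1) / 2.
have rs : Num.max r (N z) < s.
  have : Num.max r (N z) < 1 by rewrite gt_max r1.
  by rewrite /s; lra.
have s1 : s < 1.
  have : Num.max r (N z) < 1 by rewrite gt_max r1.
  by rewrite /s; lra.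
have s0 : 0 < s by rewrite (le_lt_trans _ rs)// le_max r0.
have rs' : r < s by rewrite (le_lt_trans _ rs)// le_max lexx.
have zs : N z < s by rewrite (le_lt_trans _ rs)// le_max lexx orbT.
pose h x := (1 - (s^-1)%:C * (cj z) * x)^-1 * f ((r / s)%:C * x).
have hd w : N w < 1 -> cdiff h w.
  move=> w1; apply: cdiffM.
    apply: cdiff_inv1B; rewrite !NM Nconj NR ger0_norm ?invr_ge0 ?(ltW s0)//.
    rewrite -[ltRHS]mulr1.
    rewrite ltr_pM ?mulr_ge0 ?N_ge0 ?invr_ge0 ?(ltW s0)//.
    by rewrite mulrC ltr_pdivrMr// mul1r.
  apply: holo_scale => //; rewrite divr_ge0 ?(ltW s0)//= ler_pdivrMr// mul1r.
  exact: ltW.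
have := mean_value_holo hd (r := s); rewrite (ltW s0) s1 => /(_ isT).
rewrite {2}/h !mulr0 subr0 invr1 mul1r => <-.
apply: cint_ext => t; rewrite /h /ck conjV conjB conj1 conjM conjKc.
have e1 : (s^-1)%:C * (cj z) * (s%:C * cis t) = (cj z) * cis t.
  rewrite mulrACA mulrA -rmorphM mulVf ?gt_eqF// rmorph1 mul1r.
  by [].
have e2 : (r / s)%:C * (s%:C * cis t) = r%:C * cis t.
  by rewrite mulrA -rmorphM divfK// gt_eqF.
by rewrite e1 e2.
Qed.

Lemma cint_conj_ck f r z : (forall z, N z < 1 -> cdiff f z) -> 0 <= r < 1 ->
  N z < 1 -> cint (fun t => ck z t * (cj (f (r%:C * cis t)))) = (cj (f 0)).
Proof.
move=> fd r01 z1; rewrite -(cint_ck_conj fd r01 z1).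
have := @cint_conj _ (fun t => ck z t * (cj (f (r%:C * cis t)))).
move=> /(_ (cL1_ckM z1 (cL1_conj (holo_cL1 fd r01)))) E.
rewrite -[LHS]conjKc -E; congr (cj _).
by apply: cint_ext => t; rewrite conjM conjKc.
Qed.

Lemma cint_ck1 z : N z < 1 -> cint (ck z) = 1.
Proof.
move=> z1; have := @cint_conj_ck (fun=> 1) 0 z (fun z _ => cdiff_cst 1 z).
rewrite lexx ltr01 conj1 => /(_ isT z1) <-.
by apply: cint_ext => t; rewrite mulr1.
Qed.

End cauchy.

(** * Cauchy and Poisson integrals, Fatou's theorem *)

Section poisson.
Context {R : realType}.
Notation C := R[i].
Notation T := (measurableTypeR R).
Local Notation m := (circle_measure R).
Implicit Types (f g h : C -> C) (z : C) (w : T -> C).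

Definition cauchy w z : C := cint (fun t => ck z t * w t).

(** The Poisson kernel [(1 - |z|^2) / |e^{it} - z|^2], because [e^{it}] has modulus 1. *)
Definition pk (z : C) (t : T) : R := (1 - N z ^+ 2) / N (1 - z * cj (cis t)) ^+ 2.

Definition pois w z : C := cint (fun t => (pk z t)%:C * w t).

Lemma pkE z t : N z < 1 -> (pk z t)%:C = ck z t + cj (ck z t) - 1.
Proof.
move=> z1; have u0 := ck_neq0 t z1; rewrite /pk /ck conjV.
have Nu : N (z * cj (cis t)) = N z by rewrite N_mcis.
move: u0 Nu; set u := z * cj (cis t) => u0 Nu.
have cu0 : cj (1 - u) != 0 by rewrite -N_eq0 Nconj N_eq0.
have E : (1 - N z ^+ 2)%:C = (cj (1 - u) + (1 - u) - (1 - u) * cj (1 - u)) :> C.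
  rewrite -Nu Nsq conjB conj1; apply: complex_eq.
    by rewrite !(ReD, ReN, ReM, Reconj, ImD, ImN, Imconj)/=; ring.
  by rewrite !(ImD, ImN, ImM, ReD, ReN, Reconj, Imconj)/=; ring.
rewrite rmorphM fmorphV /= -mul_conj E.
move: u0 cu0; move: (1 - u) => a; move: (cj a) => b a0 b0.
by field; rewrite ?a0 ?b0.
Qed.

Lemma pk_ge0 z t : N z < 1 -> 0 <= pk z t.
Proof.
move=> z1; rewrite /pk divr_ge0 ?sqr_ge0// subr_ge0.
by rewrite expr_le1// ?N_ge0// ltW.
Qed.

Lemma pk_cctn z : N z < 1 -> cctn (fun t => (pk z t)%:C).
Proof.
move=> z1; have cc := cctn_ck z1.
have := cctn_conj cc; case: cc => a b [c d].
split; last by move=> t; exact: cvg_cst.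
rewrite (_ : (fun t => _) = (fun t => Re (ck z t) + Re (cj (ck z t)) - 1)).
  by move=> t; apply: cvgB; [apply: cvgD; [exact: a|exact: c]|exact: cvg_cst].
by apply/funext => t; rewrite pkE//= !ReD ReN.
Qed.

Lemma pk_meas z : N z < 1 -> measurable_fun setT (pk z).
Proof. by move=> /pk_cctn/cctn_meas[]. Qed.

Lemma pk_bnd z t : N z < 1 -> N ((pk z t)%:C : C) <= 2 * (1 - N z)^-1 + 1.
Proof.
move=> z1; rewrite pkE// (le_trans (NB _ _))// N1 lerD2r.
rewrite (le_trans (ND _ _))// Nconj; have := N_ck t z1; lra.
Qed.

Lemma cL1_pk z w : N z < 1 -> cL1 w -> cL1 (fun t => (pk z t)%:C * w t).
Proof.
move=> z1; apply: (@cL1M_bnd _ (fun t => (pk z t)%:C) _ (2 * (1 - N z)^-1 + 1)).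
  by apply: cctn_meas; exact: pk_cctn.
by move=> t; exact: pk_bnd.
Qed.

Lemma cL1_ck z : N z < 1 -> cL1 (ck z).
Proof.
move=> z1; apply: (@cL1_bnd _ _ (1 - N z)^-1); last by move=> t; exact: N_ck.
by apply: cctn_meas; exact: cctn_ck.
Qed.

Lemma pois1 z : N z < 1 -> cint (fun t => (pk z t)%:C) = 1.
Proof.
move=> z1.
rewrite (@cint_ext _ _ (fun t => ck z t + cj (ck z t) - 1)); last first.
  by move=> t; rewrite pkE.
have c1 := cL1_ck z1; have c2 := cL1_conj c1.
rewrite (cintB (cL1D c1 c2) (cL1_cst 1)) (cintD c1 c2) (cint_conj c1).
by rewrite cint_ck1// cint_cst conj1 addrK.
Qed.

Lemma eint_pk z : N z < 1 -> eint m (pk z) = 1%E.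
Proof.
move=> z1; have := pois1 z1; rewrite /cint /= => -[] E _.
have /cL1_N/(integrable_fin_num measurableT) : cL1 (fun t => (pk z t)%:C).
  apply: cL1_bnd; first by apply: cctn_meas; exact: pk_cctn.
  by move=> t; exact: pk_bnd.
rewrite /= => F; move: E; rewrite /Rintegral -/(eint m (pk z)) => E.
suff -> : eint m (pk z) = (fine (eint m (pk z)))%:E by rewrite E.
rewrite fineK//; move: F; rewrite /eint; congr (_ \is a fin_num).
by apply: eq_integral => t _; rewrite expr0n/= addr0 sqrtr_sqr ger0_norm// pk_ge0.
Qed.

Lemma poisE z w : N z < 1 -> cL1 w ->
  pois w z = cauchy w z + cj (cauchy (fun t => cj (w t)) z) - cint w.
Proof.
move=> z1 w1; rewrite /pois /cauchy.
have c1 := cL1_ckM z1 w1; have c2 := cL1_ckM z1 (cL1_conj w1).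
rewrite -cint_conj// -cintD//; last exact: cL1_conj.
rewrite -cintB//; last by apply: cL1D => //; exact: cL1_conj.
by apply: cint_ext => t; rewrite pkE// conjM conjKc; ring.
Qed.

(** The distance from [r e^{is}] to [e^{it}] is symmetric in the angles, so the kernel has mass 1 in
    its parameter too. *)
Lemma pkC r s t : 0 <= r -> pk (r%:C * cis s) t = pk (r%:C * cis t) s.
Proof.
move=> r0; rewrite /pk !N_circle//; congr (_ / _ ^+ 2).
rewrite -[LHS]Nconj conjB conj1 !conjM conjKc conjR; congr (N (1 - _)); ring.
Qed.

(** The mean value property for [x (f x - f z') / (x - z')], which vanishes at [0] and is completed
    at [z'] by the derivative. On the circle of radius [r] the factor [x / (x - z')] is the Cauchy
    kernel at [z], because [z' = r z]. *)
Lemma cauchy_holo f r z : (forall z, N z < 1 -> cdiff f z) -> 0 <= r < 1 ->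
  N z < 1 -> cauchy (fun t => f (r%:C * cis t)) z = f (r%:C * z).
Proof.
move=> fd r01 z1; have /andP[r0 r1] := r01.
pose z' := r%:C * z.
have z'1 : N z' < 1.
  by rewrite NM NR ger0_norm// (le_lt_trans _ z1)// ler_piMl ?N_ge0// ltW.
have [d Hd] := fd _ z'1.
pose h x := if x == z' then z' * d else x * (f x - f z') / (x - z').
have hoff x : x != z' -> h x = x * (f x - f z') / (x - z').
  by rewrite /h => /negbTE ->.
have hcd x : N x < 1 -> x != z' -> cdiff h x.
  move=> x1 xz; apply: (@cdiff_near _ (fun x => x * (f x - f z') / (x - z'))).
    exists (N (x - z')); first by rewrite N_gt0 subr_eq0.
    move=> k kd; rewrite hoff//; apply: contraTN kd => /eqP <-.
    by rewrite opprD addNKr NN ltxx.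
  apply: cdiffM; first (apply: cdiffM; first exact: cdiff_id).
    by apply: cdiffB; [exact: fd|exact: cdiff_cst].
  apply: (@cdiffV _ (fun x => x - z')); first by rewrite subr_eq0.
  by apply: cdiffB; [exact: cdiff_id|exact: cdiff_cst].
have hcont x : N x < 1 -> ccont h x.
  move=> x1; have [->|xz] := eqVneq x z'; last by apply: cdiff_cont; exact: hcd.
  move=> e e0; have e4 : 0 < e / 4 by rewrite divr_gt0.
  have [del del0 H] := Hd _ e4.
  have dp : 0 < 1 + N d by rewrite ltr_pwDl ?N_ge0.
  exists (Num.min 1 (Num.min del (e / 4 / (1 + N d)))).
    by rewrite !lt_min ltr01 del0 divr_gt0.
  move=> k; rewrite !lt_min => /and3P[k1 kd]; rewrite ltr_pdivlMr// => ke.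
  have [->|k0] := eqVneq k 0; first by rewrite addr0 subrr N0.
  have kN : 0 < N k by rewrite N_gt0.
  rewrite hoff; last by rewrite -subr_eq0 addrAC subrr add0r.
  have -> : h z' = z' * d by rewrite /h eqxx.
  rewrite [z' + k - z']addrAC subrr add0r.
  rewrite (_ : _ - _ = (z' + k) / k * (f (z' + k) - f z' - d * k) + k * d); last by field.
  apply: (le_lt_trans (ND _ _)).
  have : N ((z' + k) / k * (f (z' + k) - f z' - d * k)) <= 2 * (e / 4).
    rewrite !NM NV -mulrA ler_pM ?mulr_ge0 ?N_ge0 ?invr_ge0 ?N_ge0//.
      by rewrite (le_trans (ND _ _))//; lra.
    by rewrite mulrC ler_pdivrMr// H.
  have : N (k * d) <= e / 4.
    by rewrite NM (le_trans _ (ltW ke))// ler_wpM2l ?N_ge0//; have := N_ge0 d; lra.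
  lra.
have h0 : h 0 = 0.
  by rewrite /h; case: eqP => [<-|_]; rewrite !mul0r.
have := @mean_value _ h (N z') hcont _ r r01; rewrite h0.
have -> : cint (fun t => h (r%:C * cis t)) =
    cauchy (fun t => f (r%:C * cis t)) z - f z'.
  rewrite -[X in _ - X]mulr1 -(cint_ck1 z1) -cintZ; last exact: cL1_ck.
  rewrite /cauchy -cintB; last 2 first.
  - by apply: cL1_ckM => //; exact: holo_cL1.
  - by apply: cL1Z; exact: cL1_ck.
  move: r0; rewrite le_eqVlt => /predU1P[r0|r0].
    have rC0 : r%:C = 0 :> C by rewrite -r0.
    by apply: cint_ext => t; rewrite /z' rC0 !mul0r h0 [f 0 * _]mulrC subrr.
  apply: cint_ext => t; rewrite hoff.
    have ct := cis_neq0 (R := R) t.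
    have rC : (r%:C : C) != 0 by rewrite -N_gt0 NR gtr0_norm.
    have nz := ck_neq0 t z1.
    rewrite /ck; set c := cis t in ct nz *.
    have cc : c * cj c = 1 by rewrite /c cisM_conj.
    have E : r%:C * c - z' = r%:C * c * (1 - z * cj c).
      by rewrite mulrBr mulr1 /z'; congr (_ - _); rewrite -[LHS]mulr1 -cc; ring.
    rewrite E; field; rewrite nz ct rC.
    by [].
  rewrite -subr_eq0.
  have -> : r%:C * cis t - z' = r%:C * cis t * (1 - z * cj (cis t)) :> C.
    rewrite mulrBr mulr1 /z'; congr (_ - _); rewrite -[LHS]mulr1 -(cisM_conj t); ring.
  rewrite !mulf_neq0// ?cis_neq0 ?ck_neq0//.
  by rewrite -N_gt0 NR gtr0_norm.
move=> E; apply/eqP; rewrite -subr_eq0; apply/eqP/E => x x1 xz.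
by apply: hcd => //; apply: contra xz => /eqP ->.
Qed.

Lemma cauchy_conj_holo f r z : (forall z, N z < 1 -> cdiff f z) -> 0 <= r < 1 ->
  N z < 1 -> cauchy (fun t => cj (f (r%:C * cis t))) z = cj (f 0).
Proof. exact: cint_conj_ck. Qed.

Lemma pois_holo f r z : (forall z, N z < 1 -> cdiff f z) -> 0 <= r < 1 ->
  N z < 1 -> pois (fun t => f (r%:C * cis t)) z = f (r%:C * z).
Proof.
move=> fd r01 z1; rewrite poisE//; last exact: holo_cL1.
rewrite cauchy_holo// cauchy_conj_holo// conjKc mean_value_holo//.
by rewrite addrK.
Qed.

Lemma pk_le_dist z t : N z < 1 ->
  pk z t * N (cis t - z) ^+ 2 <= 2 * (1 - N z).
Proof.
move=> z1; have E : N (1 - z * cj (cis t)) = N (cis t - z).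
  rewrite (_ : cis t - z = (1 - z * cj (cis t)) * cis t); first by rewrite NM Ncis mulr1.
  by rewrite mulrBl mul1r -mulrA [cj _ * _]mulrC cisM_conj mulr1.
rewrite /pk E divfK; last first.
  by rewrite sqrf_eq0 -E N_eq0 ck_neq0.
have := N_ge0 z; nra.
Qed.

End poisson.

(** * Fatou's theorem on nontangential limits *)

Section fatou_theorem.
Context {R : realType}.
Notation C := R[i].
Notation T := (measurableTypeR R).
Local Notation m := (circle_measure R).
Local Notation mu := (@lebesgue_measure R).
Implicit Types (z : C) (w : T -> C).

Lemma eint_circle (f : T -> R) : measurable_fun setT f -> (forall t, 0 <= f t) ->
  (eint m f = (2 * pi)^-1%:E * \int[mu]_(t in `[0%R, (2 * pi)%R]) (f t)%:E)%E.
Proof.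
move=> mf f0; rewrite /eint /circle_measure integral_uniform ?subr0//.
  exact/measurable_EFinP.
Qed.

#[global] Instance circle_ae_filter : Filter (nbhs (almost_everywhere m)).
Proof. exact: (@ae_filter_ringOfSetsType _ T R m). Qed.

Lemma ae_circle (P : T -> Prop) : (\forall t \ae mu, P t) -> \forall t \ae m, P t.
Proof.
move=> [A [mA A0 PA]]; exists A; split => //.
have /null_content_dominatesP := dominates_uniform_prob (two_pi_gt0 R).
exact.
Qed.

Lemma ae_circle_itv : \forall t \ae m, 0 < t < 2 * pi.
Proof.
pose I := `[0%R, (2 * pi)%R]%classic : set R.
have mI : measurable (~` I : set T) by apply: measurableC; exact: measurable_itv.
have Z1 a : m [set a] = 0%E.
  have /null_content_dominatesP := dominates_uniform_prob (two_pi_gt0 R).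
  by apply => //; exact: lebesgue_measure_set1.
have m2 : m (~` I) = 0%E.
  by rewrite /m/= /uniform_prob integral_uniform_pdf setICl integral_set0.
have nI : \forall t \ae m, I t.
  by exists (~` I); split => // t; rewrite /setC /=.
have ns a : \forall t \ae m, t != a.
  exists [set a]; split => //.
  by move=> t /= /negP; rewrite negbK => /eqP.
apply: filterS3 nI (ns 0) (ns (2 * pi)) => t.
by rewrite /I /= in_itv/= => /andP[? ?] t0 t1; rewrite !lt_def t0 eq_sym t1; apply/andP.
Qed.

(** A Lebesgue point: the integral over the ball of radius [s] is [o(s)], which avoids dividing by
    the measure of the ball. *)
Definition lebpt w (t0 : T) := forall e : R, 0 < e -> exists2 eta : R, 0 < eta &
  forall s, 0 < s -> s < eta ->
    (eint m (fun t => \1_(ball t0 s) t * N (w t - w t0))%R <= (e * s)%:E)%E.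

(** Lebesgue's differentiation theorem is applied to the components cut off outside [[0, 2 pi]],
    which are locally integrable on the line. *)
Lemma ae_lebpt w : cL1 w -> \forall t \ae m, lebpt w t.
Proof.
move=> w1.
pose I := `[0%R, (2 * pi)%R]%classic : set R.
have mI : measurable I by exact: measurable_itv.
have pi20 : 0 < 2 * pi :> R by rewrite mulr_gt0// pi_gt0.
have loc (f : T -> R) : m.-integrable setT (EFin \o f) ->
    locally_integrable setT (f \_ I : R -> R).
  move=> fi; have mf : measurable_fun setT f.
    by apply/measurable_EFinP; exact: (measurable_int _ fi).
  apply: open_integrable_locally; first exact: openT.
  rewrite -restrict_EFin; apply/integrable_restrict => //.
  rewrite setTI; apply/integrableP; split; first by apply/measurable_EFinP/measurable_funTS.
  have := integrableP _ _ _ fi => -[_].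
  have -> : (\int[m]_t `|(EFin \o f) t| = eint m (fun t => `|f t|%R))%E by [].
  rewrite eint_circle//; last exact: measurableT_comp.
  move=> H; rewrite ltey; apply/eqP => E; move: H.
  rewrite [X in (_ * X)%E](_ : _ = +oo%E)//.
  by rewrite gt0_muley ?ltxx// lte_fin invr_gt0.
have l1 := lebesgue_differentiation (loc _ w1.1).
have l2 := lebesgue_differentiation (loc _ w1.2).
apply: filterS3 (ae_circle l1) (ae_circle l2) ae_circle_itv => t0 L1 L2 t0I e e0.
have It0 : t0 \in I by rewrite inE /I /= in_itv/=; case/andP: t0I => /ltW -> /ltW ->.
have ext (f : R -> R) (e1 : R) : 0 < e1 -> lebesgue_pt f t0 -> exists2 eta : R, 0 < eta &
    forall s, 0 < s -> s < eta ->
     (\int[mu]_(t in ball t0 s) `|(f t - f t0)%:E| <= (e1 * s)%:E)%E.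
  move=> e10 /fine_cvgP[fin /cvgrPdist_lt].
  have e2 : 0 < e1 / 2 by rewrite divr_gt0.
  move=> /(_ _ e2) cv; have fF : Filter (nbhs (0 : R)^'+) by exact: at_right_proper_filter.
  have [eta /= eta0 H] := filterI fin cv; exists eta => // s s0 se.
  have [|] := H s _ s0; first by rewrite /ball_/= sub0r normrN gtr0_norm.
  rewrite sub0r normrN /davg /iavg lebesgue_measure_ball ?(ltW s0)//.
  move=> F L; have s20 : 0 < s *+ 2 by rewrite mulrn_wgt0.
  have : (((s *+ 2)^-1)%:E * \int[mu]_(t in ball t0 s) `|(f t - f t0)%:E| <= (e1 / 2)%:E)%E.
    have E : (((s *+ 2)%:E)^-1 = ((s *+ 2)^-1)%:E)%E by rewrite inver gt_eqF.
    move: F L; rewrite E => F L; rewrite -(fineK F) lee_fin.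
    by apply: ltW; apply: le_lt_trans L; exact: ler_norm.
  rewrite lee_pdivrMl// => /le_trans; apply; rewrite -EFinM lee_fin.
  by rewrite -mulr_natr; lra.
have e1 : 0 < e / 4 by rewrite divr_gt0.
have [eta1 eta10 H1] := ext _ _ e1 L1.
have [eta2 eta20 H2] := ext _ _ e1 L2.
exists (Num.min eta1 eta2); first by rewrite lt_min eta10.
move=> s s0; rewrite lt_min => /andP[s1 s2].
have mw := cL1_meas w1.
have mb : measurable (ball t0 s : set T) by exact: measurable_ball.
have mN : measurable_fun setT (fun t : T => N (w t - w t0)).
  by apply: cmeas_N; apply: cmeasB => //; exact: cmeas_cst.
rewrite eint_circle; last 2 first.
- by apply: measurable_funM => //; exact: measurable_indic.
- by move=> t; rewrite mulr_ge0// N_ge0.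
have : (\int[mu]_(t in I) (\1_(ball t0 s) t * N (w t - w t0))%:E <=
   \int[mu]_(t in ball t0 s) (`|((fun t => Re (w t)) \_ I t - (fun t => Re (w t)) \_ I t0)%:E| +
     `|((fun t => Im (w t)) \_ I t - (fun t => Im (w t)) \_ I t0)%:E|))%E.
  have [mf1 _ _] := loc _ w1.1; have [mf2 _ _] := loc _ w1.2.
  have mP (f : R -> R) : measurable_fun setT f ->
      measurable_fun setT (fun t : T => `|(f t - f t0)%:E|%E).
    move=> mf; apply: measurableT_comp => //; apply/measurable_EFinP.
    by apply: measurable_funB => //; exact: measurable_cst.
  have -> : (\int[mu]_(t in I) (\1_(ball t0 s) t * N (w t - w t0))%:E =
      \int[mu]_(t in I `&` ball t0 s) (N (w t - w t0))%:E)%E.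
    rewrite integral_mkcondr; apply: eq_integral => t _; rewrite patchE indicE.
    case: (pselect (ball t0 s t)) => tb.
      by rewrite !mem_set// mul1r.
    by rewrite !memNset// mul0r.
  apply: (@le_trans _ _ (\int[mu]_(t in I `&` ball t0 s)
     (`|((fun t => Re (w t)) \_ I t - (fun t => Re (w t)) \_ I t0)%:E| +
     `|((fun t => Im (w t)) \_ I t - (fun t => Im (w t)) \_ I t0)%:E|))%E).
    apply: ge0_le_integral => //.
    - exact: measurableI.
    - by move=> t _; rewrite lee_fin N_ge0.
    - by apply/measurable_EFinP; exact: measurable_funTS.
    - by apply: measurable_funTS; apply: emeasurable_funD; exact: mP.
    - move=> t [tI _]; rewrite !patchE It0 mem_set//= lee_fin.
      by rewrite (le_trans (N_leReIm _))// !ReD !ReN !ImD !ImN.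
  apply: ge0_subset_integral => //.
  - exact: measurableI.
  - by apply: measurable_funTS; apply: emeasurable_funD; exact: mP.
  - by move=> t _; exact: adde_ge0.
have [mf1 _ _] := loc _ w1.1; have [mf2 _ _] := loc _ w1.2.
have mP (f : R -> R) : measurable_fun setT f ->
    measurable_fun (ball t0 s) (fun t : T => `|(f t - f t0)%:E|%E).
  move=> mf; apply: measurable_funTS.
  apply: measurableT_comp => //; apply/measurable_EFinP.
  by apply: measurable_funB => //; exact: measurable_cst.
rewrite ge0_integralD//; [|exact: mP|exact: mP].
move=> H; have {}H := le_trans H (leeD (H1 _ s0 s1) (H2 _ s0 s2)).
have pi1 : (2 * pi)^-1 <= 1 :> R.
  by rewrite invf_le1//; have := @pi_ge2 R; lra.
apply: (@le_trans _ _ ((2 * pi)^-1%:E * (e / 4 * s + e / 4 * s)%:E)%E).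
  by rewrite lee_wpmul2l// lee_fin invr_ge0 ltW.
rewrite -EFinM lee_fin (_ : e / 4 * s + e / 4 * s = e * s / 2); last by field.
have es := mulr_gt0 e0 s0.
apply: (@le_trans _ _ (1 * (e * s / 2))); last lra.
by apply: ler_wpM2r => //; lra.
Qed.

Lemma cis_inj (t t0 : R) : 0 < t0 < 2 * pi -> 0 <= t <= 2 * pi ->
  cis t = cis t0 -> t = t0.
Proof.
move=> /andP[a0 a1] /andP[b0 b1] E.
have c1 : cos (t - t0) = 1.
  move: E => [Ec Es]; rewrite cosB Ec Es -!expr2; exact: cos2Dsin2.
have s0 : sin ((t - t0) / 2) = 0.
  have : cos ((t - t0) / 2 + (t - t0) / 2) = 1 by rewrite -splitr.
  rewrite cosD -!expr2 => H; have := cos2Dsin2 ((t - t0) / 2) => H2.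
  by apply/eqP; rewrite -sqrf_eq0; apply/eqP; lra.
have [tt|tt|//] := ltgtP t t0.
  have : 0 < sin ((t0 - t) / 2) by apply: sin_gt0_pi; apply/andP; split; lra.
  by rewrite -opprB mulNr sinN s0 oppr0 ltxx.
have : 0 < sin ((t - t0) / 2) by apply: sin_gt0_pi; apply/andP; split; lra.
by rewrite s0 ltxx.
Qed.

(** Compactness on the two segments away from [t0]; as [t0] is interior to [[0, 2 pi]], the
    endpoints, which are one point of the circle, stay apart from it. *)
Lemma cis_sep (t0 eta : R) : 0 < t0 < 2 * pi -> 0 < eta ->
  exists2 k : R, 0 < k & forall t, 0 <= t <= 2 * pi -> eta <= `|t - t0| ->
    k <= N (cis t - cis t0 : C).
Proof.
move=> t0I eta0.
have cont : continuous (fun t => N (cis t - cis t0 : C)).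
  move=> t; apply/cvgrPdist_lt => e e0.
  have /cctnP /(_ t e e0) := @cctn_cis R; apply: filterS => s; apply: le_lt_trans.
  rewrite (_ : cis t - cis s = (cis t - cis t0) - (cis s - cis t0) :> C); last by ring.
  rewrite ler_norml; apply/andP; split; last exact: N_leB.
  by rewrite lerNl opprB (le_trans (N_leB _ _))// NBC.
have seg a b : a <= b -> (forall t, a <= t <= b -> (0 <= t <= 2 * pi) && (eta <= `|t - t0|)) ->
   exists2 k : R, 0 < k & forall t, a <= t <= b -> k <= N (cis t - cis t0 : C).
  move=> ab H; have [|c cI cM] := @EVT_min R (fun t => N (cis t - cis t0 : C)) a b ab.
    by apply: continuous_subspaceT.
  exists (N (cis c - cis t0 : C)).
    rewrite N_gt0 subr_eq0; apply/eqP => /(cis_inj t0I) E.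
    move: cI; rewrite in_itv/= => /H/andP[cI].
    by rewrite (E cI) subrr normr0 leNgt eta0.
  by move=> t tI; apply: cM; rewrite in_itv.
have [k1 k10 H1] : exists2 k : R, 0 < k & forall t, 0 <= t <= t0 - eta -> k <= N (cis t - cis t0 : C).
  have [a|a] := leP 0 (t0 - eta); last first.
    by exists 1 => // t /andP[x y]; lra.
  apply: seg => // t /andP[x y]; rewrite x/=; case/andP: t0I => ? ?.
  by rewrite ler0_norm; [apply/andP; split|]; lra.
have [k2 k20 H2] : exists2 k : R, 0 < k & forall t, t0 + eta <= t <= 2 * pi -> k <= N (cis t - cis t0 : C).
  have [a|a] := leP (t0 + eta) (2 * pi); last first.
    by exists 1 => // t /andP[x y]; lra.
  apply: seg => // t /andP[x y]; rewrite y/= andbT; case/andP: t0I => ? ?.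
  by rewrite ger0_norm; [apply/andP; split|]; lra.
exists (Num.min k1 k2); first by rewrite lt_min k10.
move=> t /andP[t1 t2] te; rewrite ge_min; apply/orP.
have [tt|tt] := leP t t0.
  left; apply: H1; rewrite t1/=; move: te; rewrite ler0_norm; lra.
right; apply: H2; rewrite t2 andbT; move: te; rewrite ger0_norm; lra.
Qed.

Lemma cis_local (t0 : R) : exists2 eta : R, 0 < eta & forall t, `|t - t0| < eta ->
  `|t - t0| / 2 <= N (cis t - cis t0 : C).
Proof.
have [eta eta0 H] := @polar_expansion R (1 / 2) (divr_gt0 ltr01 (ltr0n _ 2)).
exists eta => // t te; have := H 0 (t - t0); rewrite normr0 add0r => /(_ eta0 te).
rewrite expR0 rmorph1 mul1r => K.
have -> : N (cis t - cis t0 : C) = N (cis (t - t0) - 1 : C).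
  rewrite -[RHS]mul1r -(Ncis t0) -NM; congr N.
  by rewrite mulrBr mulr1 -cisD subrKC.
have := N_leB (0 +i* (t - t0) : C) (0 +i* (t - t0) - (cis (t - t0) - 1)).
rewrite subKr NBC.
have -> : N (0 +i* (t - t0) : C) = `|t - t0| by rewrite /= expr0n add0r sqrtr_sqr.
move: K; rewrite mul1r; lra.
Qed.

(** The kernel has mass 1, so [l] may be moved under the integral. *)
Lemma pois_dist z w l : N z < 1 -> cL1 w ->
  ((N (l - pois w z))%:E <= eint m (fun t => pk z t * N (w t - l))%R)%E.
Proof.
move=> z1 w1; have c1 : cL1 (fun t => w t - l) by apply: cL1B => //; exact: cL1_cst.
have c2 := cL1_pk z1 c1.
have -> : l - pois w z = - cint (fun t => (pk z t)%:C * (w t - l)).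
  rewrite (@cint_ext _ _ (fun t => (pk z t)%:C * w t - (pk z t)%:C * l)); last first.
    by move=> t; rewrite mulrBr.
  rewrite cintB; [|exact: cL1_pk|by apply: cL1_pk => //; exact: cL1_cst].
  rewrite opprB; congr (_ - _).
  rewrite (@cint_ext _ _ (fun t => l * (pk z t)%:C)); last by move=> t; rewrite mulrC.
  rewrite cintZ ?pois1 ?mulr1//.
  apply: cL1_bnd; first by apply: cctn_meas; exact: pk_cctn.
  by move=> t; exact: pk_bnd.
rewrite NN (le_trans (le_cint_eint c2))//.
rewrite le_eqVlt; apply/orP; left; apply/eqP; apply: eq_integral => t _.
by rewrite NM NR ger0_norm// pk_ge0.
Qed.

Lemma shell_exists (d eta : R) : 0 < d -> d < eta ->
  exists n, 2 ^+ n * d < eta /\ eta <= 2 ^+ n.+1 * d.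
Proof.
move=> d0 de; have ex : exists n, eta <= 2 ^+ n * d.
  exists (Num.bound (eta / d)); rewrite -ler_pdivrMr//.
  have k0 : 0 <= eta / d by rewrite divr_ge0// ltW// (lt_trans d0).
  apply: (le_trans (ltW (archi_boundP k0))).
  by rewrite -natrX ler_nat; exact/ltnW/ltn_expl.
case: (ex_minnP ex) => -[|n] nP nmin.
  by move: nP; rewrite expr0 mul1r leNgt de.
exists n; split => //; rewrite ltNge; apply/negP => /nmin.
by rewrite ltnn.
Qed.

(** In a Stolz region [|e^{it} - e^{it0}| <= A |e^{it} - z|], which bounds the kernel by [2 d A^2]
    over the squared chord from [e^{it0}]. Dyadic balls of radius [2^k d] around [t0] turn this into
    a sum of multiples of indicators; far from [t0] the kernel is [O(d)]. *)
Lemma pk_shells z (t0 A d eta k0 : R) (n : nat) (t : T) : N z < 1 -> 1 <= A ->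
  d = 1 - N z -> 0 < k0 ->
  (forall s : R, N (cis s - cis t0 : C) <= A * N (cis s - z)) ->
  (`|t - t0| < eta -> `|t - t0| / 2 <= N (cis t - cis t0 : C)) ->
  (eta / 2 <= `|t - t0| -> k0 <= N (cis t - cis t0 : C)) ->
  2 ^+ n * d < eta -> eta <= 2 ^+ n.+1 * d ->
  pk z t <= \sum_(k < n.+1) 32 * A ^+ 2 / d * 4 ^- k * \1_(ball t0 (2 ^+ k * d)) t
     + 2 * d * A ^+ 2 / k0 ^+ 2.
Proof.
move=> z1 A1 dE k00 HA Hl Hs n1 n2.
have d0 : 0 < d by rewrite dE subr_gt0.
have A0 : 0 < A by exact: lt_le_trans A1.
have p0 := pk_ge0 t z1; have pd := pk_le_dist t z1; rewrite -dE in pd.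
have dN : d <= N (cis t - z).
  by rewrite dE -(Ncis t) N_leB.
have sum0 : 0 <= \sum_(k < n.+1) 32 * A ^+ 2 / d * 4 ^- k * \1_(ball t0 (2 ^+ k * d)) t.
  apply: sumr_ge0 => k _; rewrite mulr_ge0 ?mulr_ge0 ?invr_ge0 ?exprn_ge0 ?(ltW d0) ?(ltW A0)//.
have B0 : 0 <= 2 * d * A ^+ 2 / k0 ^+ 2.
  by rewrite !mulr_ge0 ?invr_ge0 ?sqr_ge0// ltW.
have aux (x : R) : 0 < x -> x <= A * N (cis t - z) -> pk z t <= 2 * d * A ^+ 2 / x ^+ 2.
  move=> x0 xA; rewrite ler_pdivlMr ?exprn_gt0//.
  have : x ^+ 2 <= (A * N (cis t - z)) ^+ 2.
    by rewrite ler_pXn2r ?nnegrE ?(ltW x0) ?mulr_ge0 ?N_ge0 ?(ltW A0).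
  move=> /(ler_wpM2l p0) => H; apply: (le_trans H).
  by rewrite exprMn; have := ler_wpM2l (sqr_ge0 A) pd; lra.
have [far|near] := leP (eta / 2) `|t - t0|.
  rewrite ler_wpDl// aux//.
  by apply: (le_trans (Hs far)); exact: HA.
rewrite ler_wpDr//.
have ex : exists j, `|t - t0| < 2 ^+ j * d.
  exists n; rewrite (lt_le_trans near)// ler_pdivrMr//.
  by rewrite mulrC mulrA -exprS.
case: (ex_minnP ex) => j jP jmin.
have jn : (j < n.+1)%N.
  by rewrite ltnS; apply: jmin; rewrite (lt_le_trans near)// ler_pdivrMr// mulrC mulrA -exprS.
rewrite (bigD1 (Ordinal jn))//= ler_wpDr//.
  apply: sumr_ge0 => k _; rewrite mulr_ge0 ?mulr_ge0 ?invr_ge0 ?exprn_ge0 ?(ltW d0) ?(ltW A0)//.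
rewrite indicE mem_set; last by rewrite -ball_normE /ball_/= distrC.
rewrite mulr1.
case: j jP jmin jn => [|i] jP jmin jn.
  rewrite expr0 invr1 mulr1; apply: (@le_trans _ _ (2 * d * A ^+ 2 / d ^+ 2)).
    apply: aux => //; apply: (le_trans dN).
    by rewrite ler_peMl ?N_ge0.
  rewrite (_ : _ / d ^+ 2 = 2 * A ^+ 2 / d); last by field; rewrite gt_eqF.
  by rewrite ler_wpM2r ?invr_ge0 ?(ltW d0)// ler_wpM2r ?sqr_ge0// ler_nat.
have ti : 2 ^+ i * d <= `|t - t0|.
  by rewrite leNgt; apply/negP => /jmin; rewrite ltnn.
have tl : `|t - t0| < eta.
  by rewrite (lt_le_trans near)//; have := normr_ge0 (t - t0); lra.
have q : (2 ^+ i : R) != 0 by rewrite expf_neq0.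
(* This is [8 A^2 / (d 4^i)], which equals [32 A^2 / (d 4^(i+1))]: hence the constant 32 in the
   statement. *)
apply: (@le_trans _ _ (2 * d * A ^+ 2 / (2 ^+ i * d / 2) ^+ 2)).
  apply: aux; first by rewrite divr_gt0// mulr_gt0// exprn_gt0.
  apply: le_trans (HA t); apply: le_trans (Hl tl).
  by rewrite ler_wpM2r.
rewrite [4 ^+ i.+1]exprS (_ : (4 : R) ^+ i = 2 ^+ i * 2 ^+ i); last first.
  by rewrite -exprMn; congr (_ ^+ _); lra.
rewrite le_eqVlt; apply/orP; left; apply/eqP; field.
by rewrite q gt_eqF.
Qed.

Lemma Nlt1 z : (`|z| < 1) = (N z < 1).
Proof. by rewrite normE (_ : (1 : C) = (1 : R)%:C)// ltcR. Qed.

Lemma stolzE (zeta : C) (a : R) z :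
  stolz zeta a z <-> N z < 1 /\ N (z - zeta) < a * (1 - N z).
Proof.
rewrite /stolz /= Nlt1 !normE (_ : a%:C * _ = (a * (1 - N z))%:C) ?ltcR//.
by rewrite rmorphM rmorphB rmorph1.
Qed.

(** On the ball of radius [2^j d] the bound [O(2^j d)] of a Lebesgue point meets the kernel bound
    [K / (d 4^j)] and leaves [2^{-j}]; the shells sum to at most [e / 4], and the far part vanishes
    with [d]. *)
Lemma pois_nontangential w t0 : cL1 w -> 0 < t0 < 2 * pi -> lebpt w t0 ->
  nontangential_limit (pois w) (cis t0) (w t0).
Proof.
move=> w1 t0I L a a1; apply/cvgC_P => e e0.
(* In the Stolz region [|k| < a (1 - |z|) <= a |e^{is} - z|]; the triangle inequality adds 1. *)
pose A := 1 + a; have A1 : 1 <= A by rewrite /A; lra.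
have A0 : 0 < A by exact: lt_le_trans A1.
have [eta0 eta00 Hl] := cis_local t0.
pose K := 32 * A ^+ 2; have K0 : 0 < K by rewrite mulr_gt0// exprn_gt0.
have e10 : 0 < e / (8 * K) by rewrite divr_gt0// mulr_gt0.
have [eta1 eta10 H1] := L _ e10.
pose eta := Num.min eta0 eta1.
have etag : 0 < eta by rewrite lt_min eta00.
have eta2 : 0 < eta / 2 by rewrite divr_gt0.
have [k0 k00 Hs] := cis_sep t0I eta2.
have mN : measurable_fun setT (fun t : T => N (w t - w t0)).
  by apply: cmeas_N; apply: cmeasB; [exact: cL1_meas|exact: cmeas_cst].
have [I0 EI I00] : exists2 I0 : R, eint m (fun t => N (w t - w t0)) = I0%:E & 0 <= I0.
  have /cL1_N/(integrable_fin_num measurableT) : cL1 (fun t => w t - w t0).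
    by apply: cL1B => //; exact: cL1_cst.
  rewrite /= -/(eint m _) => /fineK E; exists (fine (eint m (fun t => N (w t - w t0)))).
    by rewrite E.
  by rewrite -lee_fin E; apply: eint_ge0 => t; exact: N_ge0.
have q0 : 0 < 8 * A ^+ 2 / k0 ^+ 2 * (I0 + 1).
  by rewrite !mulr_gt0 ?invr_gt0 ?exprn_gt0// ltr_wpDl.
rewrite near_withinE; apply/nbhsC_P.
exists (Num.min eta (e / (8 * A ^+ 2 / k0 ^+ 2 * (I0 + 1)))).
  by rewrite lt_min etag divr_gt0.
move=> k; rewrite lt_min => /andP[k1 k2] /stolzE[].
rewrite [cis t0 + k - cis t0]addrAC subrr add0r.
set z := cis t0 + k => z1 zk.
pose d := 1 - N z; have d0 : 0 < d by rewrite subr_gt0.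
have dk : d <= N k.
  rewrite /d -(Ncis t0) (le_trans (N_leB _ _))// /z opprD addrA subrr add0r NN//.
have [n [n1 n2]] := shell_exists d0 (le_lt_trans dk k1).
rewrite -lte_fin; apply: (le_lt_trans (pois_dist (w t0) z1 w1)).
pose B := 2 * d * A ^+ 2 / k0 ^+ 2.
have B0 : 0 <= B by rewrite !mulr_ge0 ?invr_ge0 ?sqr_ge0// ltW.
pose G (j : 'I_n.+1) (t : T) : R := K / d * 4 ^- j * (\1_(ball t0 (2 ^+ j * d)) t * N (w t - w t0)).
have mi (j : 'I_n.+1) : measurable_fun setT (fun t : T => \1_(ball t0 (2 ^+ j * d)) t * N (w t - w t0) : R).
  by apply: measurable_funM => //; apply: measurable_indic; exact: measurable_ball.
have i0 (j : 'I_n.+1) (t : T) : 0 <= \1_(ball t0 (2 ^+ j * d)) t * N (w t - w t0) :> R.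
  by rewrite mulr_ge0 ?N_ge0// indicE.
have c0 (j : 'I_n.+1) : 0 <= K / d * 4 ^- j.
  by rewrite !mulr_ge0 ?invr_ge0 ?exprn_ge0 ?(ltW d0)// ltW.
have G0 j t : 0 <= G j t by rewrite mulr_ge0.
have mG j : measurable_fun setT (G j) by apply: measurable_funM => //.
have : (eint m (fun t => (pk z t * N (w t - w t0))%R) <=
   eint m (fun t => (\sum_(j < n.+1) G j t + B * N (w t - w t0))%R))%E.
  apply: eint_le_ae.
  - by apply: measurable_funM => //; exact: pk_meas.
  - by apply: measurable_funD; [exact: measurable_sum|exact: measurable_funM].
  - by move=> t; rewrite mulr_ge0 ?N_ge0// pk_ge0.
  - by move=> t; rewrite addr_ge0 ?sumr_ge0// mulr_ge0 ?N_ge0.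
  apply: filterS ae_circle_itv => t /andP[t1 t2].
  have tI : 0 <= t <= 2 * pi by rewrite !ltW.
  have := @pk_shells z t0 A d eta k0 n t z1 A1 erefl k00.
  move=> /(_ _ _ (Hs t tI) n1 n2) H.
  have {}H := ler_wpM2r (N_ge0 (w t - w t0)) (H _ _).
  have HA s : N (cis s - cis t0 : C) <= A * N (cis s - z).
    have dN : d <= N (cis s - z) by rewrite /d -(Ncis s) N_leB.
    rewrite (_ : _ - _ = (cis s - z) + k); last by rewrite /z; ring.
    rewrite (le_trans (ND _ _))// /A mulrDl mul1r lerD2l.
    by rewrite (le_trans (ltW zk))// ler_wpM2l//; lra.
  have Hl' : `|t - t0| < eta -> `|t - t0| / 2 <= N (cis t - cis t0 : C).
    by move=> te; apply: Hl; rewrite (lt_le_trans te)// ge_min lexx.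
  apply: (le_trans (H HA Hl')).
  rewrite mulrDl lerD2r mulr_suml le_eqVlt; apply/orP; left; apply/eqP.
  by apply: eq_bigr => j _; rewrite /G /K; ring.
move=> /le_lt_trans; apply.
rewrite eintD; [|exact: measurable_sum|exact: measurable_funM| |]; last 2 first.
- by move=> t; rewrite sumr_ge0.
- by move=> t; rewrite mulr_ge0 ?N_ge0.
rewrite eint_sum// eintZ//; last by move=> t; exact: N_ge0.
rewrite EI -EFinM.
have : (\sum_(j < n.+1) eint m (G j) <= \sum_(j < n.+1) (e / 8 * 2 ^- j)%:E)%E.
  apply: lee_sum => j _; rewrite /G eintZ//.
  have jn : 2 ^+ j * d < eta1.
    apply: (@le_lt_trans _ _ (2 ^+ n * d)).
      by rewrite ler_pM2r// ler_weXn2l ?ler1n// -ltnS.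
    by rewrite (lt_le_trans n1)// ge_min lexx orbT.
  have j0 : 0 < 2 ^+ j * d by rewrite mulr_gt0 ?exprn_gt0.
  apply: (le_trans (lee_wpmul2l _ (H1 _ j0 jn))); first by rewrite lee_fin.
  rewrite -EFinM lee_fin (_ : (4 : R) ^- j = 2 ^- j * 2 ^- j); last first.
    by rewrite -invfM -exprMn; congr (_ ^- _); lra.
  rewrite le_eqVlt; apply/orP; left; apply/eqP; field.
  by rewrite !gt_eqF// exprn_gt0.
move=> H; apply: (le_lt_trans (leeD H (lexx _))).
rewrite sumEFin -EFinD lte_fin -mulr_sumr.
have S2 : \sum_(j < n.+1) (2 : R) ^- j <= 2.
  suff -> : \sum_(j < n.+1) (2 : R) ^- j = 2 - 2 ^- n by rewrite gerBl invr_ge0 exprn_ge0.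
  elim: (n) => [|p ih]; first by rewrite big_ord1 expr0 invr1; lra.
  rewrite big_ord_recr /= ih exprS; field.
  by rewrite expf_neq0.
have : e / 8 * \sum_(j < n.+1) (2 : R) ^- j <= e / 8 * 2 by rewrite ler_wpM2l// divr_ge0// ltW.
have : B * I0 <= e / 4.
  have : d * (8 * A ^+ 2 / k0 ^+ 2 * (I0 + 1)) <= e.
    rewrite -ler_pdivlMr// (le_trans dk)// ltW//.
  rewrite /B; set q := A ^+ 2 / k0 ^+ 2.
  have q00 : 0 <= q by rewrite divr_ge0// sqr_ge0.
  have := mulr_ge0 (mulr_ge0 (ltW d0) q00) I00.
  have := mulr_ge0 (ltW d0) q00.
  rewrite (_ : 2 * d * A ^+ 2 / k0 ^+ 2 = 2 * d * q); last by rewrite /q; ring.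
  rewrite (_ : 8 * A ^+ 2 / k0 ^+ 2 = 8 * q); last by rewrite /q; ring.
  lra.
lra.
Qed.

Theorem fatou_nontangential w : cL1 w ->
  \forall t \ae m, nontangential_limit (pois w) (cis t) (w t).
Proof.
move=> w1; apply: filterS2 ae_circle_itv (ae_lebpt w1) => t tI L.
exact: pois_nontangential.
Qed.

End fatou_theorem.

(** * Interpolation of sublinear operators *)

Section real_powers.
Context {R : realType}.
Implicit Types (x y p q s a b e : R).

Lemma one_powR p : 1 `^ p = 1 :> R. Proof. by rewrite powR1. Qed.

Lemma le_powR p x y : 0 <= p -> 0 <= x -> x <= y -> x `^ p <= y `^ p.
Proof.
move=> p0 x0 xy; apply: ge0_ler_powR => //.
by rewrite nnegrE (le_trans x0).
Qed.

Lemma powRD_le p x y : 0 <= p -> 0 <= x -> 0 <= y ->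
  (x + y) `^ p <= 2 `^ p * (x `^ p + y `^ p).
Proof.
move=> p0; wlog xy : x y / x <= y => [H|] x0 y0.
  have [xy|/ltW yx] := leP x y; first exact: H.
  by rewrite addrC [x `^ p + _]addrC; exact: H.
apply: (@le_trans _ _ ((2 * y) `^ p)).
  by apply: le_powR => //; [exact: addr_ge0|lra].
by rewrite powRM// ler_wpM2l ?powR_ge0// lerDr powR_ge0.
Qed.

Lemma powR_le1D s p x : 0 <= s -> s <= p -> 0 <= x -> x `^ s <= 1 + x `^ p.
Proof.
move=> s0 sp x0; have [x1|x1] := leP x 1.
  rewrite (@le_trans _ _ 1)// ?lerDl ?powR_ge0//.
  by rewrite -[leRHS](one_powR s); apply: le_powR.
by rewrite (le_trans (ler_powR (ltW x1) sp))// lerDr.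
Qed.

Lemma powR_gt1 p x : 0 < p -> 1 < x -> 1 < x `^ p.
Proof.
move=> p0 x1; rewrite -[ltLHS](one_powR p); apply: gt0_ltr_powR => //; rewrite nnegrE//.
by rewrite ltW// (lt_trans _ x1).
Qed.

(** The tangent at [y] lies below the convex function [x^q]; it is Young's inequality for [q] and
    [q / (q - 1)]. Averaging it gives the Jensen inequalities [power_mean] and [pois_jensen]. *)
Lemma powR_tangent q x y : 1 <= q -> 0 <= x -> 0 <= y ->
  q * y `^ (q - 1) * x <= x `^ q + (q - 1) * y `^ q.
Proof.
rewrite le_eqVlt => /predU1P[<-|q1] x0 y0.
  by rewrite subrr powRr0 mul0r addr0 powRr1// !mul1r.
have q0 : 0 < q by rewrite (lt_trans _ q1).
have qm : 0 < q - 1 by rewrite subr_gt0.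
have := @conjugate_powR _ x (y `^ (q - 1)) q (q / (q - 1)) x0 (powR_ge0 _ _) q0.
rewrite divr_gt0// invf_div -powRrM => /(_ isT).
rewrite (_ : q^-1 + _ = 1); last by field; rewrite gt_eqF.
rewrite (_ : (q - 1) * _ = q); last by field; rewrite gt_eqF.
move=> /(_ erefl) /(ler_wpM2l (ltW q0)).
rewrite (_ : q * (x `^ q / q + _) = x `^ q + (q - 1) * y `^ q); last first.
  by field; rewrite gt_eqF.
by rewrite [x * _]mulrC mulrA.
Qed.

Lemma power_mean (I : finType) (q : R) (x : I -> R) : (0 < #|I|)%N -> 1 <= q ->
  (forall i, 0 <= x i) ->
  (#|I|%:R^-1 * \sum_i x i) `^ q <= #|I|%:R^-1 * \sum_i x i `^ q.
Proof.
move=> I0 q1 x0; have M0 : (0 : R) < #|I|%:R by rewrite ltr0n.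
have q0 : 0 < q by rewrite (lt_le_trans _ q1).
set y := _^-1 * _.
have y0 : 0 <= y by rewrite mulr_ge0 ?sumr_ge0// invr_ge0 ltW.
have : \sum_i (q * y `^ (q - 1) * x i) <= \sum_i (x i `^ q + (q - 1) * y `^ q).
  by apply: ler_sum => i _; exact: powR_tangent.
rewrite -mulr_sumr big_split /= sumr_const -[_ *+ _]mulr_natl.
have -> : \sum_i x i = #|I|%:R * y by rewrite /y mulrA mulfV ?mul1r// gt_eqF.
have E : y `^ (q - 1) * y = y `^ q by rewrite mulrC mulr_powRB1.
rewrite (_ : q * _ * (_ * y) = #|I|%:R * (q * (y `^ (q - 1) * y))); last by ring.
by rewrite E ler_pdivlMl//; lra.
Qed.

Lemma young_eps p q e : 0 < p -> 0 < q -> p^-1 + q^-1 = 1 -> 0 < e ->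
  exists2 K : R, 0 < K & forall a b, 0 <= a -> 0 <= b ->
    a * b <= K * a `^ p + e * b `^ q.
Proof.
move=> p0 q0 pq e0; pose d := e `^ q^-1.
have d0 : 0 < d by rewrite powR_gt0.
exists (d^-1 `^ p); first by rewrite powR_gt0 ?invr_gt0.
move=> a b a0 b0.
have di0 : 0 <= d^-1 by rewrite invr_ge0 ltW.
have := @conjugate_powR _ (d^-1 * a) (d * b) p q.
rewrite !mulr_ge0 ?(ltW d0)// => /(_ isT isT p0 q0 pq).
rewrite mulrACA mulVf ?gt_eqF// mul1r => /le_trans; apply.
have p1 : p^-1 <= 1 by have : 0 <= q^-1 by [rewrite invr_ge0 ltW|]; lra.
have q1 : q^-1 <= 1 by have : 0 <= p^-1 by [rewrite invr_ge0 ltW|]; lra.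
have -> : e * b `^ q = (d * b) `^ q.
  by rewrite powRM ?(ltW d0)// /d -powRrM mulVf ?gt_eqF// powRr1// ltW.
by rewrite lerD// ?powRM// ?(ltW d0)// ler_piMr// ?mulr_ge0 ?powR_ge0.
Qed.

(** With [y k = B / A * 2^{k(a + b)}] the two bounds read [Z y^{- et}] and [Z y^{1 - et}], geometric
    on either side of their crossing. Instead of splitting there, their minimum is compared with
    [v / (1 + v)^2] for [v = y^c], hence with an increment of the bounded function [v / (1 + v)],
    and the sum telescopes. *)
Lemma min_sum a b : 0 < a -> 0 < b -> exists2 K : R, 0 <= K &
  forall n (x : nat -> R) (A B : R), 0 <= A -> 0 <= B ->
    (forall k, (k < n)%N -> [/\ 0 <= x k, x k <= A * 2 `^ (- (k%:R * a)) &
                                 x k <= B * 2 `^ (k%:R * b)]) ->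
    \sum_(k < n) x k <= K * (A `^ (b / (a + b)) * B `^ (a / (a + b))).
Proof.
move=> a0 b0; have ab0 : 0 < a + b by rewrite addr_gt0.
pose et := a / (a + b); pose c := Num.min et (1 - et).
have et0 : 0 < et by rewrite divr_gt0.
have et1 : 1 - et = b / (a + b) by rewrite /et; field; rewrite gt_eqF.
have et10 : 0 < 1 - et by rewrite et1 divr_gt0.
have c0 : 0 < c by rewrite lt_min et0.
have ce : c <= et by rewrite ge_min lexx.
have ce1 : c <= 1 - et by rewrite ge_min lexx orbT.
pose r := 2 `^ ((a + b) * c).
have r1 : 1 < r by rewrite powR_gt1 ?mulr_gt0// ltr1n.
have r0 : 0 < r by rewrite (lt_trans _ r1).
exists (4 * r / (r - 1)).
  by rewrite divr_ge0 ?mulr_ge0 ?(ltW r0)// subr_ge0 ltW.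
move=> n x A B A0 B0 H; rewrite -et1 -/et.
have K0 : 0 <= 4 * r / (r - 1) * (A `^ (1 - et) * B `^ et).
  by rewrite !mulr_ge0 ?powR_ge0 ?invr_ge0 ?(ltW r0)// subr_ge0 ltW.
have z0 : (A == 0) || (B == 0) -> \sum_(k < n) x k = 0.
  move=> AB; apply: big1 => k _; have [x0 xA xB] := H k (ltn_ord k).
  apply/eqP; rewrite eq_le x0 andbT.
  by case/orP: AB => /eqP E; [move: xA|move: xB]; rewrite E mul0r.
have [AB|] := boolP ((A == 0) || (B == 0)); first by rewrite z0.
rewrite negb_or => /andP[An Bn].
have {}A0 : 0 < A by rewrite lt_def An.
have {}B0 : 0 < B by rewrite lt_def Bn.
pose Z := A `^ (1 - et) * B `^ et.
have Z0 : 0 < Z by rewrite mulr_gt0 ?powR_gt0.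
pose y (k : nat) := B / A * 2 `^ (k%:R * (a + b)).
have y0 k : 0 < y k by rewrite !mulr_gt0 ?invr_gt0 ?powR_gt0.
pose v k := y k `^ c.
have v0 k : 0 < v k by rewrite powR_gt0.
have vS k : v k.+1 = r * v k.
  have yS : y k.+1 = 2 `^ (a + b) * y k.
    rewrite /y (_ : k.+1%:R * (a + b) = (a + b) + k%:R * (a + b)); last first.
      by rewrite -natr1; ring.
    by rewrite powRD ?(pnatr_eq0 R 2) ?implybT// mulrCA.
  by rewrite /v yS powRM ?powR_ge0 ?(ltW (y0 k))// -powRrM.
have EA k : A * 2 `^ (- (k%:R * a)) = Z * y k `^ (- et).
  rewrite /Z /y !powRM ?powR_ge0 ?mulr_ge0 ?invr_ge0 ?(ltW A0) ?(ltW B0)//.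
  rewrite -powRrM (_ : k%:R * (a + b) * - et = - (k%:R * a)); last first.
    by rewrite /et; field; rewrite gt_eqF.
  rewrite -[A^-1]powR_inv1 ?(ltW A0)// -powRrM mulN1r opprK.
  rewrite (_ : A `^ (1 - et) * _ * _ = (A `^ (1 - et) * A `^ et) * (B `^ et * B `^ (- et)) * 2 `^ (- (k%:R * a))); last by ring.
  by rewrite -!powRD ?An ?Bn ?implybT// subrK subrr powRr0 mulr1 powRr1// ltW.
have EB k : B * 2 `^ (k%:R * b) = Z * y k `^ (1 - et).
  rewrite /Z /y !powRM ?powR_ge0 ?mulr_ge0 ?invr_ge0 ?(ltW A0) ?(ltW B0)//.
  rewrite -powRrM (_ : k%:R * (a + b) * (1 - et) = (k%:R * b)); last first.
    by rewrite /et; field; rewrite gt_eqF.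
  rewrite -[A^-1]powR_inv1 ?(ltW A0)// -powRrM mulN1r.
  rewrite (_ : A `^ (1 - et) * _ * _ = (A `^ (1 - et) * A `^ (- (1 - et))) * (B `^ et * B `^ (1 - et)) * 2 `^ ((k%:R * b))); last by ring.
  by rewrite -!powRD ?An ?Bn ?implybT// subrr powRr0 mul1r addrC subrK powRr1// ltW.
pose Phi k := v k / (1 + v k).
have xP k : (k < n)%N -> x k <= Z * (4 * r / (r - 1)) * (Phi k.+1 - Phi k).
  move=> kn; have [x0 xA xB] := H k kn.
  apply: (@le_trans _ _ (Z * (4 * (v k / (1 + v k) ^+ 2)))).
    have q0 : 0 < (1 + v k) ^+ 2 by rewrite exprn_gt0// addr_gt0.
    have [y1|y1] := leP (y k) 1.
      rewrite (le_trans xB)// EB ler_wpM2l ?(ltW Z0)//.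
      rewrite (@le_trans _ _ (v k))//.
        by apply: ger_powR; rewrite ?y0.
      have v1 : v k <= 1 by rewrite -(one_powR c); apply: le_powR => //; exact: ltW.
      rewrite mulrCA ler_peMr ?(ltW (v0 k))// ler_pdivlMr// mul1r.
      by have := v0 k; nra.
    have v1 : 1 <= v k by rewrite -(one_powR c); apply: le_powR => //; exact: ltW.
    rewrite (le_trans xA)// EA ler_wpM2l ?(ltW Z0)//.
    rewrite (@le_trans _ _ (v k)^-1)//.
      by rewrite /v -powRN; apply: ler_powR; [exact: ltW|rewrite lerN2].
    rewrite mulrA ler_pdivlMr// ler_pdivrMl//.
    by have := v0 k; nra.
  rewrite -mulrA ler_wpM2l ?(ltW Z0)// /Phi vS.
  have vk := v0 k; have rm : 0 < r - 1 by rewrite subr_gt0.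
  have d1 : 0 < 1 + v k by rewrite addr_gt0.
  have d2 : 0 < 1 + r * v k by rewrite addr_gt0// mulr_gt0.
  rewrite (_ : 4 * r / (r - 1) * _ = 4 * (r * v k / ((1 + v k) * (1 + r * v k)))); last first.
    by field; rewrite !gt_eqF.
  rewrite ler_wpM2l// ler_pdivrMr ?exprn_gt0// mulrAC ler_pdivlMr ?mulr_gt0//.
  have : 0 <= v k * (1 + v k) * (r - 1) by rewrite !mulr_ge0// ltW.
  by rewrite expr2; lra.
apply: (@le_trans _ _ (\sum_(k < n) Z * (4 * r / (r - 1)) * (Phi k.+1 - Phi k))).
  by apply: ler_sum => k _; exact: xP.
rewrite -mulr_sumr -(big_mkord xpredT (fun k => Phi k.+1 - Phi k)) telescope_sumr//.
rewrite [Z * _]mulrC -[leRHS]mulr1; apply: ler_wpM2l; first exact: K0.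
have P0 k : 0 <= Phi k by rewrite divr_ge0 ?(ltW (v0 k))// addr_ge0// ltW.
have P1 k : Phi k <= 1.
  by rewrite ler_pdivrMr ?addr_gt0// mul1r lerDr.
by rewrite lerBlDr (le_trans (P1 n))// lerDl.
Qed.

End real_powers.

(** * Integrals of powers on the circle *)

Section Lp.
Context {R : realType}.
Notation C := R[i].
Notation T := (measurableTypeR R).
Local Notation m := (circle_measure R).
Implicit Types (w : T -> C) (p s : R).

Definition pint p w : \bar R := eint m (fun t => N (w t) `^ p).

Definition Lp p w := cmeas w /\ (pint p w < +oo)%E.

Lemma pint_ge0 p w : (0 <= pint p w)%E.
Proof. by apply: eint_ge0 => t; exact: powR_ge0. Qed.

Lemma pintZ p (c : C) w : 0 <= p -> cmeas w ->
  (pint p (fun t => c * w t)%R = (N c `^ p)%:E * pint p w)%E.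
Proof.
move=> p0 mw; rewrite /pint -eintZ ?powR_ge0//.
- by apply: eq_integral => t _; rewrite NM powRM ?N_ge0.
- exact: cmeas_Npow.
- by move=> t; exact: powR_ge0.
Qed.

Lemma pint_le p u w : 0 <= p -> cmeas u -> cmeas w ->
  (forall t, N (u t) <= N (w t)) -> (pint p u <= pint p w)%E.
Proof.
move=> p0 mu mw uw; apply: eint_le; try exact: cmeas_Npow.
  by move=> t; exact: powR_ge0.
by move=> t; apply: le_powR => //; exact: N_ge0.
Qed.

Lemma pintD p u w : 0 <= p -> cmeas u -> cmeas w ->
  (pint p (fun t => u t + w t)%R <= (2 `^ p)%:E * (pint p u + pint p w))%E.
Proof.
move=> p0 mu mw; rewrite /pint -eintD; try (by move=> t; exact: powR_ge0);
  try exact: cmeas_Npow.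
rewrite -eintZ ?powR_ge0//; last 2 first.
- by apply: measurable_funD; exact: cmeas_Npow.
- by move=> t; rewrite addr_ge0 ?powR_ge0.
apply: eint_le.
- by apply: cmeas_Npow; exact: cmeasD.
- apply: measurable_funM => //.
  by apply: measurable_funD; exact: cmeas_Npow.
- by move=> t; exact: powR_ge0.
move=> t; apply: le_trans (powRD_le p0 (N_ge0 _) (N_ge0 _)).
by apply: le_powR => //; [exact: N_ge0|exact: ND].
Qed.

Lemma eint_m_cst (c : R) : 0 <= c -> eint m (fun=> c) = c%:E.
Proof.
move=> c0; rewrite /eint integral_cst//.
by rewrite [X in (_ * X)%E]circle_setT mule1.
Qed.

Lemma pint_le1D s p w : 0 <= s -> s <= p -> cmeas w ->
  (pint s w <= 1 + pint p w)%E.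
Proof.
move=> s0 sp mw; rewrite -(eint_m_cst ler01) /pint -eintD//; last 2 first.
- exact: cmeas_Npow.
- by move=> t; exact: powR_ge0.
apply: eint_le; try exact: cmeas_Npow.
- by apply: measurable_funD => //; exact: cmeas_Npow.
- by move=> t; exact: powR_ge0.
- by move=> t; apply: powR_le1D => //; exact: N_ge0.
Qed.

Lemma Lp_sub s p w : 0 <= s -> s <= p -> Lp p w -> Lp s w.
Proof.
move=> s0 sp [mw wi]; split; first exact: mw.
apply: (le_lt_trans (pint_le1D s0 sp mw)).
by rewrite lte_add_pinfty// ltry.
Qed.

Lemma pint1 w : pint 1 w = eint m (fun t => N (w t)).
Proof. by apply: eq_integral => t _; rewrite powRr1// N_ge0. Qed.

Lemma Lp_cL1 p w : 1 <= p -> Lp p w -> cL1 w.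
Proof.
move=> p1 wp; have [mw] := Lp_sub ler01 p1 wp.
by rewrite pint1; exact: cL1P.
Qed.

Lemma LpZ p c w : 0 <= p -> Lp p w -> Lp p (fun t => c * w t).
Proof.
move=> p0 [mw wi]; split; first by apply: cmeasM => //; exact: cmeas_cst.
by rewrite pintZ//; apply: lte_mul_pinfty; rewrite ?lee_fin ?powR_ge0.
Qed.

Lemma LpD p u w : 0 <= p -> Lp p u -> Lp p w -> Lp p (fun t => u t + w t).
Proof.
move=> p0 [mu ui] [mw wi]; split; first exact: cmeasD.
apply: (le_lt_trans (pintD p0 mu mw)).
apply: lte_mul_pinfty; rewrite ?lee_fin ?powR_ge0//.
exact: (lte_add_pinfty ui wi).
Qed.

Lemma Lp_bnd p w (M : R) : 0 <= p -> cmeas w -> (forall t, N (w t) <= M) -> Lp p w.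
Proof.
move=> p0 mw wM; split => //.
have M0 : 0 <= M by exact: le_trans (N_ge0 _) (wM 0).
apply: (@le_lt_trans _ _ (eint m (fun=> M `^ p))).
  apply: eint_le => //; first exact: cmeas_Npow.
    by move=> t; exact: powR_ge0.
  by move=> t; apply: le_powR => //; exact: N_ge0.
by rewrite eint_m_cst ?powR_ge0// ltry.
Qed.

End Lp.

(** * Cutting a function by size and averaging over signs *)

Section interpolation.
Context {R : realType}.
Notation C := R[i].
Notation T := (measurableTypeR R).
Local Notation m := (circle_measure R).
Implicit Types (w : T -> C).

(** Dyadic height: level [0] collects every value below [2]. *)
Definition level (k : nat) (y : R) : bool :=
  (y < 2 ^+ k.+1) && ((k == 0)%N || (2 ^+ k <= y)).

Lemma level_uniq j k y : level j y -> level k y -> j = k.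
Proof.
have aux i l : (i < l)%N -> level i y -> level l y -> False.
  move=> il /andP[y1 _] /andP[_ /orP[/eqP l0|y2]]; first by rewrite l0 in il.
  suff : y < y by rewrite ltxx.
  apply: (lt_le_trans y1); apply: le_trans y2.
  by rewrite ler_weXn2l ?ler1n.
by move=> Hj Hk; have [/aux/(_ Hj Hk)|/aux/(_ Hk Hj)|] := ltngtP j k.
Qed.

Lemma level_exists n y : 0 <= y -> y < 2 ^+ n.+1 -> exists2 k, (k <= n)%N & level k y.
Proof.
move=> y0; elim: n => [|n ih] yn; first by exists 0%N => //; rewrite /level yn.
have [/ih[k kn ky]|ny] := ltP y (2 ^+ n.+1).
  by exists k => //; exact: leqW.
by exists n.+1 => //; rewrite /level yn ny orbT.
Qed.

(** Levels are disjoint, so this is the step function equal to [c k] on level [k] and to [0] above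
    the first [n] levels. *)
Definition mult (n : nat) (c : nat -> R) (y : R) : R :=
  \sum_(k < n) c k * (level k y)%:R.

Lemma mult_level n c k y : level k y -> (k < n)%N -> mult n c y = c k.
Proof.
move=> ky kn; rewrite /mult (bigD1 (Ordinal kn))//= ky mulr1 big1 ?addr0// => j jk.
have [jy|_] := boolP (level j y); last by rewrite mulr0.
by move/eqP: jk; case; apply: val_inj; exact: level_uniq jy ky.
Qed.

Lemma mult_nolevel n c y : (forall k, (k < n)%N -> ~~ level k y) -> mult n c y = 0.
Proof.
move=> H; apply: big1 => k _; by rewrite (negbTE (H k (ltn_ord k))) mulr0.
Qed.

Lemma measurable_level k : measurable_fun setT (fun y : R => (level k y)%:R : R).
Proof.
pose A := [set y : R | y < 2 ^+ k.+1] `&` (if k == 0%N then setT else [set y | 2 ^+ k <= y]).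
have mA : measurable A.
  apply: measurableI.
    by rewrite (_ : [set _ | _] = `]-oo, (2 ^+ k.+1)[%classic).
  case: ifP => _; first exact: measurableT.
  rewrite (_ : [set _ | _] = `[2 ^+ k, +oo[%classic)//.
  by apply/seteqP; split=> y /=; rewrite in_itv/= andbT.
rewrite (_ : (fun _ => _) = \1_A :> (R -> R)); first exact: measurable_indic.
apply/funext => y; rewrite indicE; congr (_ %:R); congr nat_of_bool.
apply/idP/idP.
  move=> /andP[y1 /orP[/eqP k0|y2]]; rewrite inE /A; split => //.
    by rewrite k0.
  by case: ifP.
rewrite inE /A /level => -[-> /=]; case: ifP => //=.
Qed.

Lemma measurable_mult n c : measurable_fun setT (mult n c : R -> R).
Proof.
apply: measurable_sum => k; apply: measurable_funM => //; exact: measurable_level.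
Qed.

Definition cut n c w : T -> C := fun t => (mult n c (N (w t)))%:C * w t.

Lemma cmeas_cut n c w : cmeas w -> cmeas (cut n c w).
Proof.
move=> mw; apply: cmeasM => //; apply: cmeasR.
by apply: (measurableT_comp (measurable_mult n c)); exact: cmeas_N.
Qed.

Lemma N_cut n c w t : N (cut n c w t) = `|mult n c (N (w t))| * N (w t).
Proof. by rewrite NM NR. Qed.

(** On level [k] the value [y] is comparable to [2^k], so a coefficient of size [2^{ka}] multiplies
    it to about [y^{1 + a}]: geometric weights trade the exponent [p] for [s]. The summand 1 covers
    level [0], where [y] may be small. *)
Lemma cut_bound n (c : nat -> R) (a s p y : R) : -1 <= a -> 0 < s -> s * (1 + a) = p ->
  (forall k, (k < n)%N -> `|c k| <= 2 `^ (k%:R * a)) -> 0 <= y ->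
  (`|mult n c y| * y) `^ s <= 2 `^ s * (1 + y `^ p).
Proof.
move=> a1 s0 sp cb y0; have s0' := ltW s0.
have rhs0 : 0 <= 2 `^ s * (1 + y `^ p) by rewrite mulr_ge0 ?addr_ge0 ?powR_ge0.
have [[k kn ky]|nk] := pselect (exists2 k, (k < n)%N & level k y); last first.
  rewrite mult_nolevel ?normr0 ?mul0r ?powR0 ?gt_eqF// => k kn.
  by apply/negP => ky; apply: nk; exists k.
rewrite (mult_level c ky kn); have {cb}ck := cb k kn.
case: k kn ky ck => [|k] kn ky ck.
  rewrite mul0r powRr0 in ck; move: ky => /andP[]; rewrite expr1 => y2 _.
  apply: (@le_trans _ _ (2 `^ s)); last by rewrite ler_peMr ?powR_ge0// lerDl powR_ge0.
  apply: le_powR => //; first by rewrite mulr_ge0.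
  by rewrite -[leRHS]mul1r ler_pM// ltW.
move: ky => /andP[y2 /= y1].
have yp : 0 < y by rewrite (lt_le_trans _ y1)// exprn_gt0.
have P2 : 2 `^ (k.+1%:R) = 2 ^+ k.+1 :> R by rewrite powR_mulrn.
have key : 2 `^ (k.+1%:R * a) <= 2 * y `^ a.
  rewrite powRrM P2; have q0 : 0 <= (2 : R) ^+ k.+1 by rewrite exprn_ge0.
  have [a0|a0] := leP 0 a.
    by rewrite (@le_trans _ _ (y `^ a)) ?le_powR// ler_peMl ?powR_ge0// ler1n.
  (* For negative [a] the upper end of the level counts, and [-1 <= a] keeps the loss [2^{-a}] at
     most 2. *)
  rewrite -[a]opprK powRN [y `^ _]powRN.
  have na : 0 <= - a by rewrite oppr_ge0 ltW.
  rewrite -[leLHS]mul1r ler_pdivrMr ?powR_gt0 ?exprn_gt0//.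
  rewrite mulrAC ler_pdivlMr ?powR_gt0// mul1r.
  apply: (@le_trans _ _ ((2 * 2 ^+ k.+1) `^ (- a))).
    by apply: le_powR => //; rewrite -exprS ltW.
  rewrite powRM// ler_wpM2r ?powR_ge0//.
  by rewrite -[leRHS](@powRr1 _ 2)//; apply: ler_powR; rewrite ?ler1n//; lra.
apply: (@le_trans _ _ ((2 * y `^ (1 + a)) `^ s)).
  apply: le_powR => //; first by rewrite mulr_ge0.
  rewrite powRD ?(gt_eqF yp) ?implybT// powRr1// mulrCA [leLHS]mulrC.
  by rewrite ler_wpM2l// (le_trans ck).
rewrite powRM ?powR_ge0// ler_wpM2l ?powR_ge0// -powRrM mulrC sp.
by rewrite lerDr.
Qed.


Section averaging.
Context d (X : measurableType d) (mu : {measure set X -> \bar R}).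
Variables (S : (T -> C) -> X -> R) (s0 : R).
Hypothesis Smeas : forall w, Lp s0 w -> measurable_fun setT (S w).
Hypothesis Sge0 : forall w x, 0 <= S w x.
Hypothesis SD : forall u w, Lp s0 u -> Lp s0 w ->
  \forall x \ae mu, S (fun t => u t + w t) x <= S u x + S w x.
Hypothesis SZ : forall (c : R) w, Lp s0 w ->
  \forall x \ae mu, S (fun t => c%:C * w t) x = `|c| * S w x.
Hypothesis s00 : 0 <= s0.

(** Homogeneity: the factor [K^{-1/s}] brings [w] into the unit ball. *)
Lemma S_scale (rho s K C0 : R) w : 0 < s -> 0 < rho -> 0 < K -> Lp s0 w -> cmeas w ->
  (forall u, Lp s0 u -> cmeas u -> (pint s u <= 1)%E ->
    (eint mu (fun x => S u x `^ (rho * s))%R <= C0%:E)%E) ->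
  (pint s w <= K%:E)%E ->
  (eint mu (fun x => S w x `^ (rho * s))%R <= (K `^ rho * C0)%:E)%E.
Proof.
move=> sp rp K0 ws mw H wK.
pose l := K `^ (- s^-1); have l0 : 0 < l by rewrite powR_gt0.
have Nl : N (l%:C : C) = l by rewrite NR gtr0_norm.
have ml : cmeas (fun t => l%:C * w t) by apply: cmeasM => //; exact: cmeas_cst.
have Ll : Lp s0 (fun t => l%:C * w t) by exact: LpZ.
have ls : l `^ s = K^-1.
  rewrite /l -powRrM mulNr mulVf ?gt_eqF// powR_inv1// ltW//.
have := H _ Ll ml; rewrite pintZ ?(ltW sp)// Nl ls => /(_ _) H1.
have {}H1 := H1 _.
have {}H1 : (eint mu (fun x => (S (fun t => l%:C * w t) x) `^ (rho * s))%R <= C0%:E)%E.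
  by apply: H1; rewrite lee_pdivrMl// mule1.
have rs0 : 0 < rho * s by rewrite mulr_gt0.
have E : eint mu (fun x => S (fun t => l%:C * w t) x `^ (rho * s)) =
    eint mu (fun x => (l `^ (rho * s)) * S w x `^ (rho * s)).
  apply: eint_eq_ae.
  - apply: (measurableT_comp (@measurable_powR R _)); exact: Smeas.
  - apply: measurable_funM => //.
    apply: (measurableT_comp (@measurable_powR R _)); exact: Smeas.
  - by move=> x; exact: powR_ge0.
  - by move=> x; rewrite mulr_ge0 ?powR_ge0.
  - apply: filterS (SZ l ws) => x ->.
    by rewrite gtr0_norm// powRM// ltW.
move: H1; rewrite E eintZ ?powR_ge0//; last 2 first.
- apply: (measurableT_comp (@measurable_powR R _)); exact: Smeas.
- by move=> x; exact: powR_ge0.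
have -> : l `^ (rho * s) = (K `^ rho)^-1.
  by rewrite mulrC powRrM ls -powR_inv1 ?(ltW K0)// -powRrM mulN1r powRN.
by rewrite lee_pdivrMl ?powR_gt0// EFinM.
Qed.

Variables (n : nat) (c : nat -> R) (w : T -> C).
Hypothesis ws0 : Lp s0 w.
Hypothesis c0 : forall k, 0 < c k.

Definition sgc (e : {ffun 'I_n -> bool}) (k : nat) : R :=
  if insub k is Some i then (-1) ^+ (e i) * c k else 0.

Lemma sgc_norm e k : `|sgc e k| <= c k.
Proof.
rewrite /sgc; case: insubP => [i _ _|_]; last by rewrite normr0 ltW.
by rewrite normrM normr_sign mul1r ger0_norm// ltW.
Qed.

Definition block (k : nat) : T -> C := cut k.+1 (fun j => (j == k)%:R) w.

Lemma Lp_cut k (a : nat -> R) : Lp s0 (cut k a w).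
Proof.
case: ws0 => mw wi.
pose M := \sum_(i < k) `|a i|.
have MB t : N (cut k a w t) <= N (M%:C * w t).
  rewrite N_cut NM NR ler_wpM2r ?N_ge0//.
  rewrite [leRHS]ger0_norm ?sumr_ge0// /mult.
  rewrite (le_trans (ler_norm_sum _ _ _))// ler_sum// => i _.
  by rewrite normrM ler_piMr// normr_nat lern1; case: level.
have mc := cmeas_cut k a mw; split; first exact: mc.
apply: (@le_lt_trans _ _ (pint s0 (fun t => M%:C * w t))).
  by apply: pint_le => //; apply: cmeasM => //; exact: cmeas_cst.
by have [] := LpZ M%:C s00 ws0.
Qed.

Definition avg (x : X) : R :=
  #|{ffun 'I_n -> bool}|%:R^-1 * \sum_(e : {ffun 'I_n -> bool}) S (cut n (sgc e) w) x.

(** Flipping every sign except the [k]-th pairs up the terms of the average; the sum of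
    a pair of arguments is [2 c_k] times a block, up to sign. *)
Lemma block_le_avg k : (k < n)%N -> \forall x \ae mu, c k * S (block k) x <= avg x.
Proof.
move=> kn.
pose i0 := Ordinal kn.
pose flip (e : {ffun 'I_n -> bool}) : {ffun 'I_n -> bool} :=
  [ffun j => if j == i0 then e j else ~~ e j].
have flipK : involutive flip.
  by move=> e; apply/ffunP => j; rewrite !ffunE; case: eqP => // _; rewrite negbK.
have pair (e : {ffun 'I_n -> bool}) : \forall x \ae mu,
    2 * c k * S (block k) x <= S (cut n (sgc e) w) x + S (cut n (sgc (flip e)) w) x.
  have E : (fun t => ((-1) ^+ (e i0) * (2 * c k))%:C * block k t) =
      (fun t => cut n (sgc e) w t + cut n (sgc (flip e)) w t).
    apply/funext => t; rewrite /block /cut mulrA -mulrDl -rmorphM -rmorphD /=.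
    congr (_%:C * _).
    set y := N (w t).
    have [[j jn jy]|nj] := pselect (exists2 j, (j < n)%N & level j y); last first.
      have nj' j : (j < n)%N -> ~~ level j y.
        by move=> jn; apply/negP => jy; apply: nj; exists j.
      rewrite !mult_nolevel ?mulr0 ?addr0// => j jk; apply: nj'.
      exact: leq_trans jk _.
    rewrite !(mult_level _ jy jn) /sgc insubT/=.
    have [jk|jk] := eqVneq j k.
      have jy' : level k y by rewrite -jk.
      rewrite (mult_level _ jy' (ltnSn k)) eqxx mulr1.
      have -> : Sub j jn = i0 by apply: val_inj; rewrite SubK.
      by rewrite ffunE eqxx jk; ring.
    rewrite (_ : mult k.+1 _ y = 0) ?mulr0; last first.
      apply: big1 => l _; have [ly|] := boolP (level l y); last by rewrite mulr0.
      by rewrite (level_uniq ly jy) (negbTE jk) mul0r.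
    rewrite ffunE -val_eqE SubK/= (negbTE jk).
    by case: (e _) => /=; ring.
  have H1 := SD (Lp_cut n (sgc e)) (Lp_cut n (sgc (flip e))).
  have H2 := SZ ((-1) ^+ (e i0) * (2 * c k)) (Lp_cut k.+1 (fun j => (j == k)%:R)).
  apply: filterS2 H1 H2 => x; rewrite -E => H1 H2; apply: le_trans H1.
  rewrite H2 normrM normr_sign mul1r ger0_norm// mulr_ge0// ltW//.
have := filter_forall (ae_filter_ringOfSetsType mu) pair.
apply: filterS => x H; rewrite /avg.
set M := #|_|; pose F e := S (cut n (sgc e) w) x.
have M0 : (0 : R) < M%:R by rewrite ltr0n /M card_ffun card_bool expn_gt0.
rewrite ler_pdivlMl//.
have : \sum_(e : {ffun 'I_n -> bool}) 2 * c k * S (block k) x <=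
    \sum_e (F e + F (flip e)) by apply: ler_sum => e _; exact: H.
rewrite sumr_const big_split /= -(reindex_inj (inv_inj flipK) (P := xpredT) (F := F)) /=.
rewrite -/M -[_ *+ M]mulr_natl => H1.
have : 2 * (M%:R * (c k * S (block k) x)) <= 2 * \sum_e F e by lra.
by rewrite ler_pM2l.
Qed.

Lemma avg_ge0 x : 0 <= avg x.
Proof. by rewrite mulr_ge0 ?invr_ge0// sumr_ge0. Qed.

Lemma avg_meas : measurable_fun setT avg.
Proof.
apply: measurable_funM => //; apply: measurable_sum => e; apply: Smeas.
exact: Lp_cut.
Qed.

(** As [rho s >= 1], the power of the mean over signs is at most the mean of the powers, and all
    choices of signs share the bound [K]. *)
Lemma avg_bound (rho s K C0 : R) : 0 < s -> 0 < rho -> 1 <= rho * s -> 0 < K ->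
  (forall u, Lp s0 u -> cmeas u -> (pint s u <= 1)%E ->
    (eint mu (fun x => S u x `^ (rho * s))%R <= C0%:E)%E) ->
  (forall e, (pint s (cut n (sgc e) w) <= K%:E)%E) ->
  (eint mu (fun x => avg x `^ (rho * s))%R <= (K `^ rho * C0)%:E)%E.
Proof.
move=> sp rp rs K0 H cK.
pose F e x := S (cut n (sgc e) w) x `^ (rho * s).
have mF e : measurable_fun setT (F e).
  apply: (measurableT_comp (@measurable_powR R _)); apply: Smeas; exact: Lp_cut.
have F0 e x : 0 <= F e x by exact: powR_ge0.
pose M : R := #|{ffun 'I_n -> bool}|%:R.
have M0 : 0 < M by rewrite ltr0n card_ffun card_bool expn_gt0.
apply: (@le_trans _ _ (eint mu (fun x => M^-1 * \sum_e F e x)%R)).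
  apply: eint_le.
  - apply: (measurableT_comp (@measurable_powR R _)); exact: avg_meas.
  - by apply: measurable_funM => //; apply: measurable_sum => e.
  - by move=> x; exact: powR_ge0.
  - move=> x; apply: power_mean => //; by rewrite card_ffun card_bool expn_gt0.
rewrite eintZ ?invr_ge0 ?(ltW M0)//; last 2 first.
- exact: measurable_sum.
- by move=> x; apply: sumr_ge0.
rewrite eint_sum// lee_pdivrMl//.
apply: (@le_trans _ _ (\sum_(e : {ffun 'I_n -> bool}) (K `^ rho * C0)%:E)%E).
  apply: lee_sum => e _; have Lc := Lp_cut n (sgc e).
  exact: (S_scale sp rp K0 Lc Lc.1 H (cK e)).
by rewrite sumEFin sumr_const -mulr_natl.
Qed.

End averaging.

Lemma pint_cut n (c : nat -> R) (a s p : R) w : -1 <= a -> 0 < s -> s * (1 + a) = p ->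
  (forall k, (k < n)%N -> `|c k| <= 2 `^ (k%:R * a)) -> cmeas w -> (pint p w <= 1)%E ->
  (pint s (cut n c w) <= (2 `^ s * 2)%:E)%E.
Proof.
move=> a1 s0 sp cb mw w1.
apply: (@le_trans _ _ (eint m (fun t => 2 `^ s * (1 + N (w t) `^ p))%R)).
  apply: eint_le.
  - by apply: cmeas_Npow; exact: cmeas_cut.
  - apply: measurable_funM => //; apply: measurable_funD => //; exact: cmeas_Npow.
  - by move=> t; exact: powR_ge0.
  - by move=> t; rewrite N_cut; apply: (cut_bound a1 s0 sp cb (N_ge0 _)).
rewrite eintZ ?powR_ge0//; last 2 first.
- apply: measurable_funD => //; exact: cmeas_Npow.
- by move=> t; rewrite addr_ge0 ?powR_ge0.
rewrite eintD//; last 2 first.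
- exact: cmeas_Npow.
- by move=> t; exact: powR_ge0.
rewrite eint_m_cst// EFinM lee_pmul2l ?lte_fin ?powR_gt0//.
by rewrite (_ : 2%:E = 1 + 1)%E ?leeD// -EFinD.
Qed.

Definition tail n w : T -> C := fun t => w t - cut n (fun=> 1) w t.

Lemma cmeas_tail n w : cmeas w -> cmeas (tail n w).
Proof. by move=> mw; apply: cmeasB => //; exact: cmeas_cut. Qed.

(** Only values of modulus at least [2^{n+1}] survive, and there [|w|^s] is at most
    [2^{-(n+1)(p - s)} |w|^p]. *)
Lemma pint_tail n (s p : R) w : 0 < s -> s < p -> cmeas w -> (pint p w <= 1)%E ->
  (pint s (tail n.+1 w) <= ((2 ^+ n.+1)^-1 `^ (p - s))%:E)%E.
Proof.
move=> s0 sp mw w1; set K := _ `^ _.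
have K0 : 0 < K by rewrite powR_gt0// invr_gt0 exprn_gt0.
apply: (@le_trans _ _ (K%:E * pint p w)%E); last first.
  by rewrite -[leRHS]mule1 lee_pmul2l.
rewrite -eintZ ?(ltW K0)//; [|exact: cmeas_Npow|by move=> t; exact: powR_ge0].
apply: eint_le.
- by apply: cmeas_Npow; exact: cmeas_tail.
- by apply: measurable_funM => //; exact: cmeas_Npow.
- by move=> t; exact: powR_ge0.
move=> t; rewrite /tail /cut; set y := N (w t).
have y0 : 0 <= y by exact: N_ge0.
have [yn|ny] := ltP y (2 ^+ n.+1).
  have [k kn ky] := level_exists y0 yn.
  rewrite (mult_level _ ky)// mul1r subrr N0 powR0 ?gt_eqF//.
  by rewrite mulr_ge0 ?powR_ge0// ltW.
rewrite mult_nolevel ?mul0r ?subr0; last first.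
  move=> k kn; apply/negP => /andP[yk _].
  have : (2 : R) ^+ k.+1 <= 2 ^+ n.+1 by rewrite ler_weXn2l ?ler1n.
  by move=> /(lt_le_trans yk); rewrite ltNge ny.
have yp : 0 < y by rewrite (lt_le_trans _ ny)// exprn_gt0.
rewrite -/y -[y `^ p](_ : y `^ s * y `^ (p - s) = _); last first.
  by rewrite -powRD ?(gt_eqF yp) ?implybT// addrC subrK.
rewrite mulrCA ler_peMr ?powR_ge0// -powRM ?(ltW yp) ?invr_ge0 ?exprn_ge0//.
apply: (@le_trans _ _ (1 `^ (p - s))); first by rewrite one_powR.
apply: le_powR => //; first by rewrite subr_ge0 ltW.
by rewrite ler_pdivlMl ?exprn_gt0// mulr1.
Qed.

Lemma cutS n w t : cut n.+1 (fun=> 1) w t = cut n (fun=> 1) w t + block w n t.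
Proof.
rewrite /block /cut -mulrDl -rmorphD /=; congr (_%:C * _).
rewrite /mult !big_ord_recr /= mul1r eqxx mul1r; congr (_ + _).
by rewrite big1 ?add0r// => i _; rewrite ltn_eqF ?mul0r.
Qed.

Lemma powR_split (al be x y : R) : 0 <= al -> 0 <= be -> al + be = 1 -> 0 <= x -> 0 <= y ->
  x `^ al * y `^ be <= x + y.
Proof.
move=> al0 be0 ab x0 y0.
have xy : 0 <= x + y by rewrite addr_ge0.
apply: (@le_trans _ _ ((x + y) `^ al * (x + y) `^ be)).
  by rewrite ler_pM ?powR_ge0//; apply: le_powR; rewrite ?lerDl ?lerDr.
have [->|n0] := eqVneq (x + y) 0.
  have [z|al1] := eqVneq al 0.
    by rewrite [be](_ : _ = 1) ?powRr1 ?mulr0//; lra.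
  by rewrite (powR0 al1) mul0r.
by rewrite -powRD ?n0 ?implybT// ab powRr1.
Qed.

End interpolation.

Section fatou.
Context {R : realType} d (X : measurableType d) (mu : {measure set X -> \bar R}).

Lemma eint_fatou (f : nat -> X -> R) (g : X -> R) (M : \bar R) :
  (forall n, measurable_fun setT (f n)) -> (forall n x, 0 <= f n x) ->
  measurable_fun setT g -> (forall x, 0 <= g x) ->
  (\forall x \ae mu, f n x @[n --> \oo] --> g x) ->
  (forall n, (eint mu (f n) <= M)%E) -> (eint mu g <= M)%E.
Proof.
move=> mf f0 mg g0 fg fM.
have mf' n : measurable_fun setT (EFin \o f n) by exact/measurable_EFinP.
have E : eint mu g = (\int[mu]_x limn_einf (fun n => (f n x)%:E))%E.
  apply: ae_eq_integral => //.
  - exact/measurable_EFinP.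
  - rewrite (_ : (fun _ => _) = (fun x => - limn_esup (fun n => (- (f n x)%:E)))%E); last first.
      apply/funext => x; rewrite -limn_einfN; congr limn_einf.
      by apply/funext => n; rewrite /comp oppeK.
    apply: measurableT_comp => //; apply: measurable_fun_limn_esup => n.
    apply: measurableT_comp => //; exact: mf'.
  apply: filterS fg => x fgx _.
  by apply/esym; apply: (cvg_limn_einf_sup _).1; apply: cvg_EFin => //; near=> n.
rewrite E; apply: (le_trans (fatou mu measurableT mf' _)).
  by move=> n x _; rewrite /= lee_fin.
rewrite limn_einf_lim; apply: lime_le; first exact: is_cvg_einfs.
near=> n; apply: (@le_trans _ _ (eint mu (f n))); last exact: fM.
by apply: ereal_inf_lbound; exists n => /=.
Unshelve. all: by end_near. Qed.

End fatou.

(** * The interpolation theorem *)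

Section interpolation_thm.
Context {R : realType}.
Notation C := R[i].
Notation T := (measurableTypeR R).
Local Notation m := (circle_measure R).
Implicit Types (w : T -> C).

Definition sublin d (X : measurableType d) (mu : {measure set X -> \bar R})
    (s0 : R) (S : (T -> C) -> X -> R) :=
  [/\ forall w, Lp s0 w -> measurable_fun setT (S w),
      forall w x, 0 <= S w x,
      forall u w, Lp s0 u -> Lp s0 w ->
        \forall x \ae mu, S (fun t => u t + w t) x <= S u x + S w x &
      forall (c : R) w, Lp s0 w ->
        \forall x \ae mu, S (fun t => c%:C * w t) x = `|c| * S w x].

(** Stated on the unit ball; under homogeneity this is a norm inequality from [L^s] to [L^q], with
    the constant raised to the power [q]. *)
Definition bounded_at d (X : measurableType d) (mu : {measure set X -> \bar R})
    (S : (T -> C) -> X -> R) (s q C0 : R) :=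
  forall w, cmeas w -> (pint s w <= 1)%E ->
    (eint mu (fun x => S w x `^ q)%R <= C0%:E)%E.

(** Capping at [K] lets the exponent of the summand [v] drop from [r] to [r0], at the price
    [K^{r - r0}]. *)
Lemma min_split (u v z K r0 r : R) : 0 <= u -> 0 <= v -> 0 < K -> 0 < r0 -> r0 < r ->
  z <= u + v -> 0 <= z ->
  Num.min z K `^ r <= 2 `^ r * (u `^ r + K `^ (r - r0) * v `^ r0).
Proof.
move=> u0 v0 K0 r00 r0r zuv z0; have r1 : 0 < r by exact: lt_trans r0r.
pose v' := Num.min v K; have v'0 : 0 <= v' by rewrite le_min v0 ltW.
apply: (@le_trans _ _ ((u + v') `^ r)).
  apply: le_powR; [exact: ltW|by rewrite le_min z0 ltW|].
  rewrite /v' ge_min; have [vK|Kv] := leP v K; first by rewrite zuv.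
  by rewrite lerDr u0 orbT.
apply: (le_trans (powRD_le (ltW r1) u0 v'0)).
rewrite ler_wpM2l ?powR_ge0// lerD2l.
have [v'z|v'n] := eqVneq v' 0.
  by rewrite v'z powR0 ?gt_eqF// mulr_ge0 ?powR_ge0.
rewrite (_ : v' `^ r = v' `^ (r - r0) * v' `^ r0); last first.
  by rewrite -powRD ?v'n ?implybT// subrK.
by rewrite ler_pM ?powR_ge0//; apply: le_powR;
  rewrite ?subr_ge0 ?(ltW r0r) ?(ltW r00)// /v' ge_min lexx ?orbT.
Qed.

Section one_function.
Context d (X : measurableType d) (mu : {measure set X -> \bar R}).
Variables (S : (T -> C) -> X -> R) (s0 p s1 rho C0 C1 : R) (w : T -> C).
Hypotheses (s00 : 0 < s0) (s0p : s0 < p) (ps1 : p < s1).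
Hypotheses (rho0 : 0 < rho) (rs : 1 <= rho * s0).
Hypotheses (C00 : 0 <= C0) (C10 : 0 <= C1).
Hypotheses (HS : sublin mu s0 S).
Hypothesis b0 : bounded_at mu S s0 (rho * s0) C0.
Hypothesis b1 : bounded_at mu S s1 (rho * s1) C1.
Hypotheses (mw : cmeas w) (w1 : (pint p w <= 1)%E).

Let p0 : 0 < p := lt_trans s00 s0p.
Let s10 : 0 < s1 := lt_trans p0 ps1.

Let ws0 : Lp s0 w.
Proof.
apply: (@Lp_sub _ s0 p); rewrite ?(ltW s00) ?(ltW s0p)//; split => //.
by rewrite (le_lt_trans w1)// ltry.
Qed.

(** The rates are fixed by [s0 (1 + a) = p] and [s1 (1 - b) = p]: weights [2^{ka}] send [L^p] to
    [L^{s0}], and weights [2^{-kb}] send it to [L^{s1}]. *)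
Let a := p / s0 - 1.
Let b := 1 - p / s1.

Let a_gt0 : 0 < a. Proof. by rewrite subr_gt0 ltr_pdivlMr// mul1r. Qed.
Let b_gt0 : 0 < b. Proof. by rewrite subr_gt0 ltr_pdivrMr// mul1r. Qed.

Definition blocks n x := \sum_(k < n) S (block w k) x.

Lemma blocks_ge0 n x : 0 <= blocks n x.
Proof. by have [_ S0 _ _] := HS; rewrite sumr_ge0. Qed.

Lemma blocks_meas n : measurable_fun setT (blocks n).
Proof.
have [mS _ _ _] := HS; apply: measurable_sum => k; apply: mS.
exact: (Lp_cut (ltW s00) ws0).
Qed.

Lemma S_cut_le n : \forall x \ae mu, S (cut n (fun=> 1) w) x <= blocks n x.
Proof.
have [mS S0 SD SZ] := HS.
have Lc k c : Lp s0 (cut k c w) by exact: (Lp_cut (ltW s00) ws0).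
elim: n => [|n ih].
  apply: filterS (SZ 0 _ ws0) => x.
  rewrite normr0 mul0r /blocks big_ord0 => <-.
  rewrite (_ : cut _ _ _ = (fun t => (0 : R)%:C * w t))//.
  by apply/funext => t; rewrite /cut /mult big_ord0.
have := SD _ _ (Lc n (fun=> 1)) (Lc n.+1 (fun j => (j == n)%:R)).
apply: filterS2 ih => x ih H; rewrite /blocks big_ord_recr /=.
rewrite (_ : cut n.+1 _ w = (fun t => cut n (fun=> 1) w t + block w n t)); last first.
  by apply/funext => t; exact: cutS.
by apply: (le_trans H); rewrite lerD.
Qed.

(** Averaging bounds the [k]-th term by [A x 2^{-ka}] and by [B x 2^{kb}], so the sum is at most a
    product of powers of [A x] and [B x], whose [rho p]-th power is a geometric mean of the
    integrable functions [A^{rho s0}] and [B^{rho s1}]. *)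
Lemma blocks_bound (K : R) : 0 <= K ->
  (forall n (x : nat -> R) (A B : R), 0 <= A -> 0 <= B ->
    (forall k, (k < n)%N -> [/\ 0 <= x k, x k <= A * 2 `^ (- (k%:R * a)) &
                                 x k <= B * 2 `^ (k%:R * b)]) ->
    \sum_(k < n) x k <= K * (A `^ (b / (a + b)) * B `^ (a / (a + b)))) ->
  forall n, (eint mu (fun x => blocks n x `^ (rho * p))%R <=
    (K `^ (rho * p) * ((2 `^ s0 * 2) `^ rho * C0 + (2 `^ s1 * 2) `^ rho * C1))%:E)%E.
Proof.
move=> K0 HK n; have [mS S0 SD SZ] := HS.
pose ca (k : nat) : R := 2 `^ (k%:R * a).
pose cb (k : nat) : R := 2 `^ (k%:R * - b).
have ca0 k : 0 < ca k by rewrite powR_gt0.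
have cb0 k : 0 < cb k by rewrite powR_gt0.
pose A := avg S n ca w; pose B := avg S n cb w.
have A0 x : 0 <= A x by exact: avg_ge0.
have B0 x : 0 <= B x by exact: avg_ge0.
have mA : measurable_fun setT A by exact: (avg_meas mS (ltW s00)).
have mB : measurable_fun setT B by exact: (avg_meas mS (ltW s00)).
have s0a : s0 * (1 + a) = p by rewrite /a addrC subrK mulrC divfK// gt_eqF.
have s1b : s1 * (1 + - b) = p by rewrite /b opprB addrC subrK mulrC divfK// gt_eqF.
have a1 : -1 <= a by rewrite (le_trans _ (ltW a_gt0))// oppr_le0.
have b1' : -1 <= - b.
  by rewrite /b opprB lerBrDr addNr divr_ge0// ltW.
have ab0 : 0 < a + b by rewrite addr_gt0.
have rs1 : 1 <= rho * s1.
  by rewrite (le_trans rs)// ler_wpM2l ?(ltW rho0)// ltW// (lt_trans s0p).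
have HA : (eint mu (fun x => A x `^ (rho * s0))%R <= ((2 `^ s0 * 2) `^ rho * C0)%:E)%E.
  apply: (avg_bound mS S0 SZ (ltW s00) ws0) => //.
  - by move=> u _ mu' u1; exact: b0.
  - by move=> e; apply: (pint_cut a1 s00 s0a) => // k _; exact: sgc_norm.
have HB : (eint mu (fun x => B x `^ (rho * s1))%R <= ((2 `^ s1 * 2) `^ rho * C1)%:E)%E.
  apply: (avg_bound mS S0 SZ (ltW s00) ws0) => //.
  - by move=> u _ mu' u1; exact: b1.
  - by move=> e; apply: (pint_cut b1' s10 s1b) => // k _; exact: sgc_norm.
have allk (c : nat -> R) : (forall k, 0 < c k) ->
    \forall x \ae mu, forall k : 'I_n, c k * S (block w k) x <= avg S n c w x.
  move=> c0; apply: (filter_forall (ae_filter_ringOfSetsType mu)) => k.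
  exact: (block_le_avg SD SZ (ltW s00) ws0 c0 (ltn_ord k)).
have HAk := allk _ ca0; have HBk := allk _ cb0.
rewrite -/A in HAk; rewrite -/B in HBk.
clearbody A B.
have mAr : measurable_fun setT (fun x => A x `^ (rho * s0)).
  exact: (measurableT_comp (@measurable_powR R _)).
have mBr : measurable_fun setT (fun x => B x `^ (rho * s1)).
  exact: (measurableT_comp (@measurable_powR R _)).
apply: (@le_trans _ _ (eint mu (fun x => K `^ (rho * p) *
    (A x `^ (rho * s0) + B x `^ (rho * s1)))%R)); last first.
  rewrite eintZ ?powR_ge0//; last 2 first.
  - exact: measurable_funD.
  - by move=> x; rewrite addr_ge0 ?powR_ge0.
  rewrite eintD//; [|by move=> x; exact: powR_ge0|by move=> x; exact: powR_ge0].
  by rewrite EFinM EFinD lee_wpmul2l ?lee_fin ?powR_ge0// leeD.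
apply: eint_le_ae.
- exact: (measurableT_comp (@measurable_powR R _) (blocks_meas n)).
- by apply: measurable_funM => //; exact: measurable_funD.
- by move=> x; exact: powR_ge0.
- by move=> x; rewrite mulr_ge0 ?addr_ge0 ?powR_ge0.
apply: filterS2 HAk HBk => x Ha Hb.
have rp0 : 0 <= rho * p by rewrite mulr_ge0// ltW.
apply: (@le_trans _ _ ((K * (A x `^ (b / (a + b)) * B x `^ (a / (a + b)))) `^ (rho * p))).
  apply: le_powR => //; first exact: blocks_ge0.
  apply: (HK n (fun k => S (block w k) x) (A x) (B x)) => // k kn; split => //.
  - rewrite powRN ler_pdivlMr ?powR_gt0// mulrC; exact: Ha (Ordinal kn).
  - rewrite -[k%:R * b]opprK -mulrN powRN ler_pdivlMr ?powR_gt0// mulrC.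
    exact: Hb (Ordinal kn).
rewrite powRM ?mulr_ge0 ?powR_ge0// powRM ?powR_ge0// ler_wpM2l ?powR_ge0//.
rewrite -!powRrM.
(* The outer exponents add up to 1, since [(1 + a) b + (1 - b) a = a + b]. *)
have -> : b / (a + b) * (rho * p) = rho * s0 * ((1 + a) * b / (a + b)).
  by rewrite -s0a; field; rewrite gt_eqF.
have -> : a / (a + b) * (rho * p) = rho * s1 * ((1 - b) * a / (a + b)).
  by rewrite -s1b; field; rewrite gt_eqF.
rewrite !(powRrM _ (rho * _)); apply: powR_split; rewrite ?powR_ge0//.
- by apply: divr_ge0; [apply: mulr_ge0; [apply: addr_ge0|]|]; rewrite ?ler01//; exact: ltW.
- apply: divr_ge0; last exact: ltW.
  by apply: mulr_ge0; rewrite ?(ltW a_gt0)// /b subKr; apply: divr_ge0; exact: ltW.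
- by field; rewrite gt_eqF.
Qed.

(** [S w] is at most the sum of the blocks plus the image of a tail, which is small only in the
    lower exponent [rho s0]. Truncation at [K] makes that enough: for fixed [K] the number of levels
    goes to infinity. *)
Lemma min_bound (M K : R) : 0 < K -> 0 <= M ->
  (forall n, (eint mu (fun x => blocks n x `^ (rho * p))%R <= M%:E)%E) ->
  (eint mu (fun x => Num.min (S w x) K `^ (rho * p))%R <= (2 `^ (rho * p) * M)%:E)%E.
Proof.
move=> K0 M0 HM; have [mS S0 SD SZ] := HS.
have rps : rho * s0 < rho * p by rewrite ltr_pM2l.
have rs00 : 0 < rho * s0 by rewrite mulr_gt0.
pose D := K `^ (rho * p - rho * s0).
pose del n : R := ((2 ^+ n.+1)^-1 `^ (p - s0)) `^ rho * C0.
have step n : (eint mu (fun x => Num.min (S w x) K `^ (rho * p))%R <=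
    (2 `^ (rho * p) * (M + D * del n))%:E)%E.
  have mt := cmeas_tail n.+1 mw.
  have tl := pint_tail n s00 s0p mw w1.
  have Lt : Lp s0 (tail n.+1 w) by split => //; rewrite (le_lt_trans tl)// ltry.
  have St : (eint mu (fun x => S (tail n.+1 w) x `^ (rho * s0))%R <= (del n)%:E)%E.
    apply: (S_scale mS S0 SZ (ltW s00)) => //.
    by move=> u _ mu' u1; exact: b0.
  have mb : measurable_fun setT (fun x => blocks n.+1 x `^ (rho * p)).
    exact: (measurableT_comp (@measurable_powR R _) (blocks_meas _)).
  have mt' : measurable_fun setT (fun x => S (tail n.+1 w) x `^ (rho * s0)).
    exact: (measurableT_comp (@measurable_powR R _) (mS _ Lt)).
  apply: (@le_trans _ _ (eint mu (fun x => 2 `^ (rho * p) *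
      (blocks n.+1 x `^ (rho * p) + D * S (tail n.+1 w) x `^ (rho * s0)))%R)); last first.
    rewrite eintZ ?powR_ge0//; last 2 first.
    - by apply: measurable_funD => //; exact: measurable_funM.
    - by move=> x; rewrite addr_ge0 ?mulr_ge0 ?powR_ge0.
    rewrite eintD//; last 3 first.
    - exact: measurable_funM.
    - by move=> x; exact: powR_ge0.
    - by move=> x; rewrite mulr_ge0 ?powR_ge0.
    rewrite eintZ ?powR_ge0//; last by move=> x; exact: powR_ge0.
    rewrite EFinM lee_wpmul2l ?lee_fin ?powR_ge0// EFinD leeD//.
    by rewrite EFinM lee_wpmul2l ?lee_fin ?powR_ge0.
  apply: eint_le_ae.
  - apply: (measurableT_comp (@measurable_powR R _)); apply: measurable_minr => //.
    exact: mS.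
  - by apply: measurable_funM => //; apply: measurable_funD => //; exact: measurable_funM.
  - by move=> x; exact: powR_ge0.
  - by move=> x; rewrite mulr_ge0 ?addr_ge0 ?mulr_ge0 ?powR_ge0.
  have Lc : Lp s0 (cut n.+1 (fun=> 1) w) by exact: (Lp_cut (ltW s00) ws0).
  apply: filterS2 (S_cut_le n.+1) (SD _ _ Lc Lt) => x H1 H2.
  apply: min_split => //; first exact: blocks_ge0.
  rewrite (_ : (fun t => _) = w) in H2; last first.
    by apply/funext => t; rewrite /tail addrC subrK.
  by apply: (le_trans H2); rewrite lerD2r.
have del0 : del n @[n --> \oo] --> 0.
  pose q : R := 2^-1 `^ ((p - s0) * rho).
  have -> : del = (fun n => q ^+ n * (q * C0)).
    apply/funext => n; rewrite /del mulrA -exprSr; congr (_ * _).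
    rewrite -powRrM -exprVn /q -[RHS]powR_mulrn ?powR_ge0//.
    by rewrite -[RHS]powRrM [_ * n.+1%:R]mulrC [RHS]powRrM powR_mulrn// invr_ge0.
  rewrite -(mul0r (q * C0)); apply: cvgMl; apply: cvg_expr.
  rewrite ger0_norm ?powR_ge0// /q -(powR_inv1 (ler0n _ 2)) -powRrM mulN1r powRN.
  rewrite invf_lt1 ?powR_gt0//; apply: powR_gt1; last by rewrite ltr1n.
  by rewrite mulr_gt0// subr_gt0.
have lim : (2 `^ (rho * p) * (M + D * del n)) @[n --> \oo] --> 2 `^ (rho * p) * M.
  rewrite -[in X in _ --> X](addr0 M) -(mulr0 D).
  by apply: cvgMr; apply: cvgD; [exact: cvg_cst|exact: cvgMr].
have fin : (eint mu (fun x => Num.min (S w x) K `^ (rho * p))%R) \is a fin_num.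
  rewrite ge0_fin_numE ?(le_lt_trans (step 0%N)) ?ltry//.
  by apply: eint_ge0 => x; exact: powR_ge0.
rewrite -(fineK fin) lee_fin; apply: (cvgr_to_ge lim); near=> n.
by rewrite -lee_fin fineK.
Unshelve. all: by end_near. Qed.

(** The truncations at [n + 1] are eventually equal to [S w] at each point, and their bound does not
    depend on the height. *)
Lemma interp_one (M : R) : 0 <= M ->
  (forall n, (eint mu (fun x => blocks n x `^ (rho * p))%R <= M%:E)%E) ->
  (eint mu (fun x => S w x `^ (rho * p))%R <= (2 `^ (rho * p) * M)%:E)%E.
Proof.
move=> M0 HM; have [mS S0 SD SZ] := HS.
apply: (@eint_fatou _ _ _ mu (fun n x => Num.min (S w x) n.+1%:R `^ (rho * p))).
- move=> n; apply: (measurableT_comp (@measurable_powR R _)).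
  by apply: measurable_minr => //; exact: mS.
- by move=> n x; exact: powR_ge0.
- exact: (measurableT_comp (@measurable_powR R _) (mS _ ws0)).
- by move=> x; exact: powR_ge0.
- apply: aeW => x; apply: cvg_near_cst.
  exists (Num.truncn (S w x)).+1 => //= n Kn; congr (_ `^ _).
  apply/min_idPl; apply: ltW; apply: (lt_le_trans (truncnS_gt _)).
  by rewrite ler_nat ltnW.
- by move=> n; apply: min_bound.
Qed.

End one_function.

(** [K] is chosen before the operator, so it depends on the exponents and on [C0], [C1] alone; M.
    Riesz' theorem needs this uniformity in the radius. *)
Theorem interpolation (s0 p s1 rho C0 C1 : R) : 0 < s0 -> s0 < p -> p < s1 ->
  0 < rho -> 1 <= rho * s0 -> 0 <= C0 -> 0 <= C1 ->
  exists2 K : R, 0 <= K &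
    forall d (X : measurableType d) (mu : {measure set X -> \bar R})
      (S : (T -> C) -> X -> R),
      sublin mu s0 S -> bounded_at mu S s0 (rho * s0) C0 ->
      bounded_at mu S s1 (rho * s1) C1 -> bounded_at mu S p (rho * p) K.
Proof.
move=> s00 s0p ps1 rho0 rs C00 C10.
have p0 : 0 < p by exact: lt_trans s0p.
have s10 : 0 < s1 by exact: lt_trans ps1.
have [||K K0 HK] := @min_sum R (p / s0 - 1) (1 - p / s1).
- by rewrite subr_gt0 ltr_pdivlMr// mul1r.
- by rewrite subr_gt0 ltr_pdivrMr// mul1r.
pose M := K `^ (rho * p) * ((2 `^ s0 * 2) `^ rho * C0 + (2 `^ s1 * 2) `^ rho * C1).
have M0 : 0 <= M by rewrite mulr_ge0 ?addr_ge0 ?mulr_ge0 ?powR_ge0.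
exists (2 `^ (rho * p) * M); first by rewrite mulr_ge0 ?powR_ge0.
move=> d X mu S HS b0 b1 w mw w1.
apply: (@interp_one d X mu S s0 p rho C0 w) => //.
exact: (@blocks_bound d X mu S s0 p s1 rho C0 C1 w).
Qed.

End interpolation_thm.

(** * M. Riesz' theorem *)

Section cauchy_transform.
Context {R : realType}.
Notation C := R[i].
Notation T := (measurableTypeR R).
Local Notation m := (circle_measure R).
Implicit Types (z : C) (w u : T -> C) (p : R).

Definition I1 w : R := \int[m]_t N (w t).

Lemma I1_ge0 w : 0 <= I1 w.
Proof. by apply: Rintegral_ge0 => t _; exact: N_ge0. Qed.

Lemma N_cint_le u w (M : R) : cL1 u -> cL1 w -> (forall t, N (u t) <= M * N (w t)) ->
  N (cint u) <= M * I1 w.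
Proof.
move=> u1 w1 H; apply: (le_trans (le_cint u1)).
rewrite -RintegralZl//; last exact: cL1_N.
apply: le_Rintegral => //; first exact: cL1_N.
have := integrableZl measurableT M (cL1_N w1).
by apply: eq_integrable => // t _.
Qed.

Lemma N_cauchy w z : cL1 w -> N z < 1 -> N (cauchy w z) <= (1 - N z)^-1 * I1 w.
Proof.
move=> w1 z1; apply: N_cint_le => //; first exact: cL1_ckM.
by move=> t; rewrite NM ler_wpM2r ?N_ge0// N_ck.
Qed.

Lemma cauchyD u w z : cL1 u -> cL1 w -> N z < 1 ->
  cauchy (fun t => u t + w t) z = cauchy u z + cauchy w z.
Proof.
move=> u1 w1 z1; rewrite /cauchy -cintD; [|exact: cL1_ckM|exact: cL1_ckM].
by apply: cint_ext => t; rewrite mulrDr.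
Qed.

Lemma cauchyZ c w z : cL1 w -> N z < 1 -> cauchy (fun t => c * w t) z = c * cauchy w z.
Proof.
move=> w1 z1; rewrite /cauchy -cintZ; last exact: cL1_ckM.
by apply: cint_ext => t; rewrite mulrCA.
Qed.

Lemma cauchy0 w : cL1 w -> cauchy w 0 = cint w.
Proof. by move=> w1; apply: cint_ext => t; rewrite /ck mul0r subr0 invr1 mul1r. Qed.

(** Differentiation under the integral: the second order remainder of the kernel is [k^2] times a
    product of three kernels bounded by [B], as [z + k] keeps distance [q / 2] from the circle. *)
Lemma cauchy_cdiff w z : cL1 w -> N z < 1 -> cdiff (cauchy w) z.
Proof.
move=> w1 z1; pose q := 1 - N z; have q0 : 0 < q by rewrite subr_gt0.
pose dk t := cj (cis t) * (ck z t * ck z t).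
have cdk : cctn dk.
  apply: cctnM; first exact: cctn_conj cctn_cis.
  by apply: cctnM; exact: cctn_ck.
have bdk t : N (dk t) <= q^-1 * q^-1.
  by rewrite !NM Nconj Ncis mul1r ler_pM ?N_ge0// N_ck.
have dk1 : cL1 (fun t => dk t * w t) := cL1M_bnd (cctn_meas cdk) bdk w1.
exists (cint (fun t => dk t * w t)) => e e0.
pose B := q^-1 * q^-1 * (q / 2)^-1.
have B0 : 0 < B by rewrite !mulr_gt0 ?invr_gt0 ?divr_gt0 ?mulr_gt0.
pose D := B * I1 w + 1.
have D0 : 0 < D by rewrite ltr_wpDl// mulr_ge0 ?I1_ge0// ltW.
exists (Num.min (q / 2) (e / D)); first by rewrite lt_min !divr_gt0.
move=> k; rewrite lt_min => /andP[kq ke].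
have zk1 : N (z + k) < 1.
  by apply: (le_lt_trans (ND _ _)); move: kq; rewrite /q; lra.
have zkq : (1 - N (z + k))^-1 <= (q / 2)^-1.
  rewrite lef_pV2 ?posrE ?subr_gt0// ?divr_gt0//.
  by have := ND z k; move: kq; rewrite /q; lra.
have -> : cauchy w (z + k) - cauchy w z - cint (fun t => dk t * w t) * k =
    cint (fun t => (ck (z + k) t - ck z t - k * dk t) * w t).
  have a1 := cL1_ckM zk1 w1; have a2 := cL1_ckM z1 w1.
  rewrite /cauchy -cintB// [_ * k]mulrC -cintZ// -cintB//.
  - by apply: cint_ext => t; ring.
  - exact: cL1B.
  - exact: cL1Z.
apply: (@le_trans _ _ (B * N k ^+ 2 * I1 w)).
  apply: N_cint_le => //.
    have a1 := cL1_ckM zk1 w1; have a2 := cL1_ckM z1 w1.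
    rewrite (_ : (fun t => _) =
      (fun t => ck (z + k) t * w t - ck z t * w t - k * (dk t * w t))); last first.
      by apply/funext => t; ring.
    exact: cL1B (cL1B a1 a2) (cL1Z k dk1).
  move=> t; rewrite NM ler_wpM2r ?N_ge0//.
  have E : ck (z + k) t - ck z t - k * dk t =
      (k * cj (cis t)) ^+ 2 * (ck z t * ck z t * ck (z + k) t).
    rewrite /dk /ck; move: (ck_neq0 t z1) (ck_neq0 t zk1).
    by move: (cj _) => c h1 h2; field; rewrite h1 h2.
  rewrite E NM NX N_mcis mulrC ler_wpM2r ?sqr_ge0// !NM.
  by rewrite !ler_pM ?mulr_ge0 ?N_ge0// ?(le_trans (N_ck t zk1))// N_ck.
rewrite expr2 mulrA mulrAC ler_wpM2r ?N_ge0//.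
move: ke; rewrite ltr_pdivlMr// => /ltW; apply: le_trans.
by rewrite mulrAC mulrC ler_wpM2l ?N_ge0// lerDl.
Qed.

Lemma cauchy_cctn w r : cL1 w -> 0 <= r < 1 -> cctn (fun t => cauchy w (r%:C * cis t)).
Proof. by move=> w1 r1; apply: holo_cctn => // z; exact: cauchy_cdiff. Qed.

Lemma Nr r t : 0 <= r < 1 -> N (r%:C * cis t : C) < 1.
Proof. by move=> /andP[r0 r1]; rewrite N_circle. Qed.

Lemma pois_cmeas w r : cL1 w -> 0 <= r < 1 -> cmeas (fun t => pois w (r%:C * cis t) : C).
Proof.
move=> w1 r1.
rewrite (_ : (fun t => _) = (fun t => cauchy w (r%:C * cis t) +
  cj (cauchy (fun t => cj (w t)) (r%:C * cis t)) - cint w)); last first.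
  by apply/funext => t; rewrite poisE// Nr.
apply: cmeasB; last exact: cmeas_cst.
apply: cmeasD; first exact: cctn_meas (cauchy_cctn _ _).
apply: cmeas_conj; apply: cctn_meas (cauchy_cctn _ _) => //; exact: cL1_conj.
Qed.

(** The tangent of [x^p] at [|pois w z|] is integrated against the kernel, a probability density by
    [eint_pk]. *)
Lemma pois_jensen p w z : 1 <= p -> cL1 w -> N z < 1 ->
  ((N (pois w z) `^ p)%:E <= eint m (fun t => pk z t * N (w t) `^ p)%R)%E.
Proof.
move=> p1 w1 z1; set y := N _; have y0 : 0 <= y by exact: N_ge0.
have mw := cL1_meas w1; have mp := pk_meas z1.
have k0 t := pk_ge0 t z1.
have p0 : 0 < p by rewrite (lt_le_trans _ p1).
have mN : measurable_fun setT (fun t => pk z t * N (w t)).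
  by apply: measurable_funM => //; exact: cmeas_N.
have mNp : measurable_fun setT (fun t => pk z t * N (w t) `^ p).
  by apply: measurable_funM => //; exact: cmeas_Npow.
have ge1 t : 0 <= pk z t * N (w t) by rewrite mulr_ge0 ?N_ge0.
have ge2 t : 0 <= pk z t * N (w t) `^ p by rewrite mulr_ge0 ?powR_ge0.
have yle : (y%:E <= eint m (fun t => pk z t * N (w t))%R)%E.
  have := le_cint_eint (cL1_pk z1 w1); congr (_ <= _)%E.
  by apply: eq_integral => t _; rewrite NM NR ger0_norm.
have c0 : 0 <= p * y `^ (p - 1) by rewrite mulr_ge0 ?powR_ge0 ?(ltW p0).
have d0 : 0 <= (p - 1) * y `^ p by rewrite mulr_ge0 ?powR_ge0// subr_ge0.
have H : ((p * y `^ (p - 1) * y)%:E <=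
    eint m (fun t => pk z t * N (w t) `^ p)%R + ((p - 1) * y `^ p)%:E)%E.
  rewrite EFinM; apply: (le_trans (lee_wpmul2l _ yle)); first by rewrite lee_fin.
  rewrite -eintZ// -[X in (_ + X)%E]mule1 -(eint_pk z1) -eintZ//.
  rewrite -eintD//; last 2 first.
  - exact: measurable_funM.
  - by move=> t; rewrite mulr_ge0.
  apply: eint_le.
  - exact: measurable_funM.
  - by apply: measurable_funD => //; exact: measurable_funM.
  - by move=> t; rewrite mulr_ge0.
  move=> t; rewrite mulrCA [_ * pk z t]mulrC -mulrDr ler_wpM2l//.
  by apply: powR_tangent; rewrite ?N_ge0.
have E : p * y `^ (p - 1) * y = y `^ p + (p - 1) * y `^ p.
  by rewrite -mulrA [_ * y]mulrC mulr_powRB1//; ring.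
by move: H; rewrite E EFinD leeD2rE.
Qed.

Lemma cmeasV d (X : measurableType d) (v : X -> C) : cmeas v -> cmeas (fun x => (v x)^-1).
Proof.
move=> mv; rewrite (_ : (fun x => _) = (fun x => cj (v x) * (N (v x) `^ (-2))%:C)).
  by apply: cmeasM; [exact: cmeas_conj|apply: cmeasR; exact: cmeas_Npow].
apply/funext => x; have [->|v0] := eqVneq (v x) 0.
  by rewrite invr0 conj0 mul0r.
have Nv : (N (v x) ^+ 2)%:C != 0 :> C.
  by rewrite -N_eq0 NR normr_eq0 expf_eq0/= N_eq0.
rewrite powRN powR_mulrn ?N_ge0// fmorphV /= -mul_conj.
have cv0 : cj (v x) != 0 by rewrite -N_eq0 Nconj N_eq0.
by rewrite invfM mulrCA mulfV ?mulr1.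
Qed.

Lemma cmeas_cis1 : cmeas (fun x : T * T => cis x.1 : C).
Proof. by apply: (cmeas_comp (@measurable_fst _ _ T T)) (cctn_meas cctn_cis). Qed.

Lemma cmeas_cis2 : cmeas (fun x : T * T => cis x.2 : C).
Proof. by apply: (cmeas_comp (@measurable_snd _ _ T T)) (cctn_meas cctn_cis). Qed.

Lemma cmeas_ck (r : R) : cmeas (fun x : T * T => ck (r%:C * cis x.1) x.2 : C).
Proof.
apply: cmeasV; apply: cmeasB; first exact: cmeas_cst.
apply: cmeasM; last exact: cmeas_conj cmeas_cis2.
by apply: cmeasM; [exact: cmeas_cst|exact: cmeas_cis1].
Qed.

Lemma meas_pk (r : R) : measurable_fun setT (fun x : T * T => pk (r%:C * cis x.1) x.2 : R).
Proof.
rewrite (_ : (fun x => _) = (fun x => (1 - N (r%:C * cis x.1 : C) ^+ 2) *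
    N (ck (r%:C * cis x.1) x.2 : C) `^ 2)).
  apply: measurable_funM; last exact: cmeas_Npow (cmeas_ck r).
  apply: measurable_funB => //; apply: measurable_funX; apply: cmeas_N.
  by apply: cmeasM; [exact: cmeas_cst|exact: cmeas_cis1].
by apply/funext => x; rewrite /pk /ck powR_mulrn ?N_ge0// NV exprVn.
Qed.

(** After exchanging the integrals, [pkC] turns the inner one into the mass of a Poisson kernel. *)
Lemma pk_tonelli (h : T -> R) r : measurable_fun setT h -> (forall t, 0 <= h t) ->
  0 <= r < 1 ->
  (\int[m]_s eint m (fun t => pk (r%:C * cis s) t * h t)%R = eint m h)%E.
Proof.
move=> mh h0 r1.
pose F (x : T * T) := (pk (r%:C * cis x.1) x.2 * h x.2)%:E.
have F0 x : (0 <= F x)%E by rewrite lee_fin mulr_ge0// pk_ge0// Nr.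
have mF : measurable_fun setT F.
  apply/measurable_EFinP; apply: measurable_funM; first exact: meas_pk.
  exact: (measurableT_comp mh (@measurable_snd _ _ T T)).
have := @fubini_tonelli _ _ T T R m m F mF F0; congr (_ = _).
apply: eq_integral => t _.
rewrite -[RHS]mule1 -(@eint_pk _ (r%:C * cis t)) ?Nr// -eintZ//.
- apply: eq_integral => s _; rewrite /F /= mulrC pkC//.
  by case/andP: r1.
- by apply: pk_meas; exact: Nr.
- by move=> s; apply: pk_ge0; exact: Nr.
Qed.

(** Kept abstract in [h] in order to serve both the powers [|a|^p] and the function [phi] below. *)
Lemma jensen_contract (h : C -> R) w r : cL1 w -> 0 <= r < 1 -> (forall a, 0 <= h a) ->
  (forall u : T -> C, cmeas u -> measurable_fun setT (fun t => h (u t))) ->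
  (forall z, N z < 1 ->
    ((h (pois w z))%:E <= eint m (fun t => pk z t * h (w t))%R)%E) ->
  (eint m (fun t => h (pois w (r%:C * cis t)))%R <= eint m (fun t => h (w t)))%E.
Proof.
move=> w1 r1 h0 mh J; have mw := cL1_meas w1.
rewrite -(pk_tonelli (mh _ mw) _ r1)//.
pose F (x : T * T) := (pk (r%:C * cis x.1) x.2 * h (w x.2))%:E.
have F0 x : (0 <= F x)%E by rewrite lee_fin mulr_ge0// pk_ge0// Nr.
have mF : measurable_fun setT F.
  apply/measurable_EFinP; apply: measurable_funM; first exact: meas_pk.
  exact: (measurableT_comp (mh _ mw) (@measurable_snd _ _ T T)).
apply: ge0_le_integral => //.
- by move=> s _; rewrite lee_fin.
- by apply/measurable_EFinP; apply: mh; exact: pois_cmeas.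
- exact: (@measurable_fun_fubini_tonelli_F _ _ T T R m F mF F0).
- by move=> s _; apply: J; exact: Nr.
Qed.

Lemma pois_contract p w r : 1 <= p -> cL1 w -> 0 <= r < 1 ->
  (pint p (fun t => pois w (r%:C * cis t))%R <= pint p w)%E.
Proof.
move=> p1 w1 r1; apply: (@jensen_contract (fun a => N a `^ p)) => //.
- by move=> a; exact: powR_ge0.
- by move=> u mu; exact: cmeas_Npow.
- by move=> z z1; exact: pois_jensen.
Qed.

(** A majorant [M |w|] in the second variable makes rows, columns and the double integral converge
    absolutely; the two components are then exchanged separately. *)
Lemma cfubini (k : T * T -> C) w (M : R) : cmeas k -> cL1 w ->
  (forall x, N (k x) <= M * N (w x.2)) ->
  cint (fun s => cint (fun t => k (s, t))) = cint (fun t => cint (fun s => k (s, t))).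
Proof.
move=> mk w1 kM; have mw := cL1_meas w1.
have M1 : cL1 (fun t => M%:C * w t) by exact: cL1Z.
have row s : cL1 (fun t => k (s, t)).
  apply: cL1P; first by apply: (cmeas_comp _ mk); exact: pair1_measurable.
  apply: (@le_lt_trans _ _ (eint m (fun t => N (M%:C * w t)))).
    apply: eint_le.
    - by apply: cmeas_N; apply: (cmeas_comp _ mk); exact: pair1_measurable.
    - by apply: cmeas_N; exact: cL1_meas.
    - by move=> t; exact: N_ge0.
    - move=> t; rewrite NM NR; apply: (le_trans (kM (s, t))).
      by rewrite ler_wpM2r ?N_ge0// ler_norm.
  have /integrableP[_] := cL1_N M1; congr (_ < _)%E.
  by apply: eq_integral => t _ /=; rewrite ger0_norm ?N_ge0.
have col t : cL1 (fun s => k (s, t)).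
  apply: (@cL1_bnd _ _ (M * N (w t))).
    by apply: (cmeas_comp _ mk); exact: pair2_measurable.
  by move=> s; exact: (kM (s, t)).
have key (f : T * T -> R) : measurable_fun setT f -> (forall x, `|f x| <= N (k x)) ->
    (forall s, m.-integrable setT (EFin \o (fun t => f (s, t)))) ->
    (forall t, m.-integrable setT (EFin \o (fun s => f (s, t)))) ->
    (\int[m]_s \int[m]_t f (s, t) = \int[m]_t \int[m]_s f (s, t))%R.
  move=> mf fk ir ic; rewrite /Rintegral; congr fine.
  transitivity (\int[m]_s \int[m]_t (f (s, t))%:E)%E.
    apply: eq_integral => s _; rewrite fineK//.
    exact: (integrable_fin_num measurableT (ir s)).
  transitivity (\int[m]_t \int[m]_s (f (s, t))%:E)%E; last first.
    apply: eq_integral => s _; rewrite fineK//.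
    exact: (integrable_fin_num measurableT (ic s)).
  apply: (@Fubini _ _ T T R m m (EFin \o f)).
  have mf' : measurable_fun setT (EFin \o f) by exact/measurable_EFinP.
  apply/(integrable12ltyP m m mf').
  apply: (@le_lt_trans _ _ (\int[m]_(s in setT) eint m (fun t => N (M%:C * w t)%R))%E).
    apply: ge0_le_integral => //.
    - by move=> s _; apply: integral_ge0 => t _; rewrite abse_ge0.
    - apply: (@measurable_fun_fubini_tonelli_F _ _ T T R m (fun x => `|(f x)%:E|%E)).
        exact: measurableT_comp.
      by move=> x; rewrite abse_ge0.
    - move=> s _; apply: eint_le.
      + apply: measurableT_comp => //; apply: measurableT_comp mf _.
        exact: pair1_measurable.
      + by apply: cmeas_N; exact: cL1_meas.
      + by move=> t.
      + move=> t; apply: (le_trans (fk _)); apply: (le_trans (kM _)).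
        by rewrite NM NR ler_wpM2r ?N_ge0// ler_norm.
  rewrite integral_cst// [X in (_ * X)%E]circle_setT mule1.
  have /integrableP[_] := cL1_N M1; congr (_ < _)%E.
  by apply: eq_integral => t _ /=; rewrite ger0_norm ?N_ge0.
apply: complex_eq.
- apply: (key (fun x => Re (k x))); first by case: mk.
  + by move=> x; exact: normRe.
  + by move=> s; case: (row s).
  + by move=> t; case: (col t).
- apply: (key (fun x => Im (k x))); first by case: mk.
  + by move=> x; exact: normIm.
  + by move=> s; case: (row s).
  + by move=> t; case: (col t).
Qed.

End cauchy_transform.

Section powR_continuity.
Context {R : realType}.

Lemma cvgR_P (a : nat -> R) l : a n @[n --> \oo] --> l <->
  forall e : R, 0 < e -> \forall n \near \oo, `|l - a n| < e.
Proof. exact: (@cvgrPdist_lt _ R^o _ _ _ _ _). Qed.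

Lemma powR_cvg (p b : R) (a : nat -> R) : 0 < p -> (forall n, 0 <= a n) ->
  a n @[n --> \oo] --> b -> a n `^ p @[n --> \oo] --> b `^ p.
Proof.
move=> p0 a0 ab.
have b0 : 0 <= b by apply: (cvgr_to_ge ab); near=> n.
have [b_gt0|] := ltP 0 b; last first.
  move=> b_le0; have bE : b = 0 by apply/eqP; rewrite eq_le b_le0.
  rewrite bE powR0 ?gt_eqF//; apply/cvgR_P => e e0.
  have d0 : 0 < e `^ p^-1 by rewrite powR_gt0.
  have := (cvgR_P _ _).1 ab _ d0; rewrite bE.
  apply: filterS => n; rewrite !sub0r !normrN !ger0_norm ?powR_ge0// => an.
  have -> : e = (e `^ p^-1) `^ p by rewrite -powRrM mulVf ?gt_eqF// powRr1// ltW.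
  by apply: gt0_ltr_powR => //; rewrite nnegrE// ltW.
have : {for b, continuous (fun x : R => x `^ p)}.
  apply: differentiable_continuous; apply/derivable1_diffP.
  have : is_derive b 1 ((@powR R) ^~ p) (p * b `^ (p - 1)) by exact: is_derive1_powR.
  by case.
by move=> H; exact: (cvg_comp _ _ ab H).
Unshelve. all: by end_near. Qed.

Lemma powRM2 (x p : R) : 0 <= x -> x `^ (2 * p) = (x `^ p) ^+ 2.
Proof. by move=> x0; rewrite mulrC powRrM powR_mulrn// powR_ge0. Qed.

(** Radii tending to 1 along a sequence, so that Fatou's lemma and measurable upper limits apply. *)
Definition rseq (n : nat) : R := 1 - n.+2%:R^-1.

Lemma rseq_itv n : 0 <= rseq n < 1.
Proof.
rewrite /rseq subr_ge0 invf_le1 ?ltr0n// ler1n /=.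
by rewrite ltrBlDr ltrDl invr_gt0 ltr0n.
Qed.

Lemma rseq_cvg : rseq n @[n --> \oo] --> (1 : R).
Proof.
rewrite -[X in _ --> X]subr0; apply: cvgB; first exact: cvg_cst.
by have := @cvg_harmonic R; rewrite -(cvg_shiftS (@harmonic R)).
Qed.

End powR_continuity.

(** * The Cauchy transform on [L^p] *)

Section riesz.
Context {R : realType}.
Notation C := R[i].
Notation T := (measurableTypeR R).
Local Notation m := (circle_measure R).
Implicit Types (z : C) (w u : T -> C) (p : R) (F : C -> C).

Lemma NcvgP (a : nat -> C) b : (forall e : R, 0 < e -> \forall n \near \oo, N (a n - b) < e) ->
  N (a n) @[n --> \oo] --> N b.
Proof.
move=> H; apply/cvgR_P => e e0; apply: filterS (H e e0) => n.
apply: le_lt_trans; rewrite ler_norml; apply/andP; split.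
  by rewrite lerNl opprB; exact: N_leB.
by rewrite NBC; exact: N_leB.
Qed.

Lemma rseq_mul_itv (r : R) n : 0 <= r < 1 -> 0 <= r * rseq n < 1.
Proof.
move=> /andP[r0 r1]; have /andP[s0 s1] := @rseq_itv R n.
by apply/andP; split; [exact: mulr_ge0|rewrite (le_lt_trans _ r1)// ler_piMr// ltW].
Qed.

Lemma radial_cvg F r t : (forall z, N z < 1 -> ccont F z) -> 0 <= r < 1 ->
  N (F ((r * rseq n)%:C * cis t)) @[n --> \oo] --> N (F (r%:C * cis t)).
Proof.
move=> cF r1; apply: NcvgP => e e0.
have [del del0 H] := cF _ (Nr t r1) e e0.
have := (cvgR_P _ _).1 (@rseq_cvg R) _ del0.
apply: filterS => n; rewrite (_ : 1 - _ = n.+2%:R^-1); last by rewrite /rseq; ring.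
move=> nd; have := H (((r * rseq n) - r)%:C * cis t).
rewrite -mulrDl -rmorphD (_ : r + _ = r * rseq n); last by ring.
apply.
rewrite NM Ncis mulr1 NR /rseq (_ : _ - r = - (r * n.+2%:R^-1)); last by ring.
case/andP: r1 => r0 r1.
by rewrite normrN normrM ger0_norm// (le_lt_trans _ nd)// ler_piMl// ltW.
Qed.

(** Uniformity in the radius is what puts the Cauchy integral of an [L^p] function in the Hardy
    space. *)
Definition riesz_bound p := exists2 K : R, 0 <= K &
  forall r, 0 <= r < 1 ->
    bounded_at m (fun w t => N (cauchy w (r%:C * cis t))) p p K.

Lemma cauchy_sublin s0 r : 1 <= s0 -> 0 <= r < 1 ->
  sublin m s0 (fun w t => N (cauchy w (r%:C * cis t))).
Proof.
move=> s1 r1; split.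
- move=> w /(Lp_cL1 s1) w1; apply: cmeas_N; apply: cctn_meas; exact: cauchy_cctn.
- by move=> w t; exact: N_ge0.
- move=> u w /(Lp_cL1 s1) u1 /(Lp_cL1 s1) w1; apply: aeW => t.
  by rewrite cauchyD ?Nr//; exact: ND.
- move=> c w /(Lp_cL1 s1) w1; apply: aeW => t.
  by rewrite cauchyZ ?Nr// NM NR.
Qed.

Lemma riesz_scale p K r w (L : R) : 1 <= p -> 0 <= r < 1 ->
  bounded_at m (fun w t => N (cauchy w (r%:C * cis t))) p p K ->
  0 < L -> cmeas w -> (pint p w <= L%:E)%E ->
  (pint p (fun t => cauchy w (r%:C * cis t))%R <= (K * L)%:E)%E.
Proof.
move=> p1 r1 HK L0 mw wL; have p0 : 0 < p by rewrite (lt_le_trans _ p1).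
have [Sm S0 _ SZ] := cauchy_sublin p1 r1.
have Lw : Lp p w by split; [exact: mw|rewrite (le_lt_trans wL)// ltry].
have := @S_scale _ _ _ m _ _ Sm S0 SZ (ltW p0) 1 p L K w p0 ltr01 L0 Lw mw.
rewrite mul1r powRr1 ?(ltW L0)// [K * L]mulrC; apply => // u _ mu u1.
exact: HK.
Qed.

Lemma pint_sq u (M : R) : cmeas u -> (forall t, N (u t) <= M) ->
  pint 2 u = (Re (cint (fun t => u t * cj (u t))))%:E.
Proof.
move=> mu uM; rewrite /cint /= /Rintegral.
have E t : Re (u t * cj (u t)) = N (u t) `^ 2 by rewrite mul_conj powR_mulrn ?N_ge0.
have -> : (\int[m]_t (Re (u t * cj (u t)))%:E = pint 2 u)%E.
  by apply: eq_integral => t _; rewrite E.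
rewrite fineK//; rewrite ge0_fin_numE; last exact: pint_ge0.
by have [] := @Lp_bnd _ 2 u M (ler0n _ 2) mu uM.
Qed.

(** Both Cauchy integrals contain the constant term; taking it out of the second makes that half
    vanish at the centre. *)
Lemma pois_split w z : cL1 w -> N z < 1 ->
  pois w z = cauchy w z + cj (cauchy (fun t => cj (w t)) z - cint (fun t => cj (w t))).
Proof. by move=> w1 z1; rewrite poisE// conjB cint_conj// conjKc addrA. Qed.

Lemma cdiff_cauchyB w c z : cL1 w -> N z < 1 -> cdiff (fun z => cauchy w z - c) z.
Proof.
by move=> w1 z1; apply: cdiffB; [exact: cauchy_cdiff|exact: cdiff_cst].
Qed.

(** The two halves of the Poisson integral are orthogonal. *)
Lemma riesz2 : riesz_bound 2.
Proof.
exists 1 => // r r1 w mw w1.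
have Lw : Lp 2 w by split; [exact: mw|rewrite (le_lt_trans w1)// ltry].
have c1 : cL1 w by apply: (@Lp_cL1 _ 2) => //; rewrite ler1n.
have c1' := cL1_conj c1.
pose c := cint (fun t => cj (w t)).
pose F := cauchy w; pose G z := cauchy (fun t => cj (w t)) z - c.
have dF z : N z < 1 -> cdiff F z by exact: cauchy_cdiff.
have dG z : N z < 1 -> cdiff G z by exact: cdiff_cauchyB.
pose f t := F (r%:C * cis t); pose g t := G (r%:C * cis t).
have [Mf Mf0 fM] := holo_bnd dF r1; have [Mg Mg0 gM] := holo_bnd dG r1.
have mf : cmeas f by exact: cctn_meas (holo_cctn dF r1).
have mg : cmeas g by exact: cctn_meas (holo_cctn dG r1).
have lf : cL1 f by exact: holo_cL1.
have lg : cL1 g by exact: holo_cL1.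
have lfg : cL1 (fun t => f t * g t) by exact: cL1M_bnd mf fM lg.
have lff : cL1 (fun t => f t * cj (f t)) by exact: cL1M_bnd mf fM (cL1_conj lf).
have lgg : cL1 (fun t => g t * cj (g t)) by exact: cL1M_bnd mg gM (cL1_conj lg).
have fg0 : cint (fun t => f t * g t) = 0.
  rewrite (@mean_value_holo _ (fun z => F z * G z)) //.
    by rewrite /G cauchy0// subrr mulr0.
  by move=> z z1; apply: cdiffM; [exact: dF|exact: dG].
have PE : (fun t => pois w (r%:C * cis t)) = (fun t => f t + cj (g t)).
  by apply/funext => t; rewrite pois_split// Nr.
have := @pois_contract _ 2 w r _ c1 r1; rewrite ler1n PE => /(_ isT) H.
apply: le_trans w1; apply: le_trans H.
change (pint 2 f <= pint 2 (fun t => f t + cj (g t))%R)%E.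
rewrite (pint_sq mf fM) (@pint_sq _ (Mf + Mg)); last 2 first.
- by apply: cmeasD => //; exact: cmeas_conj.
- move=> t; apply: (le_trans (ND _ _)); rewrite [N (cj _)]Nconj.
  exact: lerD (fM t) (gM t).
have sq (a b : C) : (a + cj b) * cj (a + cj b) =
    (a * cj a + b * cj b) + (a * b + cj (a * b)).
  by rewrite conjD conjKc conjM; ring.
rewrite lee_fin (@cint_ext _ (fun t => (f t + cj (g t)) * cj (f t + cj (g t)))
  (fun t => (f t * cj (f t) + g t * cj (g t)) +
    (f t * g t + cj (f t * g t)))); last by move=> t; exact: (sq (f t) (g t)).
rewrite cintD; [|exact: cL1D|by apply: cL1D => //; exact: cL1_conj].
rewrite [X in _ + X]cintD//; last exact: cL1_conj.
rewrite cint_conj// fg0 conj0 !addr0 cintD// ReD lerDl.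
apply: Rintegral_ge0 => t _; rewrite mul_conj; exact: sqr_ge0.
Qed.

Lemma young2 (a b e : R) : 0 < e -> a * b <= e^-1 * a ^+ 2 + e * b ^+ 2.
Proof.
move=> e0; have ei : 0 < e^-1 by rewrite invr_gt0.
have E : e * e^-1 = 1 by rewrite mulfV// gt_eqF.
rewrite -(ler_pM2l e0) mulrDr !mulrA E mul1r.
have := sqr_ge0 (a - e * b); have := sqr_ge0 a; have := sqr_ge0 (e * b).
by move=> h1 h2 h3; nra.
Qed.

(** [(f + g) (f - g) = f ^ 2 - g ^ 2], and the Cauchy transform maps the holomorphic
    [f ^ 2] to itself and kills the antiholomorphic [g ^ 2]. *)
Lemma riesz_double p : 1 <= p -> riesz_bound p -> riesz_bound (2 * p).
Proof.
move=> p1 [K K0 HK]; have p0 : 0 < p by rewrite (lt_le_trans _ p1).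
have pp0 : 0 < 2 * p by rewrite mulr_gt0.
have pp1 : 1 <= 2 * p by lra.
pose D : R := 2 `^ (2 * p); have D0 : 0 < D by rewrite powR_gt0.
(* Chosen so that [K e D^2 <= 1/2]: the multiple of [A] that Young's inequality produces is then
   absorbed on the left. This is legitimate since [A] is finite, [F] being bounded on the circle of
   radius [rho < 1]. *)
pose e := (2 * (K + 1) * D * D)^-1.
have e0 : 0 < e by rewrite invr_gt0 !mulr_gt0// ltr_wpDl.
exists (2 * K * (e^-1 + e * D)).
  apply: mulr_ge0; first exact: mulr_ge0.
  by apply: addr_ge0; [rewrite invr_ge0 ltW|rewrite mulr_ge0// ltW].
move=> rho rho1 w mw w1.
have Lw : Lp (2 * p) w by split; [exact: mw|rewrite (le_lt_trans w1)// ltry].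
have c1 : cL1 w by exact: (Lp_cL1 pp1 Lw).
have c1' := cL1_conj c1.
pose c := cint (fun t => cj (w t)).
pose F := cauchy w; pose G z := cauchy (fun t => cj (w t)) z - c.
have dF z : N z < 1 -> cdiff F z by exact: cauchy_cdiff.
have dG z : N z < 1 -> cdiff G z by exact: cdiff_cauchyB.
pose f t := F (rho%:C * cis t); pose g t := cj (G (rho%:C * cis t)).
pose P t := pois w (rho%:C * cis t).
have PE t : P t = f t + g t by rewrite /P pois_split// Nr.
have [Mf Mf0 fM] := holo_bnd dF rho1; have [Mg Mg0 gM] := holo_bnd dG rho1.
have mf : cmeas f by exact: cctn_meas (holo_cctn dF rho1).
have mP : cmeas P by exact: pois_cmeas.
have P2 : (pint (2 * p) P <= 1)%E.
  by apply: le_trans w1; exact: pois_contract.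
have Lf : Lp (2 * p) f by exact: Lp_bnd (ltW pp0) mf fM.
pose A := fine (pint (2 * p) f).
have AE : pint (2 * p) f = A%:E.
  by rewrite fineK// ge0_fin_numE ?pint_ge0//; case: Lf.
have A0 : 0 <= A by rewrite -lee_fin -AE pint_ge0.
pose v t := P t * (f t - g t).
have vE t : v t = f t * f t + (-1) * (g t * g t) by rewrite /v PE; ring.
have dFF z : N z < 1 -> cdiff (fun z => F z * F z) z.
  by move=> z1; apply: cdiffM; exact: dF.
have dGG z : N z < 1 -> cdiff (fun z => G z * G z) z.
  by move=> z1; apply: cdiffM; exact: dG.
have cv z : N z < 1 -> cauchy v z = F (rho%:C * z) * F (rho%:C * z).
  move=> z1; rewrite (_ : v = fun t => f t * f t + (-1) * (g t * g t)); last exact/funext.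
  have gg : cL1 (fun t => g t * g t).
    have := cL1_conj (holo_cL1 dGG rho1); congr cL1; apply/funext => t.
    by rewrite conjM.
  rewrite cauchyD//; [|exact: (holo_cL1 dFF rho1)|exact: cL1Z].
  rewrite cauchyZ// (_ : (fun t => g t * g t) =
      (fun t => cj (G (rho%:C * cis t) * G (rho%:C * cis t)))); last first.
    by apply/funext => t; rewrite conjM.
  rewrite (cauchy_conj_holo dGG)// (cauchy_holo dFF)//.
  by rewrite /G cauchy0// subrr mulr0 conj0 mulr0 addr0.
have mfg : cmeas (fun t => 2%:C * f t + (-1) * P t).
  by apply: cmeasD; apply: cmeasM => //; exact: cmeas_cst.
have fgE t : f t - g t = 2%:C * f t + (-1) * P t.
  by rewrite PE (_ : 2%:C = 1 + 1 :> C) ?rmorphD//; ring.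
have mv : cmeas v.
  rewrite (_ : v = fun t => P t * (2%:C * f t + (-1) * P t)); first exact: cmeasM.
  by apply/funext => t; rewrite /v fgE.
have fgp : (pint (2 * p) (fun t => 2%:C * f t + (-1) * P t)%R <= (D * (D * A + 1))%:E)%E.
  apply: (le_trans (pintD _ _ _)); first exact: ltW.
  - by apply: cmeasM => //; exact: cmeas_cst.
  - by apply: cmeasM => //; exact: cmeas_cst.
  rewrite EFinM lee_pmul2l ?lte_fin//.
  rewrite !pintZ ?(ltW pp0)// NR ger0_norm// NN N1 one_powR mul1e AE.
  by rewrite EFinD leeD// -EFinM.
pose L := e^-1 + e * (D * (D * A + 1)).
have L0 : 0 < L.
  apply: ltr_pwDl; first by rewrite invr_gt0.
  apply: mulr_ge0; first exact: ltW.
  apply: mulr_ge0; first exact: ltW.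
  by apply: addr_ge0 => //; apply: mulr_ge0 => //; exact: ltW.
have vL : (pint p v <= L%:E)%E.
  apply: (@le_trans _ _ (eint m (fun t => e^-1 * N (P t) `^ (2 * p) +
      e * N (2%:C * f t + (-1) * P t) `^ (2 * p))%R)).
    apply: eint_le.
    - exact: cmeas_Npow.
    - by apply: measurable_funD; apply: measurable_funM => //; exact: cmeas_Npow.
    - by move=> t; exact: powR_ge0.
    - move=> t; rewrite /v fgE NM powRM ?N_ge0// !powRM2 ?N_ge0//; exact: young2.
  have ei : 0 <= e^-1 by rewrite invr_ge0 ltW.
  rewrite eintD; last 4 first.
  - by apply: measurable_funM => //; exact: cmeas_Npow.
  - by apply: measurable_funM => //; exact: cmeas_Npow.
  - by move=> t; rewrite mulr_ge0 ?powR_ge0.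
  - by move=> t; rewrite mulr_ge0 ?powR_ge0// ltW.
  rewrite !eintZ ?(ltW e0)//; try exact: cmeas_Npow; try (by move=> t; exact: powR_ge0).
  rewrite EFinD leeD//.
    by rewrite -[X in (_ <= X)%E]mule1 lee_wpmul2l ?lee_fin.
  by rewrite EFinM lee_wpmul2l ?lee_fin// ltW.
(* The Cauchy transform of [v] is controlled at radii below 1 only; Fatou's lemma then carries the
   bound to [f] itself. *)
have step n : (pint (2 * p) (fun t => F ((rho * rseq n)%:C * cis t))%R <= (K * L)%:E)%E.
  have rn := @rseq_itv R n.
  have E t : N (F ((rho * rseq n)%:C * cis t)) `^ (2 * p) =
      N (cauchy v ((rseq n)%:C * cis t)) `^ p.
    rewrite cv; last exact: Nr.
    rewrite mulrA -rmorphM; move: (F _) => a.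
    by rewrite NM powRM ?N_ge0// powRM2 ?N_ge0.
  have -> : pint (2 * p) (fun t => F ((rho * rseq n)%:C * cis t)) =
      pint p (fun t => cauchy v ((rseq n)%:C * cis t)).
    by apply: eq_integral => t _; rewrite E.
  exact: riesz_scale p1 rn (HK _ rn) L0 mv vL.
have AKL : A <= K * L.
  rewrite -lee_fin -AE.
  apply: (@eint_fatou _ _ _ m (fun n t => N (F ((rho * rseq n)%:C * cis t)) `^ (2 * p))).
  - move=> n; apply: cmeas_Npow; apply: cctn_meas; apply: holo_cctn => //.
    exact: rseq_mul_itv.
  - by move=> n t; exact: powR_ge0.
  - exact: cmeas_Npow.
  - by move=> t; exact: powR_ge0.
  - apply: aeW => t; apply: powR_cvg => //; first by move=> n; exact: N_ge0.
    by apply: radial_cvg => // z z1; apply: cdiff_cont; exact: dF.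
  - exact: step.
rewrite -/(pint (2 * p) f) AE lee_fin.
have eE : K * (e * D * D) <= 2^-1.
  rewrite (_ : e * D * D = (2 * (K + 1))^-1); last first.
    by rewrite /e; field; rewrite !gt_eqF// ltr_wpDl.
  by rewrite ler_pdivrMr ?mulr_gt0 ?ltr_wpDl//; lra.
have := ler_wpM2r A0 eE; move: AKL; rewrite /L => h1 h2.
have E1 : K * (e^-1 + e * (D * (D * A + 1))) = K * (e^-1 + e * D) + K * (e * D * D) * A by ring.
by rewrite E1 in h1; lra.
Qed.

Lemma riesz_pow2 n : riesz_bound (2 ^+ n.+1).
Proof.
elim: n => [|n ih]; first by rewrite expr1; exact: riesz2.
rewrite exprS; apply: riesz_double => //.
by rewrite exprn_ege1// ler1n.
Qed.

Lemma riesz_ge2 p : 2 <= p -> riesz_bound p.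
Proof.
move=> p2; have p0 : 0 < p by rewrite (lt_le_trans _ p2).
have [n np pn] : exists2 n, 2 ^+ n.+1 <= p & p < 2 ^+ n.+2.
  have H : exists n, p < 2 ^+ n.+2.
    exists (Num.bound p); rewrite (lt_trans (archi_boundP (ltW p0)))// -natrX ltr_nat.
    apply: (leq_trans (ltn_expl _ (isT : (1 < 2)%N))).
    by rewrite leq_pexp2l// ltnW.
  case: (ex_minnP H) => -[|n] pn minn.
    by exists 0%N; rewrite ?expr1.
  exists n.+1 => //; rewrite leNgt; apply/negP => /minn; by rewrite ltnn.
move: np; rewrite le_eqVlt => /predU1P[<-|np]; first exact: riesz_pow2.
have [K0 K00 H0] := riesz_pow2 n; have [K1 K10 H1] := riesz_pow2 n.+1.
have q0 : (0 : R) < 2 ^+ n.+1 by rewrite exprn_gt0.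
have q1 : (1 : R) <= 2 ^+ n.+1 by rewrite exprn_ege1// ler1n.
have q1' : (1 : R) <= 1 * 2 ^+ n.+1 by rewrite mul1r.
have [K K00' HK] := interpolation q0 np pn ltr01 q1' K00 K10.
exists K; first exact: K00'.
move=> r r1; rewrite -{2}(mul1r p); apply: HK.
- exact: cauchy_sublin.
- by rewrite mul1r; exact: H0.
- by rewrite mul1r; exact: H1.
Qed.

(** The kernel is Hermitian in its two angles, so at a fixed radius the Cauchy transform is its own
    adjoint. *)
Lemma ck_sym (r s t : R) : ck (r%:C * cis s) t = cj (ck (r%:C * cis t) s) :> C.
Proof. by rewrite /ck conjV conjB conj1 !conjM conjR conjKc mulrAC. Qed.

Lemma cintR (f : T -> R) : cint (fun t => (f t)%:C) = (\int[m]_t f t)%:C.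
Proof.
apply: complex_eq => //; rewrite [LHS]/= /Rintegral integral0_eq//.
Qed.

(** Duality with [q >= 2]: [F] is tested against [g = |F|^{p-2} conj F], for which [F g] and [|g|^q]
    both equal [|F|^p], and the transform is moved from [w] to [conj g]. Young's inequality brings
    back at most half of the finite integral [A], which is absorbed. *)
Lemma riesz_dual p : 1 < p -> p < 2 -> riesz_bound p.
Proof.
move=> p1 p2; have p0 : 0 < p by rewrite (lt_trans _ p1).
pose q := p / (p - 1); have pm : 0 < p - 1 by rewrite subr_gt0.
have q2 : 2 <= q by rewrite /q ler_pdivlMr//; lra.
have q0 : 0 < q by rewrite (lt_le_trans _ q2).
have q1 : 1 <= q by rewrite (le_trans _ q2)// ler1n.
have pq : p^-1 + q^-1 = 1 by rewrite /q; field; rewrite !gt_eqF.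
have [K K0 HK] := riesz_ge2 q2.
pose e := (2 * (K + 1))^-1; have K1 : 0 < K + 1 by rewrite ltr_wpDl.
have e0 : 0 < e by rewrite invr_gt0 mulr_gt0.
have [Y Y0 HY] := young_eps p0 q0 pq e0.
exists (2 * (Y + 2^-1)); first by rewrite mulr_ge0// addr_ge0// ltW.
move=> r r1 w mw w1.
have Lw : Lp p w by split; [exact: mw|rewrite (le_lt_trans w1)// ltry].
have c1 : cL1 w by exact: (Lp_cL1 (ltW p1) Lw).
pose F t := cauchy w (r%:C * cis t).
have dF z : N z < 1 -> cdiff (cauchy w) z by exact: cauchy_cdiff.
have [M M0 FM] := holo_bnd dF r1.
have mF : cmeas F by exact: cctn_meas (holo_cctn dF r1).
pose g t := (N (F t) `^ (p - 2))%:C * cj (F t).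
have mg : cmeas g by apply: cmeasM; [apply: cmeasR; exact: cmeas_Npow|exact: cmeas_conj].
have Ng t : N (g t) = N (F t) `^ (p - 1).
  rewrite /g NM NR Nconj ger0_norm ?powR_ge0//.
  have [->|Fn] := eqVneq (N (F t)) 0; first by rewrite mulr0 powR0// gt_eqF.
  rewrite -[X in _ * X]powRr1 ?N_ge0// -powRD ?Fn ?implybT//; congr (_ `^ _); ring.
have Fg t : F t * g t = (N (F t) `^ p)%:C.
  rewrite /g mulrCA mul_conj -rmorphM; congr (_%:C).
  have [->|Fn] := eqVneq (N (F t)) 0.
    by rewrite expr0n mulr0 powR0// gt_eqF.
  rewrite -powR_mulrn ?N_ge0// -powRD ?Fn ?implybT//; congr (_ `^ _); ring.
have gM t : N (g t) <= M `^ (p - 1).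
  by rewrite Ng; apply: le_powR; [exact: ltW|exact: N_ge0|exact: FM].
have Lf : Lp p F by exact: Lp_bnd (ltW p0) mF FM.
pose A := fine (pint p F).
have AE : pint p F = A%:E.
  by rewrite fineK// ge0_fin_numE ?pint_ge0//; case: Lf.
have A0 : 0 <= A by rewrite -lee_fin -AE pint_ge0.
have pg : pint q (fun t => cj (g t)) = A%:E.
  rewrite -AE; apply: eq_integral => t _; congr (_%:E).
  by rewrite Nconj Ng -powRrM /q mulrCA mulfV ?mulr1// gt_eqF.
pose H t := cauchy (fun t => cj (g t)) (r%:C * cis t).
have cg : cL1 (fun t => cj (g t)).
  by apply: (@cL1_bnd _ _ (M `^ (p - 1))) => [|t]; [exact: cmeas_conj|rewrite Nconj].
have mH : cmeas H by exact: cctn_meas (cauchy_cctn cg r1).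
(* [A + 1] replaces [A] because scaling asks for a positive bound. *)
have HA : (pint q H <= (K * (A + 1))%:E)%E.
  apply: riesz_scale => //.
  - exact: HK.
  - by rewrite ltr_wpDl.
  - exact: cmeas_conj.
  - by rewrite pg lee_fin lerDl.
have dual : cint (fun t => F t * g t) = cint (fun t => w t * cj (H t)).
  pose k (x : T * T) := g x.1 * (ck (r%:C * cis x.1) x.2 * w x.2).
  have kE s t : k (s, t) = g s * (ck (r%:C * cis s) t * w t) by [].
  have kb x : N (k x) <= M `^ (p - 1) * (1 - r)^-1 * N (w x.2).
    rewrite /k NM [N (_ * w _)]NM mulrA; apply: ler_wpM2r; first exact: N_ge0.
    apply: ler_pM; [exact: N_ge0|exact: N_ge0|exact: gM|].
    apply: (le_trans (N_ck _ (Nr _ r1))).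
    by case/andP: (r1) => r0 _; rewrite N_circle.
  have mk : cmeas k.
    apply: cmeasM; first exact: (cmeas_comp (@measurable_fst _ _ T T) mg).
    by apply: cmeasM; [exact: cmeas_ck|exact: (cmeas_comp (@measurable_snd _ _ T T) mw)].
  have := cfubini mk c1 kb; congr (_ = _).
    apply: cint_ext => s; rewrite mulrC /F /cauchy /k /= cintZ//.
    by apply: cL1_ckM => //; exact: Nr.
  apply: cint_ext => t; rewrite /H /cauchy -cint_conj; last first.
    by apply: cL1_ckM => //; exact: Nr.
  rewrite -cintZ; last by apply: cL1_conj; apply: cL1_ckM => //; exact: Nr.
  by apply: cint_ext => s; rewrite kE conjM conjKc ck_sym; ring.
clearbody A.
have Hb t : N (H t) <= (1 - r)^-1 * I1 (fun t => cj (g t)).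
  have := N_cauchy cg (Nr t r1); by case/andP: (r1) => r0 _; rewrite N_circle.
have lwH : cL1 (fun t => cj (H t) * w t).
  by apply: cL1M_bnd c1 => [|t]; [exact: cmeas_conj|rewrite Nconj; exact: Hb].
have AN : (A%:E = (N (cint (fun t => F t * g t)))%:E)%E.
  rewrite (@cint_ext _ _ (fun t => (N (F t) `^ p)%:C))//.
  rewrite cintR (_ : (\int[m]_t _)%R = A) ?NR ?ger0_norm//.
  by rewrite /Rintegral; move: AE; rewrite /pint /eint => ->.
have AY : (A%:E <= (Y + e * (K * (A + 1)))%:E)%E.
  rewrite AN dual (@cint_ext _ _ (fun t => cj (H t) * w t)); last by move=> t; rewrite mulrC.
  apply: (le_trans (le_cint_eint lwH)).
  apply: (@le_trans _ _ (eint m (fun t => Y * N (w t) `^ p + e * N (H t) `^ q)%R)).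
    apply: eint_le.
    - by apply: cmeas_N; apply: cmeasM => //; exact: cmeas_conj.
    - by apply: measurable_funD; apply: measurable_funM => //; exact: cmeas_Npow.
    - by move=> t; exact: N_ge0.
    - by move=> t; rewrite NM Nconj mulrC; apply: HY; exact: N_ge0.
  rewrite eintD; last 4 first.
  - by apply: measurable_funM => //; exact: cmeas_Npow.
  - by apply: measurable_funM => //; exact: cmeas_Npow.
  - by move=> t; rewrite mulr_ge0 ?powR_ge0// ltW.
  - by move=> t; rewrite mulr_ge0 ?powR_ge0// ltW.
  rewrite !eintZ ?(ltW e0) ?(ltW Y0)//; try exact: cmeas_Npow;
    try (by move=> t; exact: powR_ge0).
  rewrite (EFinD Y); apply: leeD.
    rewrite -[X in (_ <= X)%E]mule1; apply: lee_wpmul2l; last exact: w1.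
    by rewrite lee_fin ltW.
  rewrite (EFinM e); apply: lee_wpmul2l; last exact: HA.
  by rewrite lee_fin ltW.
rewrite -/(pint p F) AE lee_fin; rewrite lee_fin in AY.
have eK : e * K <= 2^-1.
  by rewrite /e mulrC ler_pdivrMr ?mulr_gt0//; lra.
by have := ler_wpM2r A0 eK; lra.
Qed.

Theorem riesz p : 1 < p -> riesz_bound p.
Proof. by move=> p1; have [p2|p2] := leP 2 p; [exact: riesz_ge2|exact: riesz_dual]. Qed.

End riesz.

(** * Boundary values in Hardy spaces *)

Section phi.
Context {R : realType}.
Notation C := R[i].
Notation T := (measurableTypeR R).
Local Notation m := (circle_measure R).
Implicit Types (a b z : C) (w u : T -> C) (p : R).

(** A strictly convex function of linear growth: integral means are controlled on
    [H ^ 1], and [phi_gap] quantifies the strict convexity. *)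
Definition phi a : R := Num.sqrt (1 + N a ^+ 2).

Lemma phi_sq a : phi a ^+ 2 = 1 + N a ^+ 2.
Proof. by rewrite sqr_sqrtr// addr_ge0// sqr_ge0. Qed.

Lemma phi_gt0 a : 0 < phi a.
Proof. by rewrite sqrtr_gt0 ltr_pwDl// sqr_ge0. Qed.

Lemma phi_ge0 a : 0 <= phi a. Proof. exact: ltW (phi_gt0 a). Qed.

Lemma N_le_phi a : N a <= phi a.
Proof.
rewrite -(@ler_pXn2r _ 2)// ?nnegrE ?N_ge0 ?phi_ge0// phi_sq.
by rewrite lerDr.
Qed.

Lemma phi_le a : phi a <= 1 + N a.
Proof.
have Na := N_ge0 a.
rewrite -(@ler_pXn2r _ 2)// ?nnegrE ?phi_ge0 ?addr_ge0// phi_sq.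
by rewrite sqrrD; nra.
Qed.

Lemma parallelogram a b : N (a + b) ^+ 2 + N (a - b) ^+ 2 = 2 * N a ^+ 2 + 2 * N b ^+ 2.
Proof. by rewrite !Nsq !(ReD, ImD, ReN, ImN); ring. Qed.

(** [phi a] is the length of the vector [(1, a)]. The parallelogram law gives
    [S^2 - 4 M^2 = x^2 - (P - Q)^2] for [S = P + Q], and [S^2 - (A + B)^2 >= 2] shows that [P - Q]
    uses up only part of [x]. The cube arises from [S^2 - 4 M^2 <= 2 S (S - 2 M)]. *)
Lemma phi_gap a b :
  N (a - b) ^+ 2 <=
    (phi a + phi b) ^+ 3 * (phi a + phi b - 2 * phi (2^-1%:C * (a + b))).
Proof.
set M := phi (_ * _); have M2 : 4 * M ^+ 2 = 4 + N (a + b) ^+ 2.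
  by rewrite phi_sq NM NR ger0_norm ?invr_ge0// exprMn; field.
have := parallelogram a b; have M0 : 0 < M by exact: phi_gt0.
have := N_leB a b; have := N_leB b a; rewrite [N (b - a)]NBC.
have := phi_sq a; have := phi_sq b; have := phi_gt0 a; have := phi_gt0 b.
have := N_ge0 a; have := N_ge0 b; have := N_ge0 (a - b).
move: (N a) (N b) (N (a - b)) (N (a + b)) M2 => A B x y M2.
move: (phi a) (phi b) => P Q x0 B0 A0 Q0 P0 Q2 P2 h1 h2 par.
have {}M2 : 4 * M ^+ 2 = 4 + 2 * A ^+ 2 + 2 * B ^+ 2 - x ^+ 2 by lra.
set S := P + Q; have S0 : 0 < S by rewrite addr_gt0.
have ABx : (A - B) ^+ 2 <= x ^+ 2.
  have : `|A - B| <= x by rewrite ler_norml; lra.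
  by rewrite -(@ler_pXn2r _ 2)// ?nnegrE// real_normK// num_real.
have PQ : A * B <= P * Q.
  rewrite ler_pM//; rewrite -(@ler_pXn2r _ 2)// ?nnegrE ?(ltW P0) ?(ltW Q0)//; lra.
have k1 : S ^+ 2 - (A + B) ^+ 2 >= 2 by rewrite /S !sqrrD; lra.
have k2 : S ^+ 2 * (P - Q) ^+ 2 = (A - B) ^+ 2 * (A + B) ^+ 2.
  rewrite -!exprMn /S (_ : (P + Q) * (P - Q) = P ^+ 2 - Q ^+ 2); last by ring.
  by rewrite P2 Q2; ring.
have k3 : S ^+ 2 - 4 * M ^+ 2 = x ^+ 2 - (P - Q) ^+ 2.
  by rewrite /S; lra.
have k4 : 2 * x ^+ 2 <= S ^+ 2 * (S ^+ 2 - 4 * M ^+ 2).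
  rewrite k3 mulrBr k2.
  have h3 : (A - B) ^+ 2 * (A + B) ^+ 2 <= x ^+ 2 * (A + B) ^+ 2.
    by rewrite ler_wpM2r ?sqr_ge0.
  have h4 : x ^+ 2 * 2 <= x ^+ 2 * (S ^+ 2 - (A + B) ^+ 2).
    by rewrite ler_wpM2l ?sqr_ge0.
  by rewrite mulrBr in h4; lra.
have k5 : 2 * M <= S.
  rewrite -(@ler_pXn2r _ 2)// ?nnegrE ?(ltW S0) ?mulr_ge0 ?(ltW M0)//.
  have : 0 <= S ^+ 2 * (S ^+ 2 - 4 * M ^+ 2).
    by apply: le_trans k4; rewrite mulr_ge0// sqr_ge0.
  by rewrite pmulr_rge0 ?exprn_gt0// exprMn; lra.
have k6 : S ^+ 2 * (S ^+ 2 - 4 * M ^+ 2) <= S ^+ 2 * ((S - 2 * M) * (2 * S)).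
  rewrite ler_wpM2l ?sqr_ge0// (_ : _ - _ = (S - 2 * M) * (S + 2 * M)); last by ring.
  by rewrite ler_wpM2l ?subr_ge0//; lra.
have E : S ^+ 2 * ((S - 2 * M) * (2 * S)) = 2 * (S ^+ 3 * (S - 2 * M)) by ring.
by rewrite E in k6; lra.
Qed.

Lemma phi_lip a b : phi a - phi b <= N (a - b).
Proof.
have ab := N_leB a b; have := phi_sq a; have := phi_sq b.
have := N_le_phi a; have := N_le_phi b; have := phi_gt0 a; have := phi_gt0 b.
have := N_ge0 a; have := N_ge0 b; have := N_ge0 (a - b).
move: (N a) (N b) (N (a - b)) (phi a) (phi b) ab => A B x P Q ab x0 B0 A0 Q0 P0 BQ AP Q2 P2.
have S0 : 0 < P + Q by rewrite addr_gt0.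
rewrite -(ler_pM2r S0) (_ : (P - Q) * (P + Q) = (A - B) * (A + B)); last first.
  by rewrite (_ : (P - Q) * (P + Q) = P ^+ 2 - Q ^+ 2); [rewrite P2 Q2|]; ring.
apply: (@le_trans _ _ (x * (A + B))); first by rewrite ler_wpM2r// addr_ge0.
by rewrite ler_wpM2l// lerD.
Qed.

(** The Cauchy-Schwarz inequality for the vectors [(1, a)] and [(1, b)]. *)
Lemma phi_cs a b : 1 + Re (cj a * b) <= phi a * phi b.
Proof.
have h : Re (cj a * b) <= N a * N b.
  by rewrite (le_trans (ler_norm _))// (le_trans (normRe _))// NM Nconj.
have Na := N_ge0 a; have Nb := N_ge0 b.
apply: (@le_trans _ _ (1 + N a * N b)); first by rewrite lerD2l.
rewrite -(@ler_pXn2r _ 2)// ?nnegrE ?addr_ge0 ?mulr_ge0 ?phi_ge0//.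
rewrite exprMn !phi_sq.
by have := sqr_ge0 (N a - N b); rewrite !sqrrD exprMn; lra.
Qed.

Lemma meas_phi d (X : measurableType d) (u : X -> C) : cmeas u ->
  measurable_fun setT (fun t => phi (u t)).
Proof.
move=> mu; rewrite (_ : (fun t => _) = (fun t => (1 + N (u t) ^+ 2) `^ 2^-1)); last first.
  by apply/funext => t; rewrite powR12_sqrt// addr_ge0// sqr_ge0.
apply: (measurableT_comp (@measurable_powR R _)); apply: measurable_funD => //.
by apply: measurable_funX; exact: cmeas_N.
Qed.

Lemma phi_cL1 w : cL1 w -> cL1 (fun t => (phi (w t))%:C).
Proof.
move=> w1; have mw := cL1_meas w1.
apply: cL1P; first by apply: cmeasR; exact: meas_phi.
apply: (@le_lt_trans _ _ (eint m (fun t => 1 + N (w t))%R)).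
  apply: eint_le.
  - by apply: cmeas_N; apply: cmeasR; exact: meas_phi.
  - by apply: measurable_funD => //; exact: cmeas_N.
  - by move=> t; exact: N_ge0.
  - by move=> t; rewrite NR ger0_norm ?phi_ge0// phi_le.
rewrite eintD//; [|exact: cmeas_N|by move=> t; exact: N_ge0].
rewrite eint_m_cst// lte_add_pinfty ?ltry//.
have /integrableP[_] := cL1_N w1; congr (_ < _)%E.
by apply: eq_integral => t _ /=; rewrite ger0_norm ?N_ge0.
Qed.

(** Integrating [phi_cs] with [a = pois w z] against the kernel gives [phi a ^ 2] on the left; one
    factor [phi a] is then cancelled. *)
Lemma phi_jensen w z : cL1 w -> N z < 1 ->
  ((phi (pois w z))%:E <= eint m (fun t => pk z t * phi (w t))%R)%E.
Proof.
move=> w1 z1; set a := pois w z.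
have mw := cL1_meas w1; have k0 t := pk_ge0 t z1.
have mk : measurable_fun setT (fun t => pk z t * phi (w t)).
  by apply: measurable_funM; [exact: pk_meas|exact: meas_phi].
have g0 t : 0 <= pk z t * phi (w t) by rewrite mulr_ge0 ?phi_ge0.
have u1 : cL1 (fun t => (pk z t)%:C * (1 + cj a * w t)).
  apply: cL1_pk => //; apply: cL1D; first exact: cL1_cst.
  exact: cL1Z.
have uE : cint (fun t => (pk z t)%:C * (1 + cj a * w t)) = (phi a ^+ 2)%:C.
  rewrite (@cint_ext _ _ (fun t => (pk z t)%:C + cj a * ((pk z t)%:C * w t))); last first.
    by move=> t; ring.
  rewrite cintD; last by apply: cL1Z; exact: cL1_pk.
    rewrite pois1// cintZ; last exact: cL1_pk.
    by rewrite -/(pois w z) -/a [cj a * a]mulrC mul_conj phi_sq rmorphD.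
  apply: cL1_bnd; first by apply: cctn_meas; exact: pk_cctn.
  by move=> t; exact: pk_bnd.
have : ((phi a ^+ 2)%:E <= (phi a)%:E * eint m (fun t => pk z t * phi (w t))%R)%E.
  rewrite -eintZ ?phi_ge0//.
  have -> : phi a ^+ 2 = Re (cint (fun t => (pk z t)%:C * (1 + cj a * w t))) by rewrite uE.
  have [i1 _] := u1; clearbody a.
  have i2 := cL1_N (cL1Z (phi a)%:C (cL1_pk z1 (phi_cL1 w1))).
  rewrite [Re (cint _)]/= /Rintegral fineK; last exact: integrable_fin_num i1.
  apply: le_integral => //.
    apply: eq_integrable i2 => // t _.
    by rewrite /comp !NM !NR !ger0_norm ?phi_ge0.
  move=> t _; rewrite lee_fin ReM [Re _]/= [Im _]/= mul0r subr0 mulrCA.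
  by apply: ler_wpM2l => //; rewrite ReD; exact: phi_cs.
rewrite expr2 EFinM lee_pmul2l// lte_fin; exact: phi_gt0.
Qed.

Lemma phi_contract w r : cL1 w -> 0 <= r < 1 ->
  (eint m (fun t => phi (pois w (r%:C * cis t)))%R <= eint m (fun t => phi (w t)))%E.
Proof.
move=> w1 r1; apply: jensen_contract => //.
- exact: phi_ge0.
- by move=> u; exact: meas_phi.
- by move=> z z1; exact: phi_jensen.
Qed.

End phi.

Lemma measurable_limsup (R : realType) d (X : measurableType d) (a : nat -> X -> R) :
  (forall k, measurable_fun setT (a k)) ->
  measurable_fun setT (fun x => fine (limn_esup (fun k => (a k x)%:E))).
Proof.
move=> ma; apply: (measurableT_comp (fine_measurable measurableT)).
by apply: measurable_fun_limn_esup => k; exact/measurable_EFinP.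
Qed.

(** * Limits of Cauchy sequences in [L^1] *)

Section l1_limit.
Context {R : realType}.
Notation C := R[i].
Notation T := (measurableTypeR R).
Local Notation m := (circle_measure R).
Implicit Types (a b z : C) (w : T -> C) (u : nat -> T -> C) (p : R).

Definition l1_cauchy u := forall e : R, 0 < e -> exists n0, forall i j,
  (n0 <= i)%N -> (n0 <= j)%N -> (eint m (fun t => N (u i t - u j t))%R <= e%:E)%E.

Lemma telescope_cvg (a h : nat -> R) : (forall k, `|a k.+1 - a k| <= h k) ->
  cvgn (series h) -> cvgn a.
Proof.
move=> ah ch.
have c1 : cvgn [normed series (fun k => a k.+1 - a k)].
  by apply: series_le_cvg ch => k //=; exact: le_trans (ah k).
have /normed_cvg := c1.
rewrite (_ : series _ = (fun n => a n - a 0%N)); last first.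
  by apply/funext => n; rewrite /series /= telescope_sumr.
move=> /cvg_ex[l /= cl]; apply/cvg_ex; exists (l + a 0%N).
apply/cvgR_P => e e0; have := (cvgR_P _ _).1 cl e e0; apply: filterS => n.
by congr (`|_| < _); ring.
Qed.

Lemma ae_fin (h : T -> \bar R) : measurable_fun setT h -> (forall t, 0 <= h t)%E ->
  (\int[m]_t h t < +oo)%E -> \forall t \ae m, (h t < +oo)%E.
Proof.
move=> mh h0 hi.
have ih : m.-integrable setT h.
  apply/integrableP; split => //.
  by under eq_integral do rewrite gee0_abs//.
have := integrable_ae measurableT ih; apply: filterS => t /(_ I).
by rewrite ge0_fin_numE.
Qed.

(** A subsequence with summable increments converges almost everywhere. Its limit is taken as an
    upper limit, hence measurable and defined everywhere, and Fatou's lemma gives [L^1] convergence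
    of the full sequence. *)
Lemma l1_limit u : (forall n, cmeas (u n)) -> l1_cauchy u ->
  exists w, [/\ cmeas w,
    exists2 g : nat -> nat, (forall k, (k <= g k)%N) &
      \forall t \ae m, N (u (g k) t - w t) @[k --> \oo] --> (0 : R) &
    forall e : R, 0 < e -> exists n0, forall n, (n0 <= n)%N ->
      (eint m (fun t => N (u n t - w t))%R <= e%:E)%E].
Proof.
move=> mu cu.
have [n0 Hn0] : {n0 : nat -> nat | forall k i j, (n0 k <= i)%N -> (n0 k <= j)%N ->
    (eint m (fun t => N (u i t - u j t))%R <= (1 / (2 ^ (k + 1))%:R)%:E)%E}.
  have H k : {n | forall i j, (n <= i)%N -> (n <= j)%N ->
      (eint m (fun t => N (u i t - u j t))%R <= (1 / (2 ^ (k + 1))%:R)%:E)%E}.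
    by apply: cid; apply: cu; rewrite divr_gt0// ltr0n expn_gt0.
  by exists (fun k => sval (H k)) => k; exact: (svalP (H k)).
(* Adding up all thresholds makes [g] nondecreasing, at least [k], and at least [n0 k]. *)
pose g k := (k + \sum_(i < k.+1) n0 i)%N.
have gk k : (k <= g k)%N by exact: leq_addr.
have gn k : (n0 k <= g k)%N.
  by rewrite /g big_ord_recr /= addnA leq_addl.
have gS k : (g k <= g k.+1)%N.
  by rewrite /g leq_add// [leqRHS]big_ord_recr /= leq_addr.
pose h k t := N (u (g k.+1) t - u (g k) t).
have h0 k t : 0 <= h k t by exact: N_ge0.
have mh k : measurable_fun setT (h k) by apply: cmeas_N; exact: cmeasB.
have mh' k : measurable_fun setT (EFin \o h k) by exact/measurable_EFinP.
have hi k : (eint m (h k) <= (1 / (2 ^ (k + 1))%:R)%:E)%E.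
  by apply: Hn0; rewrite ?gn// (leq_trans (gn k)).
have sum_fin : (\int[m]_t (\sum_(k <oo) (h k t)%:E) < +oo)%E.
  rewrite integral_nneseries//; last by move=> k t _; rewrite lee_fin.
  apply: (@le_lt_trans _ _ (\sum_(k <oo) (1 / (2 ^ (k + 1))%:R)%:E)%E).
    apply: lee_nneseries => [k _ _|k _]; last exact: hi.
    by apply: eint_ge0 => t; exact: h0.
  by rewrite (cvg_lim _ (@cvg_geometric_eseries_half R 1 0))// ltry.
have : \forall t \ae m, (\sum_(k <oo) (h k t)%:E < +oo)%E.
  apply: ae_fin => //.
  - apply: (@ge0_emeasurable_sum _ _ _ setT (fun k t => (h k t)%:E) xpredT).
      by move=> k t _ _; rewrite lee_fin.
    by move=> k _; exact: mh'.
  - by move=> t; apply: nneseries_ge0 => k _ _; rewrite lee_fin.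
move=> aefin.
have aecvg : \forall t \ae m, cvgn (fun k => Re (u (g k) t)) /\
    cvgn (fun k => Im (u (g k) t)).
  apply: filterS aefin => t tfin.
  have ch : cvgn (series (fun k => h k t)).
    apply: nondecreasing_is_cvgn.
      by apply/nondecreasing_seqP => n; rewrite /series /= big_nat_recr//= lerDl.
    exists (fine (\sum_(k <oo) (h k t)%:E)%E) => _ [n _ <-].
    have f : (\sum_(k <oo) (h k t)%:E)%E \is a fin_num.
      by rewrite ge0_fin_numE//; apply: nneseries_ge0 => k _ _; rewrite lee_fin.
    rewrite -lee_fin fineK// /series /= -sumEFin.
    by apply: nneseries_lim_ge => k _ _; rewrite lee_fin.
  split; apply: telescope_cvg ch => k.
  - by rewrite -ReN -ReD; exact: normRe.
  - by rewrite -ImN -ImD; exact: normIm.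
pose wr t := fine (limn_esup (fun k => (Re (u (g k) t))%:E)).
pose wi t := fine (limn_esup (fun k => (Im (u (g k) t))%:E)).
pose w t : C := wr t +i* wi t.
have mw : cmeas w.
  split.
  - by apply: (measurable_limsup (a := fun k t => Re (u (g k) t))) => k; case: (mu (g k)).
  - by apply: (measurable_limsup (a := fun k t => Im (u (g k) t))) => k; case: (mu (g k)).
have aew : \forall t \ae m, N (u (g k) t - w t) @[k --> \oo] --> (0 : R).
  apply: filterS aecvg => t [cr ci].
  have key (a : nat -> R) : cvgn a -> `|a k - fine (limn_esup (EFin \o a))| @[k --> \oo] --> (0 : R).
    move=> ca; have H : (a k)%:E @[k --> \oo] --> (limn a)%:E.
      by apply: cvg_EFin => //; near=> k.
    rewrite (cvg_limn_einf_sup H).2 /=.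
    apply/cvgR_P => e e0; apply: filterS ((cvgR_P _ _).1 ca e e0) => k.
    by rewrite sub0r normrN normr_id distrC.
  apply/cvgR_P => e e0; have e2 : 0 < e / 2 by rewrite divr_gt0.
  have := (cvgR_P _ _).1 (key _ cr) _ e2; have := (cvgR_P _ _).1 (key _ ci) _ e2.
  apply: filterS2 => k; rewrite !sub0r !normrN !normr_id => h2 h1.
  rewrite ger0_norm ?N_ge0//; apply: (le_lt_trans (N_leReIm _)).
  rewrite ReD ReN ImD ImN [e]splitr; exact: ltrD h1 h2.
exists w; split => //; first by exists g.
move=> e e0; have [n1 Hn1] := cu e e0; exists n1 => n nn.
apply: (@eint_fatou _ _ _ m (fun k t => N (u n t - u (g (k + n1)%N) t))).
- by move=> k; apply: cmeas_N; exact: cmeasB.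
- by move=> k t; exact: N_ge0.
- by apply: cmeas_N; exact: cmeasB.
- by move=> t; exact: N_ge0.
- apply: filterS aew => t tw.
  have tw' : N (u (g (k + n1)%N) t - w t) @[k --> \oo] --> (0 : R).
    by have := tw; rewrite -(cvg_shiftn n1).
  apply: NcvgP => d d0.
  have := (cvgR_P _ _).1 tw' _ d0; apply: filterS => k.
  rewrite sub0r normrN ger0_norm ?N_ge0//; congr (_ < _).
  by rewrite NBC; congr N; ring.
- move=> k; apply: Hn1 => //; apply: (leq_trans _ (gk _)); exact: leq_addl.
Unshelve. all: by end_near. Qed.

End l1_limit.

(** * Representation of Hardy functions by their boundary functions *)

Section hardy_representation.
Context {R : realType}.
Notation C := R[i].
Notation T := (measurableTypeR R).
Local Notation m := (circle_measure R).
Implicit Types (a b z : C) (w u : T -> C) (p e : R).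

(** [x] stands for [|u - v|], [D] for the sum of the [phi] values and [g] for the midpoint gap.
    Where [D] is large, [D <= e D^p] because [p > 1]; elsewhere [x^2 <= L^3 g], and
    [x <= e + x^2 / (4 e)]. *)
Lemma gap_young p e : 1 < p -> 0 < e -> exists2 K : R, 0 <= K &
  forall x D g : R, 0 <= x -> 0 < D -> 0 <= g -> x <= D -> x ^+ 2 <= D ^+ 3 * g ->
    x <= K * g + e * (1 + D `^ p).
Proof.
move=> p1 e0; have pm : 0 < p - 1 by rewrite subr_gt0.
pose L := e `^ (- (p - 1)^-1); have L0 : 0 < L by rewrite powR_gt0.
exists (L ^+ 3 / (4 * e)); first by rewrite divr_ge0 ?exprn_ge0 ?mulr_ge0// ltW.
move=> x D g x0 D0 g0 xD xg.
have Kg : 0 <= L ^+ 3 / (4 * e) * g.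
  by rewrite mulr_ge0// divr_ge0 ?exprn_ge0 ?mulr_ge0// ltW.
have [LD|DL] := leP L D.
  suff : D <= e * D `^ p by have := ltW e0; lra.
  have E : e = L `^ (1 - p).
    rewrite /L -powRrM (_ : _ * (1 - p) = 1) ?powRr1 ?(ltW e0)//.
    by field; rewrite gt_eqF.
  have Dp : D `^ (p - 1) * D = D `^ p by rewrite mulrC mulr_powRB1 ?(ltW D0)// (lt_trans _ p1).
  rewrite -Dp mulrA ler_peMl ?(ltW D0)// E -opprB powRN mulrC ler_pdivlMr ?powR_gt0// mul1r.
  by apply: le_powR => //; exact: ltW.
have h1 : x ^+ 2 <= L ^+ 3 * g.
  by apply: (le_trans xg); rewrite ler_wpM2r// lerXn2r ?nnegrE ?(ltW L0) ?(ltW D0)// ltW.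
have h2 : x <= e + x ^+ 2 / (4 * e).
  rewrite -lerBlDl ler_pdivlMr ?mulr_gt0//.
  by have := sqr_ge0 (x - 2 * e); rewrite sqrrB exprMn; lra.
have h3 : x ^+ 2 / (4 * e) <= L ^+ 3 / (4 * e) * g.
  by rewrite [leRHS]mulrAC ler_wpM2r// invr_ge0 mulr_ge0// ltW.
by have := mulr_ge0 (ltW e0) (powR_ge0 D p); lra.
Qed.

Lemma phi_pow p a b : 1 <= p ->
  (phi a + phi b) `^ p <= 2 `^ p * 2 `^ p * (2 + N a `^ p + N b `^ p).
Proof.
move=> p1; have p0 : 0 <= p by rewrite (le_trans _ p1).
apply: (le_trans (powRD_le p0 (phi_ge0 a) (phi_ge0 b))).
rewrite -mulrA ler_wpM2l ?powR_ge0//.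
have key c : phi c `^ p <= 2 `^ p * (1 + N c `^ p).
  apply: (@le_trans _ _ ((1 + N c) `^ p)).
    by apply: le_powR => //; [exact: phi_ge0|exact: phi_le].
  by rewrite -[X in _ * (X + _)](one_powR p); apply: powRD_le => //; exact: N_ge0.
by have := key a; have := key b; rewrite !mulrDr; lra.
Qed.

Lemma powR_Ncvg p (a : nat -> C) b : 0 < p -> N (a k - b) @[k --> \oo] --> (0 : R) ->
  N (a k) `^ p @[k --> \oo] --> N b `^ p.
Proof.
move=> p0 ab; apply: powR_cvg => //; first by move=> n; exact: N_ge0.
apply: NcvgP => e e0; have := (cvgR_P _ _).1 ab _ e0; apply: filterS => n.
by rewrite sub0r normrN ger0_norm ?N_ge0.
Qed.

Lemma I1E w : cL1 w -> ((I1 w)%:E = eint m (fun t => N (w t)))%E.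
Proof. by move=> w1; rewrite /I1 /Rintegral fineK//; exact: integrable_fin_num (cL1_N w1). Qed.

Variables (f : C -> C) (p M : R).
Hypothesis p1 : 1 < p.
Hypothesis df : forall z, N z < 1 -> cdiff f z.
Hypothesis M0 : 0 <= M.
Hypothesis fM : forall r, 0 <= r < 1 -> (pint p (fun t => f (r%:C * cis t))%R <= M%:E)%E.

Let F r t : C := f (r%:C * cis t).
Let p0 : 0 < p. Proof. exact: lt_trans p1. Qed.

Let mF r : 0 <= r < 1 -> cmeas (F r : T -> C).
Proof. by move=> r1; exact: cctn_meas (holo_cctn df r1). Qed.

Let F1 r : 0 <= r < 1 -> cL1 (F r).
Proof. exact: holo_cL1. Qed.

Lemma eint_phiE w : cL1 w ->
  ((\int[m]_t phi (w t))%:E = eint m (fun t => phi (w t)))%E.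
Proof.
move=> w1; have i := cL1_N (phi_cL1 w1); rewrite /Rintegral fineK//.
have := integrable_fin_num measurableT i; congr (_ \is a fin_num).
by apply: eq_integral => t _; rewrite /comp NR ger0_norm ?phi_ge0.
Qed.

Lemma phi_mean_bound r : 0 <= r < 1 -> \int[m]_t phi (F r t) <= 2 + M.
Proof.
move=> r1; rewrite -lee_fin eint_phiE; last exact: F1.
apply: (@le_trans _ _ (eint m (fun t => 1 + N (F r t))%R)).
  apply: eint_le.
  - exact: meas_phi (mF r1).
  - by apply: measurable_funD => //; exact: cmeas_N (mF r1).
  - by move=> t; exact: phi_ge0.
  - by move=> t; exact: phi_le.
rewrite eintD//; [|exact: cmeas_N (mF r1)|by move=> t; exact: N_ge0].
rewrite eint_m_cst// -pint1 (_ : 2 + M = 1 + (1 + M)); last by ring.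
rewrite (EFinD 1) leeD2l//.
apply: (le_trans (pint_le1D ler01 (ltW p1) (mF r1))).
by rewrite EFinD leeD2l//; exact: fM.
Qed.

(** The means [A r] of [phi] are bounded; let [rho] be a radius where they nearly attain their
    supremum. The Poisson integral at [rho] of the midpoint of two dilates is close to [f] on that
    circle, so by contraction the midpoint itself has a nearly maximal mean. The midpoint gap is
    then small in [L^1], and strict convexity brings the dilates together. *)
Lemma hardy_l1_cauchy : l1_cauchy (fun n => F (rseq n)).
Proof.
move=> eps eps0.
pose E0 := 1 + 2 `^ p * 2 `^ p * (2 + M + M).
have E00 : 0 < E0 by rewrite ltr_pwDl// !mulr_ge0 ?powR_ge0 ?addr_ge0.
(* [e] and [del] split [eps] into halves: [e * E0 = eps / 2] and [K * (4 * del) <= eps / 2]. *)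
pose e := eps / (2 * E0); have e0 : 0 < e by rewrite divr_gt0 ?mulr_gt0.
have [K K0 HK] := gap_young p1 e0.
pose del := eps / (8 * (K + 1)).
have K1 : 0 < K + 1 by rewrite ltr_wpDl.
have del0 : 0 < del by rewrite divr_gt0 ?mulr_gt0.
pose A r := \int[m]_t phi (F r t).
pose B := [set A r | r in [set r | 0 <= r < 1]].
have hB : has_sup B.
  split; first by exists (A 0); exists 0 => //=; rewrite lexx ltr01.
  by exists (2 + M) => _ [r r1 <-]; exact: phi_mean_bound.
have AS r : 0 <= r < 1 -> A r <= sup B.
  by move=> r1; apply: ub_le_sup; [case: hB|exists r].
have [_ [rho rho1 <-] Arho] := sup_adherent del0 hB.
have [rho0 rhol] := andP rho1.
have [d1 d10 Hd] := uniform_circle rho0 rhol del0 (fun z hz => cdiff_cont (df hz)).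
have [n0 _ Hn0] := (cvgR_P _ _).1 (@rseq_cvg R) _ d10.
have near n t : (n0 <= n)%N -> N (f ((rho * rseq n)%:C * cis t) - F rho t) <= del.
  move=> nn; rewrite /F; have [t' t'1 <-] := cis_repr t.
  apply: Hd => //; have := Hn0 n nn => /=; apply: le_lt_trans.
  rewrite (_ : _ - rho = - (rho * (1 - rseq n))); last by ring.
  by rewrite normrN normrM ger0_norm// ler_piMl// ltW.
exists n0 => i j ni nj.
have ri := @rseq_itv R i; have rj := @rseq_itv R j.
pose u := F (rseq i); pose v := F (rseq j).
pose mid t := 2^-1%:C * (u t + v t).
have u1 : cL1 u by exact: F1.
have v1 : cL1 v by exact: F1.
have mid1 : cL1 mid by apply: cL1Z; exact: cL1D.
pose h t := pois mid (rho%:C * cis t).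
have hE t : h t = 2^-1%:C * (f ((rho * rseq i)%:C * cis t) + f ((rho * rseq j)%:C * cis t)).
  have z1 := Nr t rho1.
  rewrite [rho * rseq i]mulrC [rho * rseq j]mulrC !rmorphM -!mulrA.
  rewrite -(pois_holo df ri z1) -(pois_holo df rj z1) /h /pois.
  rewrite -cintD; [|exact: cL1_pk|exact: cL1_pk].
  rewrite -cintZ; last by apply: cL1D; exact: cL1_pk.
  by apply: cint_ext => s; rewrite /mid /u /v /F; ring.
have h2 : 0 <= 2^-1 :> R by rewrite invr_ge0.
have hn t : N (F rho t - h t) <= del.
  have -> : F rho t - h t = - (2^-1%:C * ((f ((rho * rseq i)%:C * cis t) - F rho t) +
      (f ((rho * rseq j)%:C * cis t) - F rho t))).
    rewrite hE -[in LHS](mul1r (F rho t)).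
    rewrite (_ : 1 = 2^-1%:C + 2^-1%:C :> C); first by ring.
    by rewrite -rmorphD (_ : 2^-1 + 2^-1 = 1 :> R)//; lra.
  rewrite NN NM NR ger0_norm// mulrC ler_pdivrMr//.
  by have := ND (f ((rho * rseq i)%:C * cis t) - F rho t) (f ((rho * rseq j)%:C * cis t) - F rho t);
     have := near i t ni; have := near j t nj; lra.
have mh : cmeas h by exact: pois_cmeas.
pose m0 := \int[m]_t phi (mid t).
have Am0 : A rho <= m0 + del.
  rewrite -lee_fin eint_phiE; last exact: F1.
  apply: (@le_trans _ _ (eint m (fun t => phi (h t) + del)%R)).
    apply: eint_le.
    - exact: meas_phi (mF rho1).
    - by apply: measurable_funD => //; exact: meas_phi.
    - by move=> t; exact: phi_ge0.
    - by move=> t; have := phi_lip (F rho t) (h t); have := hn t; lra.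
  rewrite eintD//; [|exact: meas_phi|by move=> t; exact: phi_ge0|by move=> t; exact: ltW].
  rewrite eint_m_cst ?(ltW del0)// EFinD leeD2r// eint_phiE//.
  exact: phi_contract.
pose g t := phi (u t) + phi (v t) - 2 * phi (mid t).
have D0 t : 0 < phi (u t) + phi (v t) by rewrite addr_gt0 ?phi_gt0.
have ge t : N (u t - v t) ^+ 2 <= (phi (u t) + phi (v t)) ^+ 3 * g t by exact: phi_gap.
have g0 t : 0 <= g t.
  by have := le_trans (sqr_ge0 _) (ge t); rewrite pmulr_rge0// exprn_gt0.
have mu : cmeas u by exact: mF. have mv : cmeas v by exact: mF.
have mmid : cmeas mid by exact: cL1_meas.
have pu := meas_phi mu; have pv := meas_phi mv; have pm := meas_phi mmid.
have mg : measurable_fun setT g.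
  by apply: measurable_funB; [exact: measurable_funD|exact: measurable_funM].
(* Both means are at most [sup B], while [m0] exceeds [sup B - 2 del]. *)
have gi : (eint m g <= (4 * del)%:E)%E.
  have : (eint m g + (2 * m0)%:E = (A (rseq i) + A (rseq j))%:E)%E.
    rewrite EFinD EFinM !eint_phiE// -eintZ//; last by move=> t; exact: phi_ge0.
    rewrite -!eintD//; try by move=> t; rewrite ?mulr_ge0 ?phi_ge0.
      by apply: eq_integral => t _; rewrite /g subrK.
    exact: measurable_funM.
  have fin : eint m g \is a fin_num.
    rewrite ge0_fin_numE; last exact: eint_ge0.
    apply: (@le_lt_trans _ _ (eint m (fun t => phi (u t) + phi (v t))%R)).
      apply: eint_le => //; first exact: measurable_funD.
      by move=> t; rewrite gerBl mulr_ge0 ?phi_ge0.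
    rewrite eintD//; try by move=> t; exact: phi_ge0.
    by rewrite -!eint_phiE// -EFinD ltry.
  rewrite -(fineK fin) -EFinD => -[H]; rewrite lee_fin.
  by have := AS _ ri; have := AS _ rj; move: H Am0 Arho; lra.
clearbody g m0 h.
pose D t := phi (u t) + phi (v t).
have mD : measurable_fun setT (fun t => D t `^ p).
  by apply: (measurableT_comp (@measurable_powR R _)); exact: measurable_funD.
have Di : (eint m (fun t => 1 + D t `^ p)%R <= E0%:E)%E.
  rewrite eintD//; [|by move=> t; exact: powR_ge0].
  rewrite eint_m_cst// EFinD leeD2l//.
  have c0 : 0 <= 2 `^ p * 2 `^ p :> R by rewrite mulr_ge0 ?powR_ge0.
  apply: (@le_trans _ _ (eint m (fun t => 2 `^ p * 2 `^ p *
      (2 + N (u t) `^ p + N (v t) `^ p))%R)).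
    apply: eint_le => //.
    - apply: measurable_funM => //; apply: measurable_funD; last exact: cmeas_Npow.
      by apply: measurable_funD => //; exact: cmeas_Npow.
    - by move=> t; exact: powR_ge0.
    - by move=> t; apply: phi_pow; exact: ltW.
  rewrite eintZ//; last 2 first.
  - apply: measurable_funD; last exact: cmeas_Npow.
    by apply: measurable_funD => //; exact: cmeas_Npow.
  - by move=> t; rewrite !addr_ge0 ?powR_ge0.
  rewrite [leRHS]EFinM; apply: lee_wpmul2l; first by rewrite lee_fin.
  rewrite eintD//; last 4 first.
  - by apply: measurable_funD => //; exact: cmeas_Npow.
  - exact: cmeas_Npow.
  - by move=> t; rewrite addr_ge0 ?powR_ge0.
  - by move=> t; exact: powR_ge0.
  rewrite eintD//; [|exact: cmeas_Npow|by move=> t; exact: powR_ge0].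
  rewrite eint_m_cst// !EFinD; apply: leeD; last exact: fM.
  by apply: leeD => //; exact: fM.
apply: (@le_trans _ _ (eint m (fun t => K * g t + e * (1 + D t `^ p))%R)).
  apply: eint_le.
  - by apply: cmeas_N; exact: cmeasB.
  - apply: measurable_funD; first exact: measurable_funM.
    by apply: measurable_funM => //; exact: measurable_funD.
  - by move=> t; exact: N_ge0.
  - move=> t; apply: HK => //; [exact: N_ge0|exact: D0|].
    by apply: (le_trans (NB _ _)); apply: lerD; exact: N_le_phi.
rewrite eintD; last 4 first.
- exact: measurable_funM.
- by apply: measurable_funM => //; exact: measurable_funD.
- by move=> t; exact: mulr_ge0.
- by move=> t; rewrite mulr_ge0 ?addr_ge0 ?powR_ge0// ltW.
rewrite !eintZ ?(ltW e0)//; last 2 first.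
- exact: measurable_funD.
- by move=> t; rewrite addr_ge0 ?powR_ge0.
apply: (@le_trans _ _ (K%:E * (4 * del)%:E + e%:E * E0%:E)%E).
  by rewrite leeD// lee_wpmul2l ?lee_fin// ltW.
rewrite -!EFinM -EFinD lee_fin.
have -> : e * E0 = eps / 2 by rewrite /e; field; rewrite gt_eqF.
suff : K * (4 * del) <= eps / 2 by lra.
rewrite /del mulrA mulrA ler_pdivrMr ?mulr_gt0//.
by have := ltW eps0; nra.
Qed.

(** At fixed [z] the kernel is bounded, so the [L^1] limit suffices for Cauchy integrals; the [L^p]
    bound follows by Fatou's lemma along the subsequence. The identity for conjugates says that [w]
    has no Fourier coefficients of negative index. *)
Theorem hardy_representation : exists w, [/\ Lp p w, (pint p w <= M%:E)%E,
  forall z, N z < 1 -> cauchy w z = f z,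
  forall z, N z < 1 -> cauchy (fun t => cj (w t)) z = cj (f 0) &
  forall z, N z < 1 -> pois w z = f z].
Proof.
have [n|w [mw [g gk gw] wl]] := l1_limit _ hardy_l1_cauchy; first exact: mF (rseq_itv n).
have wM : (pint p w <= M%:E)%E.
  apply: (@eint_fatou _ _ _ m (fun k t => N (F (rseq (g k)) t) `^ p)).
  - by move=> n; exact: cmeas_Npow (mF (rseq_itv _)).
  - by move=> n t; exact: powR_ge0.
  - exact: cmeas_Npow.
  - by move=> t; exact: powR_ge0.
  - by apply: filterS gw => t; exact: powR_Ncvg.
  - by move=> n; apply: fM; exact: rseq_itv.
have Lw : Lp p w by split; [exact: mw|rewrite (le_lt_trans wM)// ltry].
have w1 : cL1 w := Lp_cL1 (ltW p1) Lw.
have w1' := cL1_conj w1.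
have small z (e : R) : N z < 1 -> 0 < e -> exists n0, forall n, (n0 <= n)%N ->
    N (f ((rseq n)%:C * z) - cauchy w z) <= e /\
    N (cj (f 0) - cauchy (fun t => cj (w t)) z) <= e.
  move=> z1 e0; have q0 : 0 < 1 - N z by rewrite subr_gt0.
  have [n0 Hn0] := wl _ (mulr_gt0 e0 q0); exists n0 => n nn.
  have rn := @rseq_itv R n.
  have d1 : cL1 (fun t => F (rseq n) t - w t) by apply: cL1B => //; exact: F1.
  have In : (1 - N z)^-1 * I1 (fun t => F (rseq n) t - w t) <= e.
    by rewrite mulrC ler_pdivrMr// -lee_fin I1E//; exact: Hn0.
  have cB (u v : T -> C) : cL1 u -> cL1 v ->
      cauchy u z - cauchy v z = cauchy (fun t => u t - v t) z.
    move=> u1 v1; rewrite /cauchy -cintB; [|exact: cL1_ckM|exact: cL1_ckM].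
    by apply: cint_ext => t; rewrite mulrBr.
  split; apply: le_trans In.
    rewrite -(cauchy_holo df rn z1) cB//; last exact: F1.
    exact: N_cauchy.
  rewrite -(cauchy_conj_holo df rn z1) cB//; last by apply: cL1_conj; exact: F1.
  have -> : I1 (fun t => F (rseq n) t - w t) = I1 (fun t => cj (F (rseq n) t - w t)).
    by apply: eq_Rintegral => t _; rewrite Nconj.
  rewrite (_ : cauchy _ z = cauchy (fun t => cj (F (rseq n) t - w t)) z).
    exact: N_cauchy (cL1_conj d1) z1.
  by apply: cint_ext => t; rewrite conjB.
have eq0 (a b : C) : (forall e : R, 0 < e -> N (a - b) <= e) -> a = b.
  move=> H; apply/eqP; rewrite -subr_eq0 -N_eq0 eq_le N_ge0 andbT.
  by apply/ler_addgt0Pl => e e0; rewrite addr0; exact: H.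
have cw z : N z < 1 -> cauchy w z = f z.
  move=> z1; apply: eq0 => e e0; have e2 : 0 < e / 2 by rewrite divr_gt0.
  have [n0 Hn0] := small z _ z1 e2.
  have [d d0 Hd] := cdiff_cont (df z1) e2.
  have [n1 _ Hn1] := (cvgR_P _ _).1 (@rseq_cvg R) _ d0.
  pose n := maxn n0 n1.
  have [h1 _] := Hn0 n (leq_maxl _ _).
  have h2 : N (f ((rseq n)%:C * z) - f z) < e / 2.
    have := Hd ((rseq n - 1)%:C * z); rewrite (_ : z + _ = (rseq n)%:C * z); last first.
      by rewrite rmorphB mulrBl mul1r addrC subrK.
    apply; rewrite NM NR distrC; apply: le_lt_trans (Hn1 n (leq_maxr _ _)).
    by rewrite ler_piMr// ltW.
  rewrite (_ : _ - f z = (f ((rseq n)%:C * z) - f z) - (f ((rseq n)%:C * z) - cauchy w z)).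
    by apply: (le_trans (NB _ _)); lra.
  by ring.
have cc z : N z < 1 -> cauchy (fun t => cj (w t)) z = cj (f 0).
  move=> z1; apply/esym/eq0 => e e0; have [n0 Hn0] := small z _ z1 e0.
  by have [] := Hn0 n0 (leqnn _).
exists w; split => // z z1.
have z0 : N (0 : C) < 1 by rewrite N0.
by rewrite poisE// cw// cc// conjKc -(cauchy0 w1) cw// addrK.
Qed.

End hardy_representation.

(** * Boundary functions and the Riesz decomposition *)

Section boundary_values.
Context {R : realType}.
Notation C := R[i].
Notation T := (measurableTypeR R).
Local Notation m := (circle_measure R).
Implicit Types (a b : C) (w u : T -> C) (f g h : C -> C) (p e t : R).

Lemma ntP f t (l : C) : nontangential_limit f (cis t) l <->
  forall al : R, 1 < al -> forall e, 0 < e -> exists2 del : R, 0 < del &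
    forall k, N k < del -> N (cis t + k) < 1 -> N k < al * (1 - N (cis t + k)) ->
      N (l - f (cis t + k)) < e.
Proof.
have kE k : cis t + k - cis t = k :> C by rewrite addrC addKr.
split=> H al al1.
  move=> e e0; have /cvgC_P/(_ e e0) H1 := H al al1.
  have [del del0 Hd] := (nbhsC_P _ _).1 H1; exists del => // k kd k1 kal.
  by apply: (Hd k kd); apply/stolzE; rewrite kE.
apply/cvgC_P => e e0; have [del del0 Hd] := H al al1 e e0.
apply/nbhsC_P; exists del => // k kd /stolzE[k1]; rewrite kE => kal.
exact: Hd.
Qed.

Lemma nt_radial f t (l : C) : nontangential_limit f (cis t) l ->
  forall e, 0 < e -> \forall n \near \oo, N (f ((rseq n)%:C * cis t) - l) < e.
Proof.
move=> /ntP H e e0; have [del del0 Hd] := H 2 (ltr1n _ 2) e e0.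
have := (cvgR_P _ _).1 (@rseq_cvg R) _ del0; apply: filterS => n nd.
have /andP[r0 r1] := @rseq_itv R n.
pose k : C := - ((1 - rseq n)%:C * cis t).
have kE : cis t + k = (rseq n)%:C * cis t by rewrite /k rmorphB rmorph1; ring.
have Nk : N k = 1 - rseq n.
  by rewrite NN NM Ncis mulr1 NR ger0_norm// subr_ge0 ltW.
have := Hd k; rewrite kE Nk N_circle// NBC; apply => //.
  by move: nd; rewrite ger0_norm// subr_ge0 ltW.
by rewrite -subr_gt0 in r1; lra.
Qed.

Lemma nt_unique f t (l l' : C) : nontangential_limit f (cis t) l ->
  nontangential_limit f (cis t) l' -> l = l'.
Proof.
move=> H H'; apply/eqP; rewrite -subr_eq0 -N_eq0 eq_le N_ge0 andbT.
apply/ler_addgt0Pl => e e0; rewrite addr0; have e2 : 0 < e / 2 by rewrite divr_gt0.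
have [n _ /(_ n (leqnn n)) [h1 h2]] := filterI (nt_radial H e2) (nt_radial H' e2).
rewrite (_ : l - l' = (f ((rseq n)%:C * cis t) - l') - (f ((rseq n)%:C * cis t) - l)).
  by apply: (le_trans (NB _ _)); lra.
by ring.
Qed.

Lemma boundaryE f t (l : C) : nontangential_limit f (cis t) l -> boundary f t = l.
Proof.
move=> H; suff bH : nontangential_limit f (cis t) (boundary f t) by exact: nt_unique bH H.
exact: (@xgetPex _ 0 (nontangential_limit f (cis t)) (ex_intro _ l H)).
Qed.

Lemma nt_ext f g t l : (forall z, N z < 1 -> f z = g z) ->
  nontangential_limit f (cis t) l -> nontangential_limit g (cis t) l.
Proof.
move=> fg /ntP H; apply/ntP => al al1 e e0; have [del del0 Hd] := H al al1 e e0.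
by exists del => // k kd k1 kal; rewrite -fg//; exact: Hd.
Qed.

Lemma nt_cst a t : nontangential_limit (fun=> a) (cis t) a.
Proof. by apply/ntP => al al1 e e0; exists 1 => // k *; rewrite subrr N0. Qed.

Lemma ntD f g t l l' : nontangential_limit f (cis t) l -> nontangential_limit g (cis t) l' ->
  nontangential_limit (fun z => f z + g z) (cis t) (l + l').
Proof. by move=> H H' al al1; apply: (@cvgD _ C^o); [exact: H|exact: H']. Qed.

Lemma ntM f g t l l' : nontangential_limit f (cis t) l -> nontangential_limit g (cis t) l' ->
  nontangential_limit (fun z => f z * g z) (cis t) (l * l').
Proof. by move=> H H' al al1; apply: (@cvgM C); [exact: H|exact: H']. Qed.

Lemma nt_conj f t l : nontangential_limit f (cis t) l ->
  nontangential_limit (fun z => cj (f z)) (cis t) (cj l).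
Proof.
move=> /ntP H; apply/ntP => al al1 e e0; have [del del0 Hd] := H al al1 e e0.
by exists del => // k kd k1 kal; rewrite -conjB Nconj; exact: Hd.
Qed.

(** A measurable stand-in for [boundary f], which need not be Borel measurable. *)
Definition rl f t : C := fine (limn_esup (fun n => (Re (f ((rseq n)%:C * cis t)))%:E)) +i*
  fine (limn_esup (fun n => (Im (f ((rseq n)%:C * cis t)))%:E)).

Lemma rl_meas f : (forall r, 0 <= r < 1 -> cmeas (fun t : T => f (r%:C * cis t))) ->
  cmeas (rl f : T -> C).
Proof.
move=> mf.
split.
- apply: (measurable_limsup (a := fun n t => Re (f ((rseq n)%:C * cis t)))) => n.
  by case: (mf _ (@rseq_itv R n)).
- apply: (measurable_limsup (a := fun n t => Im (f ((rseq n)%:C * cis t)))) => n.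
  by case: (mf _ (@rseq_itv R n)).
Qed.

Lemma rlE f t l : nontangential_limit f (cis t) l -> rl f t = l.
Proof.
move=> /nt_radial H.
have key (pr : C -> R) : (forall a b, `|pr a - pr b| <= N (a - b)) ->
    fine (limn_esup (fun n => (pr (f ((rseq n)%:C * cis t)))%:E)) = pr l.
  move=> Hp; have c : (pr (f ((rseq n)%:C * cis t)))%:E @[n --> \oo] --> (pr l)%:E.
    apply: cvg_EFin; first by near=> n.
    apply/cvgR_P => e e0; apply: filterS (H e e0) => n; apply: le_lt_trans.
    by rewrite distrC; exact: Hp.
  by rewrite (cvg_limn_einf_sup c).2.
apply: complex_eq; rewrite /rl [LHS]/=; apply: key => a b.
- by rewrite -ReN -ReD; exact: normRe.
- by rewrite -ImN -ImD; exact: normIm.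
Unshelve. all: by end_near. Qed.

(** Working form of [hardy] for finite [p], with integrals of powers in place of norms; [hardyP] is
    the translation. *)
Definition hp p f := [/\ forall z, N z < 1 -> cdiff f z, forall z, ~ N z < 1 -> f z = 0 &
  exists2 M : R, 0 <= M & forall r, 0 <= r < 1 ->
    (pint p (fun t => f (r%:C * cis t))%R <= M%:E)%E].

Lemma pint_ae p u w : cmeas u -> cmeas w -> (\forall t \ae m, u t = w t) ->
  pint p u = pint p w.
Proof.
move=> mu mw uw; apply: eint_eq_ae; try exact: cmeas_Npow;
  try (by move=> t; exact: powR_ge0).
by apply: filterS uw => t ->.
Qed.

Lemma cint_ae u w : cmeas u -> (\forall t \ae m, u t = w t) -> cL1 w ->
  cL1 u /\ cint u = cint w.
Proof.
move=> mu uw w1; have mw := cL1_meas w1; split.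
  apply: cL1P => //; rewrite -pint1 (pint_ae 1 mu mw uw) pint1.
  by rewrite -I1E// ltry.
case: (mu) (mw) => m1 m2 [m3 m4].
apply: complex_eq; rewrite /cint /= /Rintegral; congr fine;
  apply: ae_eq_integral => //; try exact/measurable_EFinP.
- by apply: filterS uw => t -> _.
- by apply: filterS uw => t -> _.
Qed.

Lemma cauchy_ae u w z : cmeas u -> (\forall t \ae m, u t = w t) -> cL1 w -> N z < 1 ->
  cauchy u z = cauchy w z.
Proof.
move=> mu uw w1 hz.
have [] // := @cint_ae (fun t => ck z t * u t) (fun t => ck z t * w t).
- by apply: cmeasM => //; apply: cctn_meas; exact: cctn_ck.
- by apply: filterS uw => t ->.
- exact: cL1_ckM.
Qed.

Lemma hp_mono s p f : 0 <= s -> s <= p -> hp p f -> hp s f.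
Proof.
move=> s0 sp [df f0 [M M0 HM]]; split => //; exists (1 + M); first by rewrite addr_ge0.
move=> r r1; apply: (le_trans (pint_le1D s0 sp _)).
  by apply: cctn_meas; exact: holo_cctn.
by rewrite EFinD leeD2l//; exact: HM.
Qed.

Theorem hp_rl p f : 1 < p -> hp p f -> [/\
  \forall t \ae m, nontangential_limit f (cis t) (rl f t),
  Lp p (rl f),
  forall M : R, 0 <= M -> (forall r, 0 <= r < 1 ->
    (pint p (fun t => f (r%:C * cis t))%R <= M%:E)%E) -> (pint p (rl f) <= M%:E)%E,
  forall z, N z < 1 -> cauchy (rl f) z = f z /\ pois (rl f) z = f z &
  forall z, N z < 1 -> cauchy (fun t => cj (rl f t)) z = cj (f 0)].
Proof.
move=> p1 [df f0 [M0 M00 HM0]].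
(* The representing function may depend on the bound [M], whereas [rl f] does not: by Fatou's
   theorem they agree almost everywhere, so each bound can be treated with its own
   representation. *)
have main (M : R) : 0 <= M -> (forall r, 0 <= r < 1 ->
    (pint p (fun t => f (r%:C * cis t))%R <= M%:E)%E) -> [/\
    \forall t \ae m, nontangential_limit f (cis t) (rl f t),
    Lp p (rl f), (pint p (rl f) <= M%:E)%E,
    forall z, N z < 1 -> cauchy (rl f) z = f z /\ pois (rl f) z = f z &
    forall z, N z < 1 -> cauchy (fun t => cj (rl f t)) z = cj (f 0)].
  move=> hM HM.
  have [w [Lw wM cw cc pw]] := hardy_representation p1 df hM HM.
  have w1 : cL1 w := Lp_cL1 (ltW p1) Lw.
  have mw := cL1_meas w1.
  have ntw : \forall t \ae m, nontangential_limit f (cis t) (w t).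
    by apply: filterS (fatou_nontangential w1) => t; exact: nt_ext pw.
  have rw : \forall t \ae m, rl f t = w t by apply: filterS ntw => t; exact: rlE.
  have mr : cmeas (rl f : T -> C).
    by apply: rl_meas => r r1; apply: cctn_meas; exact: holo_cctn.
  have r1 : cL1 (rl f) by have [] := cint_ae mr rw w1.
  have crw z : N z < 1 -> cauchy (rl f) z = cauchy w z.
    by move=> hz; exact: cauchy_ae.
  have crc z : N z < 1 -> cauchy (fun t => cj (rl f t)) z = cauchy (fun t => cj (w t)) z.
    move=> hz; apply: cauchy_ae => //; first exact: cmeas_conj.
      by apply: filterS rw => t ->.
    exact: cL1_conj.
  split.
  - by apply: filterS2 ntw rw => t + ->.
  - by split => //; rewrite (pint_ae p mr mw rw); case: Lw.
  - by rewrite (pint_ae p mr mw rw).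
  - move=> z hz; rewrite crw// cw//; split => //.
    have z0 : N (0 : C) < 1 by rewrite N0.
    by rewrite poisE// crw// crc// cw// cc// conjKc -(cauchy0 r1) crw// cw// addrK.
  - by move=> z hz; rewrite crc// cc.
have [h1 h2 _ h4 h5] := main _ M00 HM0.
by split => // M hM HM; have [] := main M hM HM.
Qed.

Lemma hp_boundary p f : 1 < p -> hp p f -> \forall t \ae m, boundary f t = rl f t.
Proof. by move=> p1 /(hp_rl p1)[h _ _ _ _]; apply: filterS h => t; exact: boundaryE. Qed.

(** Functions on the disk are encoded with the value [0] outside it, which Cauchy integrals need not
    have. *)
Definition dx f : C -> C := fun z => if N z < 1 then f z else 0.

Lemma dxE f z : N z < 1 -> dx f z = f z. Proof. by rewrite /dx => ->. Qed.

Lemma dx0 f z : ~ N z < 1 -> dx f z = 0. Proof. by move=> /negP/negbTE h; rewrite /dx h. Qed.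

Lemma dx_cdiff f z : (forall z, N z < 1 -> cdiff f z) -> N z < 1 -> cdiff (dx f) z.
Proof.
move=> df hz; apply: cdiff_near (df z hz); exists (1 - N z); first by rewrite subr_gt0.
by move=> k hk; rewrite dxE//; apply: (le_lt_trans (ND _ _)); lra.
Qed.

Lemma dx_circle f r : 0 <= r < 1 ->
  (fun t => dx f (r%:C * cis t)) = (fun t => f (r%:C * cis t)).
Proof. by move=> r1; apply/funext => t; rewrite dxE// Nr. Qed.

Lemma pint_fin p w : Lp p w -> exists2 L : R, 0 < L & (pint p w <= L%:E)%E.
Proof.
move=> [mw wi]; have f : pint p w \is a fin_num by rewrite ge0_fin_numE ?pint_ge0.
exists (fine (pint p w) + 1); first by rewrite ltr_wpDl// fine_ge0// pint_ge0.
by rewrite EFinD fineK// leeDl.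
Qed.

Lemma hp_cauchy p K w (L : R) : 1 < p -> (forall r, 0 <= r < 1 ->
    bounded_at m (fun w t => N (cauchy w (r%:C * cis t))) p p K) -> 0 <= K ->
  0 < L -> cmeas w -> (pint p w <= L%:E)%E ->
  hp p (dx (cauchy w)) /\ (pint p (rl (dx (cauchy w))) <= (K * L)%:E)%E.
Proof.
move=> p1 HK K0 L0 mw wL.
have Lw : Lp p w by split; [exact: mw|rewrite (le_lt_trans wL)// ltry].
have w1 := Lp_cL1 (ltW p1) Lw.
have KL : 0 <= K * L by rewrite mulr_ge0// ltW.
have B r : 0 <= r < 1 -> (pint p (fun t => dx (cauchy w) (r%:C * cis t))%R <= (K * L)%:E)%E.
  by move=> r1; rewrite dx_circle//; apply: riesz_scale => //; [exact: ltW|exact: HK].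
have hpd : hp p (dx (cauchy w)).
  split; [|by move=> z; exact: dx0|by exists (K * L)].
  by move=> z; apply: dx_cdiff => z'; exact: cauchy_cdiff.
by split => //; have [_ _ + _ _] := hp_rl p1 hpd; apply.
Qed.

Lemma hpD p f g : 1 <= p -> hp p f -> hp p g -> hp p (fun z => f z + g z).
Proof.
move=> p1 [df f0 [M M0 HM]] [dg g0 [L L0 HL]]; have p0 : 0 <= p by rewrite (le_trans _ p1).
split.
- by move=> z hz; apply: cdiffD; [exact: df|exact: dg].
- by move=> z hz; rewrite f0// g0// addr0.
- exists (2 `^ p * (M + L)); first by rewrite mulr_ge0 ?powR_ge0 ?addr_ge0.
  move=> r r1; apply: (le_trans (pintD p0 _ _)).
  + exact: cctn_meas (holo_cctn df r1).
  + exact: cctn_meas (holo_cctn dg r1).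
  + by rewrite EFinM lee_wpmul2l ?lee_fin ?powR_ge0// EFinD leeD ?HM ?HL.
Qed.

Lemma hp_bndM p f g : 0 <= p -> (forall z, N z < 1 -> cdiff g z) ->
  (forall z, N z < 1 -> N (g z) <= 1) -> hp p f -> hp p (fun z => g z * f z).
Proof.
move=> p0 dg g1 [df f0 [M M0 HM]]; split.
- by move=> z hz; apply: cdiffM; [exact: dg|exact: df].
- by move=> z hz; rewrite f0// mulr0.
- exists M; first exact: M0.
  move=> r r1; apply: le_trans (HM r r1); apply: pint_le => //.
  + apply: cmeasM; apply: cctn_meas; exact: holo_cctn.
  + by apply: cctn_meas; exact: holo_cctn.
  + by move=> t; rewrite NM ler_piMl ?N_ge0//; apply: g1; exact: Nr.
Qed.

Lemma hpZ p c f : 0 <= p -> hp p f -> hp p (fun z => c * f z).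
Proof.
move=> p0 [df f0 [M M0 HM]]; split.
- by move=> z hz; apply: cdiffM; [exact: cdiff_cst|exact: df].
- by move=> z hz; rewrite f0// mulr0.
- exists (N c `^ p * M); first by rewrite mulr_ge0 ?powR_ge0.
  move=> r r1; rewrite pintZ//; last exact: cctn_meas (holo_cctn df r1).
  by rewrite EFinM lee_wpmul2l ?lee_fin ?powR_ge0// HM.
Qed.

Lemma hp_sq p f : 1 <= p -> hp (2 * p) f -> hp p (fun z => f z * f z).
Proof.
move=> p1 [df f0 [M M0 HM]]; split.
- by move=> z hz; apply: cdiffM; exact: df.
- by move=> z hz; rewrite f0// mulr0.
- exists M; first exact: M0.
  move=> r r1; apply: le_trans (HM r r1).
  rewrite le_eqVlt; apply/orP; left; apply/eqP; apply: eq_integral => t _.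
  by rewrite NM powRM ?N_ge0// powRM2 ?N_ge0.
Qed.

Lemma hp_cst_dx p (c : C) : 0 <= p -> hp p (dx (fun=> c)).
Proof.
move=> p0; split.
- by move=> z; apply: dx_cdiff => *; exact: cdiff_cst.
- by move=> z; exact: dx0.
- exists (N c `^ p); first exact: powR_ge0.
  by move=> r r1; rewrite dx_circle// /pint eint_m_cst ?powR_ge0.
Qed.

(** [pois_split] passes to nontangential limits, where the Poisson integral returns [w]; M. Riesz'
    theorem puts both halves in the Hardy space. *)
Theorem riesz_split p w : 1 < p -> Lp p w -> exists B : C -> C,
  [/\ hp p (dx (cauchy w)), hp p B, B 0 = 0 &
      \forall t \ae m, w t = rl (dx (cauchy w)) t + cj (rl B t)].
Proof.
move=> p1 Lw; have [K K0 HK] := riesz p1.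
have w1 := Lp_cL1 (ltW p1) Lw; have w1' := cL1_conj w1.
have p0 : 0 <= p by rewrite ltW// (lt_trans _ p1).
have [L L0 wL] := pint_fin Lw.
have [hA _] := hp_cauchy p1 HK K0 L0 Lw.1 wL.
have mw' := cmeas_conj Lw.1.
have wL' : (pint p (fun t => cj (w t)) <= L%:E)%E.
  by apply: le_trans wL; rewrite le_eqVlt; apply/orP; left; apply/eqP;
    apply: eq_integral => t _; rewrite Nconj.
have [hB _] := hp_cauchy p1 HK K0 L0 mw' wL'.
pose c := cint (fun t => cj (w t)).
pose B z := dx (cauchy (fun t => cj (w t))) z + (-1) * dx (fun=> c) z.
have z0 : N (0 : C) < 1 by rewrite N0.
have hB' : hp p B by apply: hpD (ltW p1) hB (hpZ _ p0 (hp_cst_dx _ p0)).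
exists B; split => //.
  by rewrite /B !dxE// cauchy0// mulN1r subrr.
have [ntA _ _ _ _] := hp_rl p1 hA; have [ntB _ _ _ _] := hp_rl p1 hB'.
apply: filterS3 (fatou_nontangential w1) ntA ntB => t ntw nA nB.
apply: (nt_unique ntw); apply: nt_ext (ntD nA (nt_conj nB)) => z hz.
by rewrite pois_split// /B !dxE// mulN1r.
Qed.

End boundary_values.

(** * Model spaces *)

Section norms.
Context {R : realType} d (X : measurableType d) (mu : {measure set X -> \bar R}).

(** The integral of a nonnegative function is a supremum over simple functions below it, so
    monotonicity also covers nonmeasurable boundary functions. *)
Lemma ge0_integral_mono (f g : X -> \bar R) : (forall x, 0 <= f x)%E ->
  (forall x, f x <= g x)%E -> (\int[mu]_x f x <= \int[mu]_x g x)%E.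
Proof.
move=> f0 fg; have g0 x : (0 <= g x)%E by exact: le_trans (f0 x) (fg x).
rewrite !ge0_integralTE//; apply: ereal_sup_le => _ [h hf <-].
by exists h => // x; exact: le_trans (hf x) (fg x).
Qed.

(** [f] is not assumed measurable: a boundary function need not be. *)
Lemma ge0_integral_ae (f g : X -> \bar R) : (forall x, 0 <= f x)%E ->
  (forall x, 0 <= g x)%E -> measurable_fun setT g -> (\forall x \ae mu, f x = g x) ->
  (\int[mu]_x f x = \int[mu]_x g x)%E.
Proof.
move=> f0 g0 mg [A [mA A0 fgA]].
have offA x : ~ A x -> f x = g x.
  by move=> nA; apply: contrapT => nfg; apply: nA; exact: fgA.
have aeA : \forall x \ae mu, ~ A x.
  by exists A; split => // x /= /contrapT.
(* [g] altered on the null set, to [+oo] for a measurable majorant of [f] and to [0] for a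
   minorant. *)
pose h (c : \bar R) x := if x \in A then c else g x.
have mh c : measurable_fun setT (h c).
  apply: measurable_fun_if => //.
  - apply: (measurable_fun_bool true); rewrite setTI (_ : _ @^-1` _ = A)//.
    by apply/seteqP; split => x /=; [exact: set_mem|exact: mem_set].
  - exact: measurable_funTS.
have hE c : (0 <= c)%E -> (\int[mu]_x h c x = \int[mu]_x g x)%E.
  move=> c0; apply: ae_eq_integral => //; apply: filterS aeA => x nA _.
  by rewrite /h memNset.
apply/eqP; rewrite eq_le; apply/andP; split.
  rewrite -(hE +oo%E)//; apply: ge0_integral_mono => // x; rewrite /h.
  by case: ifPn => [_|/negP xA]; [exact: leey|rewrite offA// => /mem_set].
rewrite -(hE 0%E)//; apply: ge0_integral_mono => x; rewrite /h.
  by case: ifPn.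
by case: ifPn => [_|/negP xA]; [exact: f0|rewrite offA// => /mem_set].
Qed.

Lemma Lp_normE (p : R) (u : X -> R[i]) :
  Lp_norm mu p%:E u = ((eint mu (fun x => N (u x) `^ p)%R) `^ p^-1)%E.
Proof.
rewrite /Lp_norm Lnorm.unlock; apply: (congr1 (fun I => poweR I p^-1)).
apply: eq_integral => x _.
by rewrite /= ger0_norm ?N_ge0.
Qed.

Lemma poweR_le (I : \bar R) (M p : R) : 0 < p -> (0 <= I)%E -> 0 <= M ->
  (I `^ p^-1 <= M%:E)%E <-> (I <= (M `^ p)%:E)%E.
Proof.
move=> p0; have pV : 0 < p^-1 by rewrite invr_gt0.
case: I => [x x0 M0|_ M0|//].
  rewrite poweR_EFin !lee_fin; rewrite lee_fin in x0; split => H.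
    have -> : x = (x `^ p^-1) `^ p by rewrite -powRrM mulVf ?gt_eqF// powRr1.
    by apply: le_powR => //; [exact: ltW|exact: powR_ge0].
  have -> : M = (M `^ p) `^ p^-1 by rewrite -powRrM mulfV ?gt_eqF// powRr1.
  by apply: le_powR => //; exact: ltW.
by rewrite poweRyr ?gt_eqF// !leye_eq.
Qed.

End norms.

Section hardy_conversion.
Context {R : realType}.
Notation C := R[i].
Notation T := (measurableTypeR R).
Local Notation m := (circle_measure R).
Implicit Types (f g h : C -> C) (p : R).

Lemma holoP f : holomorphic_on_disk f <->
  (forall z, N z < 1 -> cdiff f z) /\ (forall z, ~ N z < 1 -> f z = 0).
Proof.
split=> -[h1 h2]; split => z hz.
- by apply/derivable_cdiff; apply: h1; rewrite Nlt1.
- by apply: h2; rewrite Nlt1.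
- by apply/derivable_cdiff; apply: h1; rewrite -Nlt1.
- by apply: h2; rewrite -Nlt1.
Qed.

Lemma hardyP p f : 0 < p -> hardy p%:E f <-> hp p f.
Proof.
move=> p0; split.
  move=> [/holoP[df f0] [M HM]]; split => //.
  have M0 : 0 <= M.
    have := HM 0; rewrite lexx ltr01 => /(_ isT); rewrite -lee_fin; apply: le_trans.
    exact: Lnorm_ge0.
  exists (M `^ p); first exact: powR_ge0.
  move=> r r1; apply/(poweR_le p0 (pint_ge0 _ _) M0).
  by rewrite -Lp_normE; exact: HM.
move=> [df f0 [M M0 HM]]; split; first exact/holoP.
exists (M `^ p^-1) => r r1; rewrite Lp_normE; apply/poweR_le => //.
- exact: pint_ge0.
- exact: powR_ge0.
- by rewrite -powRrM mulVf ?gt_eqF// powRr1//; exact: HM.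
Qed.

(** Any exponent above 1 would give access to [hp_rl]; 2 is taken for the inner function. *)
Lemma hardyy_hp2 f : hardy +oo%E f -> hp 2 f.
Proof.
move=> [/holoP[df f0] [M HM]]; split => //.
have mf r : 0 <= r < 1 -> cmeas (fun t : T => f (r%:C * cis t)).
  by move=> r1; exact: cctn_meas (holo_cctn df r1).
exists (M ^+ 2); first exact: sqr_ge0.
move=> r r1; have := HM r r1; rewrite /Lp_norm Lnorm.unlock.
rewrite (_ : (0 < m setT)%E = true); last by rewrite circle_setT lte01.
move=> /ess_sup_inf.ess_supP aeM.
rewrite -(eint_m_cst (sqr_ge0 M)); apply: eint_le_ae.
- by apply: cmeas_Npow; exact: mf.
- exact: measurable_cst.
- by move=> t; exact: powR_ge0.
- by move=> t; exact: sqr_ge0.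
apply: filterS aeM => t; rewrite /= lee_fin ger0_norm ?N_ge0// powR_mulrn ?N_ge0// => H.
by rewrite lerXn2r// nnegrE ?N_ge0// (le_trans (N_ge0 _) H).
Qed.

Lemma hardy_normE p f : 1 < p -> hp p f -> hardy_norm p%:E f = (pint p (rl f) `^ p^-1)%E.
Proof.
move=> p1 hf; rewrite /hardy_norm Lp_normE.
apply: (congr1 (fun I => poweR I p^-1)).
have [_ Lf _ _ _] := hp_rl p1 hf.
apply: ge0_integral_ae.
- by move=> t; rewrite lee_fin powR_ge0.
- by move=> t; rewrite lee_fin powR_ge0.
- by apply/measurable_EFinP; apply: cmeas_Npow; case: Lf.
- by apply: filterS (hp_boundary p1 hf) => t ->.
Qed.

End hardy_conversion.

(** * The projection onto the model space and the splitting of squares *)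

Section model.
Context {R : realType}.
Notation C := R[i].
Notation T := (measurableTypeR R).
Local Notation m := (circle_measure R).
Implicit Types (f g h : C -> C) (p s : R) (w u : T -> C).

(** Unlike a Hardy class, this property passes to products without loss of exponent. *)
Definition ant f := \forall t \ae m, nontangential_limit f (cis t) (rl f t).

Lemma hp_ant s f : 1 < s -> hp s f -> ant f.
Proof. by move=> s1 /(hp_rl s1)[]. Qed.

Lemma rlD f g : ant f -> ant g -> \forall t \ae m,
  rl (fun z => f z + g z) t = rl f t + rl g t.
Proof. by apply: filterS2 => t nf ng; apply: rlE; exact: ntD. Qed.

Lemma rlM f g : ant f -> ant g -> \forall t \ae m,
  rl (fun z => f z * g z) t = rl f t * rl g t.
Proof. by apply: filterS2 => t nf ng; apply: rlE; exact: ntM. Qed.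

Lemma rlZ (c : C) f : ant f -> \forall t \ae m, rl (fun z => c * f z) t = c * rl f t.
Proof.
by apply: filterS => t nf; apply: rlE; have H := ntM (@nt_cst R c t) nf; exact H.
Qed.

Lemma antM f g : ant f -> ant g -> ant (fun z => f z * g z).
Proof.
by move=> af ag; apply: filterS3 af ag (rlM af ag) => t nf ng ->; exact: ntM.
Qed.

Lemma pint_le_ae p u w : 0 <= p -> cmeas u -> cmeas w ->
  (\forall t \ae m, N (u t) <= N (w t)) -> (pint p u <= pint p w)%E.
Proof.
move=> p0 mu mw uw; apply: eint_le_ae; try exact: cmeas_Npow;
  try (by move=> t; exact: powR_ge0).
by apply: filterS uw => t uw; apply: le_powR => //; exact: N_ge0.
Qed.

Variable th : C -> C.
Hypothesis ith : inner th.

Lemma th_hp2 : hp 2 th. Proof. by case: ith => /hardyy_hp2. Qed.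

Lemma th_diff z : N z < 1 -> cdiff th z. Proof. by case: th_hp2 => + _ _; apply. Qed.

Lemma th_ant : ant th. Proof. exact: hp_ant (ltr1n _ 2) th_hp2. Qed.

Lemma th_meas : cmeas (rl th : T -> C).
Proof. by have [_ [] ] := hp_rl (ltr1n _ 2) th_hp2. Qed.

Lemma th_unim : \forall t \ae m, N (rl th t) = 1.
Proof.
case: ith => _; apply: filterS2 (hp_boundary (ltr1n _ 2) th_hp2) => t -> /eqP.
by rewrite normE (_ : (1 : C) = (1 : R)%:C)// => /eqP[].
Qed.

(** The maximum principle, read off from the Poisson integral of a unimodular function. *)
Lemma th_le1 z : N z < 1 -> N (th z) <= 1.
Proof.
move=> hz; have [_ L2 _ c _] := hp_rl (ltr1n R 2) th_hp2.
have [_ <-] := c z hz.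
have r1 : cL1 (rl th) by apply: (Lp_cL1 _ L2); rewrite ler1n.
rewrite -lee_fin; apply: (le_trans (le_cint_eint (cL1_pk hz r1))).
rewrite -(eint_pk hz); apply: eint_le_ae.
- by apply: cmeas_N; apply: cL1_meas; exact: cL1_pk.
- exact: pk_meas.
- by move=> t; exact: N_ge0.
- by move=> t; exact: pk_ge0.
- by apply: filterS th_unim => t h; rewrite NM h mulr1 NR ger0_norm// pk_ge0.
Qed.

Lemma thM_hp s f : 0 <= s -> hp s f -> hp s (fun z => th z * f z).
Proof. by move=> s0; apply: hp_bndM => // z hz; [exact: th_diff|exact: th_le1]. Qed.

(** The measurable [rl] replaces [boundary]; for [s > 1] this is [model_space], by [KpP]. *)
Definition Kp s f := hp s f /\ exists h, [/\ hp s h, h 0 = 0 &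
  \forall t \ae m, rl f t = rl th t * cj (rl h t)].

Lemma KpP s f : 1 < s -> model_space s%:E th f <-> Kp s f.
Proof.
move=> s1; have s0 : 0 < s by exact: lt_trans s1.
have bd h : hp s f -> hp s h -> \forall t \ae m,
    [/\ boundary f t = rl f t, boundary h t = rl h t & boundary th t = rl th t].
  move=> hf hh; apply: filterS3 (hp_boundary s1 hf) (hp_boundary s1 hh)
    (hp_boundary (ltr1n _ 2) th_hp2) => t h1 h2 h3; by split.
split=> -[].
  move=> /(hardyP _ s0) hf [h [/(hardyP _ s0) hh h0 E]]; split => //; exists h; split => //.
  by apply: filterS2 E (bd h hf hh) => t Et [e1 e2 e3]; rewrite -e1 -e2 -e3 Et.
move=> hf [h [hh h0 E]]; split; first exact/hardyP.
exists h; split => //; first exact/hardyP.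
by apply: filterS2 E (bd h hf hh) => t + [-> -> ->].
Qed.

(** The boundary identities are checked at an exponent [s > 1], where [hp_boundary] applies, and
    only the conclusion descends to 1. *)
Lemma model1 s f h : 1 < s -> hp s f -> hp s h -> h 0 = 0 ->
  (\forall t \ae m, rl f t = rl th t * rl th t * cj (rl h t)) ->
  model_space 1%E (th \* th) f.
Proof.
move=> s1 hf hh h0 E; have le1 g : hp s g -> hardy 1%E g.
  by move=> hg; exact: ((hardyP g ltr01).2 (hp_mono ler01 (ltW s1) hg)).
split; first exact: le1.
exists h; split => //; first exact: le1.
have thth : \forall t \ae m, boundary (th \* th) t = rl th t * rl th t.
  by apply: filterS th_ant => t nt; apply: boundaryE; exact: ntM.
have bd : \forall t \ae m, boundary f t = rl f t /\ boundary h t = rl h t.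
  by apply: filterS2 (hp_boundary s1 hf) (hp_boundary s1 hh).
by apply: filterS3 E thth bd => t + -> [-> ->].
Qed.

Lemma th_conj : \forall t \ae m, rl th t * cj (rl th t) = 1.
Proof. by apply: filterS th_unim => t h; rewrite mul_conj h expr1n. Qed.

(** From [f = theta conj h] follows [f = theta^2 conj (theta h)]. *)
Lemma Kp_E s f : 1 < s -> Kp s f -> model_space 1%E (th \* th) f.
Proof.
move=> s1 [hf [h [hh h0 E]]]; have s0 : 0 <= s by rewrite ltW// (lt_trans _ s1).
apply: (model1 s1 hf (thM_hp s0 hh)); first by rewrite h0 mulr0.
apply: filterS3 E th_conj (rlM th_ant (hp_ant s1 hh)) => t -> c ->.
by rewrite conjM mulrA -[_ * rl th t * _]mulrA c mulr1.
Qed.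

(** Here [theta f = theta^2 conj h]: one multiplication by [theta] stays in the domain of the
    operator. *)
Lemma Kp_thE s f : 1 < s -> Kp s f -> model_space 1%E (th \* th) (th \* f).
Proof.
move=> s1 [hf [h [hh h0 E]]]; have s0 : 0 <= s by rewrite ltW// (lt_trans _ s1).
apply: (model1 s1 (thM_hp s0 hf) hh h0).
by apply: filterS2 E (rlM th_ant (hp_ant s1 hf)) => t E1 ->; rewrite E1 mulrA.
Qed.

(** Squaring [theta conj h] yields [theta^2 conj (h^2)], which is why the operator lives over the
    squared inner function. *)
Lemma Kp_sqE s f : 1 < s -> Kp (2 * s) f -> model_space 1%E (th \* th) (f \* f).
Proof.
move=> s1 [hf [h [hh h0 E]]]; have s2 : 1 < 2 * s by lra.
apply: (model1 s1 (hp_sq (ltW s1) hf) (hp_sq (ltW s1) hh)); first by rewrite h0 mulr0.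
have af := hp_ant s2 hf; have ah := hp_ant s2 hh.
apply: filterS3 E (rlM af af) (rlM ah ah) => t E1 -> ->.
by rewrite E1 conjM; ring.
Qed.

Lemma Kp_mono s s' f : 1 < s' -> s' <= s -> Kp s f -> Kp s' f.
Proof.
move=> s1 ss [hf [h [hh h0 E]]]; have s0 : 0 <= s' by rewrite ltW// (lt_trans _ s1).
split; first exact: (hp_mono s0 ss hf).
exists h; split; [exact: (hp_mono s0 ss hh)|exact: h0|exact: E].
Qed.

Lemma KpZ s c f : 1 < s -> Kp s f -> Kp s (fun z => c * f z).
Proof.
move=> s1 [hf [h [hh h0 E]]]; have s0 : 0 <= s by rewrite ltW// (lt_trans _ s1).
split; first exact: hpZ; exists (fun z => cj c * h z); split; first exact: hpZ.
  by rewrite h0 mulr0.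
apply: filterS3 E (rlZ c (hp_ant s1 hf)) (rlZ (cj c) (hp_ant s1 hh)) => t E1 -> ->.
by rewrite E1 conjM conjKc; ring.
Qed.

Definition Qth w := dx (cauchy (fun t => cj (rl th t) * rl (dx (cauchy w)) t)).
(** The Riesz projection onto the model space: [A - theta A'], where [A] and [A'] are
    the analytic parts of [w] and of [conj theta A]. *)
Definition Pth w z := dx (cauchy w) z + (-1) * (th z * Qth w z).

(** [Qth] takes two successive Riesz projections, hence the factor [K^2]; multiplications by [theta]
    and its conjugate preserve moduli on the circle. *)
Lemma Pth_spec s : 1 < s -> exists2 K : R, 0 <= K & forall w (L : R), 0 < L -> cmeas w ->
  (pint s w <= L%:E)%E -> [/\ hp s (dx (cauchy w)), hp s (Qth w),
    Lp s (fun t => cj (rl th t) * rl (dx (cauchy w)) t),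
    (pint s (rl (Qth w)) <= (K * L)%:E)%E & (pint s (rl (Pth w)) <= (K * L)%:E)%E].
Proof.
move=> s1; have s0 : 0 <= s by rewrite ltW// (lt_trans _ s1).
have [K1 K10 HK1] := riesz s1.
(* Made positive because the second projection starts from the bound [K * L], which has to be
   positive. *)
pose K := K1 + 1; have K0 : 0 < K by rewrite ltr_wpDl.
have HK r : 0 <= r < 1 -> bounded_at m (fun w t => N (cauchy w (r%:C * cis t))) s s K.
  by move=> r1 w mw w1; apply: (le_trans (HK1 r r1 w mw w1)); rewrite lee_fin lerDl.
pose K' := K * K + 2 `^ s * (K + K * K).
have KK0 : 0 <= K * K by rewrite mulr_ge0 ?ltW.
have K20 : 0 <= 2 `^ s * (K + K * K).
  by apply: mulr_ge0; [exact: powR_ge0|apply: addr_ge0 => //; exact: ltW].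
have K'0 : 0 <= K' by exact: addr_ge0.
exists K' => // w L L0 mw wL.
have [hA AL] := hp_cauchy s1 HK (ltW K0) L0 mw wL.
have mth := cmeas_conj th_meas.
have [_ [mA Ai] _ _ _] := hp_rl s1 hA.
pose u t := cj (rl th t) * rl (dx (cauchy w)) t.
have mu : cmeas u by exact: cmeasM.
have uL : (pint s u <= (K * L)%:E)%E.
  apply: le_trans AL; apply: pint_le_ae => //.
  by apply: filterS th_unim => t h; rewrite /u NM Nconj h mul1r.
have KL0 : 0 < K * L by rewrite mulr_gt0.
have Lu : Lp s u by split; [exact: mu|rewrite (le_lt_trans uL)// ltry].
have [hQ QL] := hp_cauchy s1 HK (ltW K0) KL0 mu uL.
have {}QL : (pint s (rl (Qth w)) <= (K * K * L)%:E)%E by rewrite -mulrA.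
have hP : hp s (Pth w) by apply: hpD (ltW s1) hA (hpZ _ s0 (thM_hp s0 hQ)).
split; [exact: hA|exact: hQ|exact: Lu| |].
  by apply: (le_trans QL); rewrite lee_fin ler_wpM2r ?(ltW L0)// lerDl; exact: K20.
have [_ [mP _] _ _ _] := hp_rl s1 hP; have [_ [mQ _] _ _ _] := hp_rl s1 hQ.
have mthQ : cmeas (fun t => (-1) * (rl th t * rl (Qth w) t)).
  by apply: cmeasM; [exact: cmeas_cst|apply: cmeasM => //; exact: th_meas].
apply: (@le_trans _ _ (pint s (fun t => rl (dx (cauchy w)) t +
    (-1) * (rl th t * rl (Qth w) t))%R)).
  apply: pint_le_ae => //; first exact: cmeasD.
  have aA := hp_ant s1 hA; have aQ := hp_ant s1 hQ.
  have atQ := antM th_ant aQ.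
  have athQ : ant (fun z => (-1) * (th z * Qth w z)).
    by apply: hp_ant s1 _; exact: hpZ s0 (thM_hp s0 hQ).
  by apply: filterS3 (rlD aA athQ) (rlZ (-1) atQ) (rlM th_ant aQ) => t -> -> ->.
apply: (le_trans (pintD s0 mA mthQ)).
have tQ : (pint s (fun t => (-1) * (rl th t * rl (Qth w) t))%R <= (K * K * L)%:E)%E.
  apply: le_trans QL; apply: pint_le_ae => //.
  by apply: filterS th_unim => t h; rewrite NM NN N1 mul1r NM h mul1r.
apply: (@le_trans _ _ ((2 `^ s)%:E * (K * L + K * K * L)%:E)%E).
  apply: lee_wpmul2l; first by rewrite lee_fin powR_ge0.
  by rewrite EFinD; apply: leeD; [exact: AL|exact: tQ].
rewrite -EFinM lee_fin -mulrDl mulrA ler_wpM2r ?(ltW L0)// /K' lerDr.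
exact: KK0.
Qed.

(** Splitting [conj theta A = A' + conj B] with [B 0 = 0] gives [A - theta A' = theta conj B] on the
    circle. *)
Lemma Pth_K s w : 1 < s -> Lp s w -> Kp s (Pth w).
Proof.
move=> s1 Lw; have s0 : 0 <= s by rewrite ltW// (lt_trans _ s1).
have [K K0 HK] := Pth_spec s1; have [L L0 wL] := pint_fin Lw.
have [hA hQ Lu _ _] := HK w L L0 Lw.1 wL.
have [B [_ hB B0 EB]] := riesz_split s1 Lu.
split; first by apply: hpD (ltW s1) hA (hpZ _ s0 (thM_hp s0 hQ)).
exists B; split => //.
have aA := hp_ant s1 hA; have aQ := hp_ant s1 hQ.
have atQ := antM th_ant aQ.
have athQ : ant (fun z => (-1) * (th z * Qth w z)).
  by apply: hp_ant s1 _; exact: hpZ s0 (thM_hp s0 hQ).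
have E1 : \forall t \ae m, rl (Pth w) t =
    rl (dx (cauchy w)) t + (-1) * (rl th t * rl (Qth w) t).
  by apply: filterS3 (rlD aA athQ) (rlZ (-1) atQ) (rlM th_ant aQ) => t -> -> ->.
apply: filterS3 E1 EB th_conj => t -> EBt c.
rewrite -/(Qth w) in EBt.
have -> : cj (rl B t) = cj (rl th t) * rl (dx (cauchy w)) t - rl (Qth w) t.
  by rewrite EBt addrC addKr.
by rewrite mulrBr mulN1r [in RHS]mulrA c mul1r.
Qed.

Lemma cauchy_rl s f : 1 < s -> hp s f -> dx (cauchy (rl f)) = f.
Proof.
move=> s1 hf; have [_ _ _ c _] := hp_rl s1 hf; case: hf => _ f0 _.
apply/funext => z; have [hz|hz] := pselect (N z < 1); last by rewrite dx0// f0.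
by rewrite dxE//; have [] := c z hz.
Qed.

(** For [f = theta conj h] the function [conj theta f] is [conj h], whose analytic part is the
    constant [conj (h 0) = 0]. *)
Lemma Pth_id s f : 1 < s -> Kp s f -> Pth (rl f) = f.
Proof.
move=> s1 [hf [h [hh h0 E]]].
have Ef := cauchy_rl s1 hf.
have [_ [mh _] _ _ ch] := hp_rl s1 hh; have [_ Lh _ _ _] := hp_rl s1 hh.
have [_ [mf _] _ _ _] := hp_rl s1 hf.
have Q0 : Qth (rl f) = fun=> 0.
  apply/funext => z; have [hz|hz] := pselect (N z < 1); last by rewrite /Qth dx0.
  rewrite /Qth dxE// Ef (@cauchy_ae _ _ (fun t => cj (rl h t)))//.
  - by rewrite ch// h0 conj0.
  - by apply: cmeasM => //; exact: cmeas_conj th_meas.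
  - apply: filterS2 E th_conj => t -> c.
    by rewrite mulrA [_ * rl th t]mulrC c mul1r.
  - by apply: cL1_conj; exact: Lp_cL1 (ltW s1) Lh.
by apply/funext => z; rewrite /Pth Q0 Ef !mulr0 addr0.
Qed.

Lemma dxD f g : dx (fun z => f z + g z) = (fun z => dx f z + dx g z).
Proof. by apply/funext => z; rewrite /dx; case: ifP => // _; rewrite addr0. Qed.

Lemma dx_ext f g : (forall z, N z < 1 -> f z = g z) -> dx f = dx g.
Proof. by move=> fg; apply/funext => z; rewrite /dx; case: ifP => // hz; exact: fg. Qed.

Lemma dcauchyD u w : cL1 u -> cL1 w -> dx (cauchy (fun t => u t + w t)) =
  (fun z => dx (cauchy u) z + dx (cauchy w) z).
Proof. by move=> u1 w1; rewrite -dxD; apply: dx_ext => z hz; exact: cauchyD. Qed.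

Lemma dcauchyZ (c : C) w : cL1 w -> dx (cauchy (fun t => c * w t)) =
  (fun z => c * dx (cauchy w) z).
Proof.
move=> w1; apply/funext => z; rewrite /dx; case: ifP => hz; last by rewrite mulr0.
exact: cauchyZ.
Qed.

Lemma Qth_facts s w : 1 < s -> Lp s w -> [/\ cL1 w, ant (dx (cauchy w)) &
  cL1 (fun t => cj (rl th t) * rl (dx (cauchy w)) t)].
Proof.
move=> s1 Lw; have [K K0 HK] := Pth_spec s1; have [L L0 wL] := pint_fin Lw.
have [hA hQ Lu _ _] := HK w L L0 Lw.1 wL.
split; [exact: Lp_cL1 (ltW s1) Lw|exact: hp_ant s1 hA|exact: Lp_cL1 (ltW s1) Lu].
Qed.

Lemma PthD s u w : 1 < s -> Lp s u -> Lp s w ->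
  Pth (fun t => u t + w t) = Pth u \+ Pth w.
Proof.
move=> s1 Lu Lw; have [u1 au bu] := Qth_facts s1 Lu; have [w1 aw bw] := Qth_facts s1 Lw.
have s0 : 0 <= s by rewrite ltW// (lt_trans _ s1).
have [_ _ [mb _]] := Qth_facts s1 (LpD s0 Lu Lw).
have [_ _ b] := Qth_facts s1 (LpD s0 Lu Lw).
have QD : Qth (fun t => u t + w t) = (fun z => Qth u z + Qth w z).
  rewrite -[RHS](dcauchyD bu bw); apply: dx_ext => z hz.
  apply: cauchy_ae => //; [exact: cL1_meas b| |exact: cL1D].
  rewrite dcauchyD//; apply: filterS (rlD au aw) => t ->.
  by rewrite mulrDr.
apply/funext => z; transitivity (Pth u z + Pth w z); last by [].
rewrite /Pth QD dcauchyD//; move: (dx _ z) (dx _ z) (Qth u z) (Qth w z) (th z).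
by move=> a1 a2 a3 a4 a5; ring.
Qed.

Lemma PthZ s (c : C) w : 1 < s -> Lp s w ->
  Pth (fun t => c * w t) = (fun z => c * Pth w z).
Proof.
move=> s1 Lw; have [w1 aw bw] := Qth_facts s1 Lw.
have s0 : 0 <= s by rewrite ltW// (lt_trans _ s1).
have [_ _ b] := Qth_facts s1 (LpZ c s0 Lw).
have QZ : Qth (fun t => c * w t) = (fun z => c * Qth w z).
  rewrite -[RHS](dcauchyZ c bw); apply: dx_ext => z hz.
  apply: cauchy_ae => //; [exact: cL1_meas b| |exact: cL1Z].
  rewrite dcauchyZ//; apply: filterS (rlZ c aw) => t ->.
  by rewrite mulrCA.
apply/funext => z; rewrite /Pth QZ dcauchyZ//; move: (dx _ z) (Qth w z) (th z).
by move=> a1 a2 a3; ring.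
Qed.

(** The point is that [A' = Qth w] lies in the model space too: from [conj theta f^2 = A' + conj B]
    and [f^2 = theta^2 conj (h^2)] one gets [A' = theta conj (h^2 - theta B)]. *)
Lemma Kp_square s : 1 < s -> exists2 K : R, 0 <= K & forall f, Kp (2 * s) f ->
  (pint (2 * s) (rl f) <= 1)%E -> exists g h2, [/\ Kp s g, Kp s h2,
    (pint s (rl g) <= K%:E)%E, (pint s (rl h2) <= K%:E)%E &
    f \* f = g \+ (th \* h2)].
Proof.
move=> s1; have [K K0 HK] := Pth_spec s1; exists K => // f Kf f1.
have s0 : 0 <= s by rewrite ltW// (lt_trans _ s1).
have s2 : 1 < 2 * s by lra.
case: Kf => hf [h [hh h0 E]].
have hff := hp_sq (ltW s1) hf; have hhh := hp_sq (ltW s1) hh.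
pose F z := f z * f z; pose w := rl F.
have [_ Lw _ _ _] := hp_rl s1 hff.
have [_ [mf _] _ _ _] := hp_rl s2 hf.
have af := hp_ant s2 hf; have ah := hp_ant s2 hh.
have wE : \forall t \ae m, w t = rl f t * rl f t := rlM af af.
have w1 : (pint s w <= 1)%E.
  apply: le_trans f1; rewrite (pint_ae s Lw.1 (cmeasM mf mf) wE).
  rewrite le_eqVlt; apply/orP; left; apply/eqP; apply: eq_integral => t _.
  by rewrite NM powRM ?N_ge0// powRM2 ?N_ge0.
have [hA hQ Lu QK PK] := HK w 1 ltr01 Lw.1 w1; rewrite mulr1 in QK PK.
have AE : dx (cauchy w) = F by exact: cauchy_rl s1 hff.
have {}Lw : Lp s w by exact: Lw.
have wF : rl F = w by [].
clearbody w.
exists (Pth w), (Qth w); split; [exact: Pth_K| |exact: PK|exact: QK|].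
- have [B [_ hB B0 EB]] := riesz_split s1 Lu; rewrite -/(Qth w) in EB.
  split; first exact: hQ.
  exists (fun z => h z * h z + (-1) * (th z * B z)).
  have htB := thM_hp s0 hB; have hntB := hpZ (-1) s0 htB.
  split; [exact: hpD (ltW s1) hhh hntB|by rewrite h0 B0 !mulr0 addr0|].
  have aB := hp_ant s1 hB.
  have E1 : \forall t \ae m, rl (fun z => h z * h z + (-1) * (th z * B z)) t =
      rl h t * rl h t + (-1) * (rl th t * rl B t).
    have ahh := hp_ant s1 hhh; have antB := hp_ant s1 hntB.
    have E2 : \forall t \ae m, rl (fun z => (-1) * (th z * B z)) t =
        (-1) * (rl th t * rl B t).
      by apply: filterS2 (rlZ (-1) (hp_ant s1 htB)) (rlM th_ant aB) => t -> ->.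
    by apply: filterS3 (rlD ahh antB) (rlM ah ah) E2 => t -> -> ->.
  have E3 : \forall t \ae m, rl (Qth w) t =
      cj (rl th t) * (rl f t * rl f t) - cj (rl B t).
    apply: filterS2 EB wE => t; rewrite AE wF => EBt <-.
    by rewrite EBt addrK.
  have E4 : \forall t \ae m, rl f t = rl th t * cj (rl h t) /\
      rl th t * cj (rl th t) = 1 by apply: filterS2 E th_conj.
  apply: filterS3 E1 E3 E4 => t -> -> [-> c].
  rewrite conjD !conjM conjN conj1.
  move: (rl th t) (cj (rl th t)) c (cj (rl h t)) (cj (rl B t)) => a a' c x y.
  rewrite (_ : a' * (a * x * (a * x)) - y = a * (a * a' * (x * x)) - y); last by ring.
  rewrite c mul1r (_ : a * (x * x + -1 * (a' * y)) = a * (x * x) - (a * a') * y); last by ring.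
  by rewrite c mul1r.
- apply/funext => z; transitivity (Pth w z + th z * Qth w z); last by [].
  by rewrite /Pth AE /F mulN1r subrK.
Qed.

End model.

(** * Solid sublinear operators *)

Section operator.
Context {R : realType}.
Notation C := R[i].
Notation TT := (measurableTypeR R).
Local Notation m := (circle_measure R).
Context d (X : measurableType d) (mu : {measure set X -> \bar R}).
Variables (th : C -> C) (X1 : base_set) (T : (C -> C) -> X -> C).
Implicit Types (f g h : C -> C) (s rho L : R).
Hypothesis ith : inner th.
Notation E := (model_space 1%E (th \* th)).
Hypothesis HT0 : maps_to_L0 E T.
Hypothesis HTs : sublinear mu E T.
Hypothesis HTo : solid mu X1 E T.

Definition NT f x : R := N (T f x).

Lemma NT_ge0 f x : 0 <= NT f x. Proof. exact: N_ge0. Qed.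

Lemma NT_meas f : E f -> measurable_fun setT (NT f).
Proof. by move=> Ef; apply: cmeas_N; exact: HT0. Qed.

Lemma NT_measX f (q : R) : E f -> measurable_fun setT (fun x => NT f x `^ q).
Proof. by move=> Ef; apply: (measurableT_comp (@measurable_powR R _)); exact: NT_meas. Qed.

Lemma NT_add f g : E f -> E g -> \forall x \ae mu, NT (f \+ g) x <= NT f x + NT g x.
Proof.
move=> Ef Eg; apply: filterS (HTs.1 f g Ef Eg) => x.
by rewrite !normE -rmorphD lecR.
Qed.

Lemma NT_scale (c : C) f : E f -> \forall x \ae mu, NT (fun z => c * f z) x = N c * NT f x.
Proof.
move=> Ef; apply: filterS (HTs.2 c f Ef) => x.
by rewrite !normE -rmorphM => -[].
Qed.

Lemma NT_sq : exists2 g : R, 0 < g & forall f, E f -> E (f \* f) ->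
  \forall x \ae mu, NT f x ^+ 2 <= g * NT (f \* f) x.
Proof.
case: HTo => -[g g0 H] _; exists g => // f Ef Eff; apply: filterS (H f Ef Eff) => x.
by rewrite !normE -rmorphXn -rmorphM lecR.
Qed.

(** [f] dominates [theta f] for either base set: on the disk by the maximum principle, on the circle
    by unimodularity. *)
Lemma NT_th s f : 1 < s -> Kp th s f -> \forall x \ae mu, NT (th \* f) x <= NT f x.
Proof.
move=> s1 Kf; case: HTo => _ H.
have : dominated X1 (th \* f) f.
  case: X1 => /=.
    move=> z; rewrite Nlt1 => hz; rewrite !normE lecR NM ler_piMl ?N_ge0//.
    exact: th_le1.
  have hf := Kf.1; have af := hp_ant s1 hf.
  apply: filterS3 (th_unim ith) (filterI (th_ant ith) af) (hp_boundary s1 hf).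
  move=> t t1 [nt nf] ->; rewrite (boundaryE (ntM nt nf)) !normE lecR NM t1.
  by rewrite mul1r.
move=> /(H _ _ (Kp_thE ith s1 Kf) (Kp_E ith s1 Kf)); apply: filterS => x.
by rewrite !normE lecR.
Qed.

(** The counterpart of [bounded_at] on the model space; [rho] is kept apart because it stays fixed
    while [s] varies. *)
Definition Bnd rho s (A : R) := forall f, Kp th s f -> (pint s (rl f) <= 1)%E ->
  (eint mu (fun x => NT f x `^ (rho * s))%R <= A%:E)%E.

Lemma Bnd_scale rho s A f L : 1 < s -> 0 < rho -> Bnd rho s A -> Kp th s f -> 0 < L ->
  (pint s (rl f) <= L%:E)%E ->
  (eint mu (fun x => NT f x `^ (rho * s))%R <= (L `^ rho * A)%:E)%E.
Proof.
move=> s1 rho0 HA Kf L0 fL; have s0 : 0 < s by exact: lt_trans s1.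
pose l := L `^ (- s^-1); have l0 : 0 < l by rewrite powR_gt0.
have Nl : N (l%:C : C) = l by rewrite NR gtr0_norm.
have ls : l `^ s = L^-1.
  by rewrite /l -powRrM mulNr mulVf ?gt_eqF// powR_inv1// ltW.
have Klf := KpZ l%:C s1 Kf.
have af := hp_ant s1 Kf.1.
have [_ [mlf _] _ _ _] := hp_rl s1 Klf.1; have [_ [mf _] _ _ _] := hp_rl s1 Kf.1.
have E1 : pint s (rl (fun z => l%:C * f z)) = (L^-1%:E * pint s (rl f))%E.
  rewrite (@pint_ae _ s _ (fun t => l%:C * rl f t) mlf); [|by apply: cmeasM => //; exact: cmeas_cst|exact: rlZ].
  by rewrite pintZ ?(ltW s0)// Nl ls.
have := HA _ Klf; rewrite E1 lee_pdivrMl// mule1 => /(_ fL).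
have Ef := Kp_E ith s1 Kf; have Elf := Kp_E ith s1 Klf.
have -> : eint mu (fun x => NT (fun z => l%:C * f z) x `^ (rho * s)) =
    eint mu (fun x => l `^ (rho * s) * NT f x `^ (rho * s)).
  apply: eint_eq_ae.
  - exact: NT_measX.
  - by apply: measurable_funM => //; exact: NT_measX.
  - by move=> x; exact: powR_ge0.
  - by move=> x; rewrite mulr_ge0 ?powR_ge0.
  - by apply: filterS (NT_scale l%:C Ef) => x ->; rewrite Nl powRM ?NT_ge0// ltW.
rewrite eintZ ?powR_ge0//; [|exact: NT_measX|by move=> x; exact: powR_ge0].
have -> : l `^ (rho * s) = (L `^ rho)^-1.
  by rewrite mulrC powRrM ls -powR_inv1 ?(ltW L0)// -powRrM mulN1r powRN.
by rewrite lee_pdivrMl ?powR_gt0// EFinM.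
Qed.

Lemma Bnd_double rho s A : 1 < s -> 0 < rho -> 0 <= A -> Bnd rho s A ->
  exists2 A' : R, 0 <= A' & Bnd rho (2 * s) A'.
Proof.
move=> s1 rho0 A0 HA; have s0 : 0 < s by exact: lt_trans s1.
have [K K0 HK] := Kp_square ith s1; have [ga ga0 Hsq] := NT_sq.
have s2 : 1 < 2 * s by lra.
pose L := K + 1; have L0 : 0 < L by rewrite ltr_wpDl.
pose q := rho * s; have q0 : 0 < q by rewrite mulr_gt0.
pose c := ga `^ q * 2 `^ q; have c0 : 0 <= c by rewrite mulr_ge0 ?powR_ge0.
pose B := L `^ rho * A; have B0 : 0 <= B by rewrite mulr_ge0 ?powR_ge0.
exists (c * (B + B)); first by rewrite mulr_ge0 ?addr_ge0.
move=> f Kf f1; have [g [h2 [Kg Kh gK hK ff]]] := HK f Kf f1.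
have KL : (K%:E <= L%:E)%E by rewrite lee_fin lerDl.
have gB := Bnd_scale s1 rho0 HA Kg L0 (le_trans gK KL).
have hB := Bnd_scale s1 rho0 HA Kh L0 (le_trans hK KL).
have Ef := Kp_E ith s2 Kf; have Eff := Kp_sqE ith s1 Kf.
have Eg := Kp_E ith s1 Kg; have Eh := Kp_E ith s1 Kh; have Eth := Kp_thE ith s1 Kh.
apply: (@le_trans _ _ (eint mu (fun x => c * (NT g x `^ q + NT h2 x `^ q))%R)); last first.
  rewrite eintZ//; last 2 first.
  - by apply: measurable_funD; exact: NT_measX.
  - by move=> x; rewrite addr_ge0 ?powR_ge0.
  rewrite eintD; [|exact: NT_measX|exact: NT_measX|by move=> x; exact: powR_ge0|
    by move=> x; exact: powR_ge0].
  rewrite [leRHS]EFinM; apply: lee_wpmul2l; first by rewrite lee_fin.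
  by rewrite (EFinD B); apply: leeD; [exact: gB|exact: hB].
apply: eint_le_ae.
- exact: NT_measX.
- by apply: measurable_funM => //; apply: measurable_funD; exact: NT_measX.
- by move=> x; exact: powR_ge0.
- by move=> x; rewrite mulr_ge0 ?addr_ge0 ?powR_ge0.
have := NT_add Eg Eth; rewrite -ff => Hadd.
apply: filterS3 (Hsq f Ef Eff) Hadd (NT_th s1 Kh) => x h1 h3 h4.
(* [|T f|^{2 q}] is the [q]-th power of the quantity that solidity bounds. *)
rewrite (_ : rho * (2 * s) = 2 * q); last by rewrite /q; ring.
rewrite mulrC powRrM powR_mulrn ?powR_ge0// -powR_mulrn ?powR_ge0//.
rewrite -powRrM mulrC powRrM powR_mulrn ?NT_ge0//.
apply: (@le_trans _ _ ((ga * (NT g x + NT h2 x)) `^ q)).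
  apply: le_powR; [exact: ltW|exact: sqr_ge0|].
  by apply: (le_trans h1); rewrite ler_wpM2l ?(ltW ga0)// (le_trans h3)// lerD2l.
rewrite powRM ?(ltW ga0) ?addr_ge0 ?NT_ge0// /c -mulrA ler_wpM2l ?powR_ge0//.
by apply: powRD_le; rewrite ?NT_ge0// ltW.
Qed.

Lemma Bnd_pow2 rho s A n : 1 < s -> 0 < rho -> 0 <= A -> Bnd rho s A ->
  exists2 A' : R, 0 <= A' & Bnd rho (2 ^+ n * s) A'.
Proof.
move=> s1 rho0 A0 HA; elim: n => [|n [A' A'0 ih]]; first by exists A; rewrite ?expr0 ?mul1r.
rewrite exprS -mulrA; apply: Bnd_double ih => //.
by rewrite (lt_le_trans s1)// ler_peMl ?exprn_ege1 ?ler1n// ltW// (lt_trans _ s1).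
Qed.

(** Linearity of [Pth] extends sublinearity from the model space to the whole of [L^s]. *)
Lemma Pth_sublin s : 1 < s -> sublin mu s (fun w => NT (Pth th w)).
Proof.
move=> s1; have EP w : Lp s w -> E (Pth th w).
  by move=> Lw; exact: (Kp_E ith s1 (Pth_K ith s1 Lw)).
split.
- by move=> w Lw; apply: NT_meas; exact: EP.
- by move=> w x; exact: NT_ge0.
- by move=> u w Lu Lw; rewrite (PthD ith s1 Lu Lw); apply: NT_add; exact: EP.
- move=> c w Lw; rewrite (PthZ ith c%:C s1 Lw); apply: filterS (NT_scale c%:C (EP w Lw)) => x.
  by rewrite NR.
Qed.

Lemma Pth_bounded rho s A : 1 < s -> 0 < rho -> 0 <= A -> Bnd rho s A ->
  exists2 A' : R, 0 <= A' & bounded_at mu (fun w => NT (Pth th w)) s (rho * s) A'.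
Proof.
move=> s1 rho0 A0 HA; have [K K0 HK] := Pth_spec ith s1.
have K1 : 0 < K + 1 by rewrite ltr_wpDl.
exists ((K + 1) `^ rho * A); first by rewrite mulr_ge0 ?powR_ge0.
move=> w mw w1; have Lw : Lp s w by split; [exact: mw|rewrite (le_lt_trans w1)// ltry].
have [_ _ _ _ PK] := HK w 1 ltr01 mw w1.
apply: (Bnd_scale s1 rho0 HA (Pth_K ith s1 Lw) K1).
by apply: (le_trans PK); rewrite lee_fin mulr1 lerDl.
Qed.

(** [Pth_id] recovers [f] from its boundary function, so the interpolated bound for the composition
    with the projection restricts to the model space. *)
Lemma Bnd_all rho s A p : 1 < s -> 0 < rho -> 1 <= rho * s -> 0 <= A -> Bnd rho s A ->
  s < p -> exists2 A' : R, 0 <= A' & Bnd rho p A'.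
Proof.
move=> s1 rho0 rs A0 HA sp; have s0 : 0 < s by exact: lt_trans s1.
have [n np pn] : exists2 n, 2 ^+ n * s <= p & p < 2 ^+ n.+1 * s.
  have H : exists n, p < 2 ^+ n.+1 * s.
    exists (Num.bound p); apply: (@lt_le_trans _ _ (2 ^+ (Num.bound p).+1)); last first.
      by rewrite ler_peMr ?exprn_ge0// ltW.
    rewrite (lt_trans (archi_boundP (ltW (lt_trans s0 sp))))// -natrX ltr_nat.
    by apply: (leq_trans (ltn_expl _ (isT : (1 < 2)%N))); rewrite leq_pexp2l.
  case: (ex_minnP H) => -[|n] pn minn.
    by exists 0%N => //; rewrite expr0 mul1r ltW.
  by exists n.+1 => //; rewrite leNgt; apply/negP => /minn; rewrite ltnn.
have big k : s <= 2 ^+ k * s by rewrite ler_peMl ?exprn_ege1 ?ler1n// ltW.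
have big1 k : 1 < 2 ^+ k * s by exact: lt_le_trans (big k).
have [A1 A10 H1] := Bnd_pow2 n s1 rho0 A0 HA.
have [A2 A20 H2] := Bnd_pow2 n.+1 s1 rho0 A0 HA.
move: np; rewrite le_eqVlt => /predU1P[<-|np]; first by exists A1.
have [B1 B10 HB1] := Pth_bounded (big1 n) rho0 A10 H1.
have [B2 B20 HB2] := Pth_bounded (big1 n.+1) rho0 A20 H2.
have q0 : 0 < 2 ^+ n * s by rewrite mulr_gt0 ?exprn_gt0.
have rq : 1 <= rho * (2 ^+ n * s).
  by rewrite (le_trans rs)// ler_wpM2l ?(ltW rho0)// big.
have [K K0 HK] := interpolation q0 np pn rho0 rq B10 B20.
exists K; first exact: K0.
move=> f Kf f1; have p1 : 1 < p by exact: lt_trans sp.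
have := HK _ _ _ _ (Pth_sublin (big1 n)) HB1 HB2 (rl f).
rewrite (Pth_id ith p1 Kf); apply => //.
by have [_ [mf _] _ _ _] := hp_rl p1 Kf.1.
Qed.

(** The given constant may be negative, hence the maximum with [0] before a power is taken. *)
Lemma Bnd_of_maps rho s (C0 : R) : 1 < s -> 0 < rho * s ->
  (forall f, model_space s%:E th f ->
    (Lp_norm mu (rho * s)%:E (T f) <= C0%:E * hardy_norm s%:E f)%E) ->
  Bnd rho s (Num.max C0 0 `^ (rho * s)).
Proof.
move=> s1 rs H f Kf f1; have s0 : 0 < s by exact: lt_trans s1.
have M0 : 0 <= Num.max C0 0 by rewrite le_max lexx orbT.
apply/(poweR_le rs (eint_ge0 _ (fun x => powR_ge0 _ _)) M0).
rewrite -Lp_normE; apply: (le_trans (H f ((KpP ith f s1).2 Kf))).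
rewrite (hardy_normE s1 Kf.1).
apply: (@le_trans _ _ ((Num.max C0 0)%:E * (pint s (rl f) `^ s^-1))%E).
  by apply: lee_wpmul2r; [exact: poweR_ge0|rewrite lee_fin le_max lexx].
rewrite -[leRHS]mule1; apply: lee_wpmul2l; first by rewrite lee_fin.
by apply/(poweR_le s0 (pint_ge0 _ _) ler01); rewrite one_powR.
Qed.

Lemma maps_of_Bnd rho p (A : R) : 1 < p -> 0 < rho -> 0 <= A -> Bnd rho p A ->
  maps_boundedly mu th p%:E (rho * p)%:E T.
Proof.
move=> p1 rho0 A0 HA; have p0 : 0 < p by exact: lt_trans p1.
have q0 : 0 < rho * p by rewrite mulr_gt0.
exists (A `^ (rho * p)^-1) => f /(KpP ith f p1) Kf.
rewrite (hardy_normE p1 Kf.1) Lp_normE.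
have [_ [_ Lf] _ _ _] := hp_rl p1 Kf.1.
have fin : pint p (rl f) \is a fin_num by rewrite ge0_fin_numE ?pint_ge0.
have fE := fineK fin; move: fE (pint_ge0 p (rl f)); set L := fine _ => fE.
rewrite -fE poweR_EFin -EFinM lee_fin => L0.
have L'0 : 0 <= A `^ (rho * p)^-1 * L `^ p^-1 by rewrite mulr_ge0 ?powR_ge0.
apply/(poweR_le q0 (eint_ge0 _ (fun x => powR_ge0 _ _)) L'0).
have -> : (A `^ (rho * p)^-1 * L `^ p^-1) `^ (rho * p) = L `^ rho * A.
  rewrite powRM ?powR_ge0// -!powRrM mulVf ?gt_eqF// powRr1// mulrC.
  by congr (_ `^ _ * _); field; rewrite gt_eqF.
have main (e : R) : 0 < e -> L <= e ->
    (eint mu (fun x => NT f x `^ (rho * p))%R <= (e `^ rho * A)%:E)%E.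
  by move=> e0 Le; apply: Bnd_scale HA Kf e0 _ => //; rewrite -fE lee_fin.
move: L0; rewrite le_eqVlt => /predU1P[L0|L0]; last by apply: main.
(* [Bnd_scale] needs a positive bound; when the integral of [f] vanishes, arbitrarily small bounds
   [e'] take its place. *)
rewrite -L0 powR0 ?gt_eqF// mul0r; apply/lee_addgt0Pr => e e0; rewrite add0e.
pose e' := (e / (A + 1)) `^ rho^-1.
have A1 : 0 < A + 1 by rewrite ltr_wpDl.
have e'0 : 0 < e' by rewrite powR_gt0// divr_gt0.
apply: (le_trans (main e' e'0 _)); first by rewrite -L0 ltW.
rewrite lee_fin /e' -powRrM mulVf ?gt_eqF// powRr1; last by rewrite divr_ge0// ltW.
by rewrite mulrAC ler_pdivrMr// ler_wpM2l ?(ltW e0)// lerDl.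
Qed.

(** Poisson-Jensen at the centre of the disk. *)
Lemma pint_power_mean s p (w : TT -> C) : 0 < s -> s <= p -> Lp p w ->
  (pint s w `^ s^-1 <= pint p w `^ p^-1)%E.
Proof.
move=> s0 sp Lw; have p0 : 0 < p by exact: lt_le_trans sp.
have [mw wi] := Lw; have [_ wsi] := Lp_sub (ltW s0) sp Lw.
have f1 : pint s w \is a fin_num by rewrite ge0_fin_numE ?pint_ge0.
have f2 : pint p w \is a fin_num by rewrite ge0_fin_numE ?pint_ge0.
pose W t : C := (N (w t) `^ s)%:C.
have W1 : cL1 W.
  apply: cL1P; first by apply: cmeasR; exact: cmeas_Npow.
  apply: le_lt_trans wsi; rewrite le_eqVlt; apply/orP; left; apply/eqP.
  by apply: eq_integral => t _; rewrite /W NR ger0_norm ?powR_ge0.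
have ps : 1 <= p / s by rewrite ler_pdivlMr// mul1r.
have z0 : N (0 : C) < 1 by rewrite N0.
have pk1 t : pk 0 t = 1 :> R.
  by rewrite /pk N0 mul0r subr0 N1 expr0n expr1n subr0 divr1.
have := pois_jensen ps W1 z0.
have -> : pois W 0 = (fine (pint s w))%:C.
  rewrite /pois (@cint_ext _ _ W); last by move=> t; rewrite pk1 mul1r.
  by rewrite /W cintR.
have -> : eint m (fun t => pk 0 t * N (W t) `^ (p / s)) = pint p w.
  apply: eq_integral => t _; rewrite pk1 mul1r /W NR ger0_norm ?powR_ge0//.
  by rewrite -powRrM mulrC divfK// gt_eqF.
have key (a b : R) : 0 <= a -> a `^ (p / s) <= b -> a `^ s^-1 <= b `^ p^-1.
  move=> a0 H; have -> : a `^ s^-1 = (a `^ (p / s)) `^ p^-1.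
    by rewrite -powRrM; congr (_ `^ _); field; rewrite !gt_eqF.
  by apply: le_powR => //; [rewrite invr_ge0 ltW|exact: powR_ge0].
have I0 : 0 <= fine (pint s w) by rewrite fine_ge0// pint_ge0.
rewrite NR ger0_norm// -(fineK f1) -(fineK f2) !poweR_EFin !lee_fin.
exact: key I0.
Qed.

End operator.

Theorem theorem5p1 (R : realType) (sigma : R) (tau : \bar R)
    (theta : R[i] -> R[i]) (d : measure_display) (X : measurableType d)
    (mu : {measure set X -> \bar R}) (X1 : base_set)
    (T : (R[i] -> R[i]) -> X -> R[i]) :
  1 < sigma -> (1 <= tau)%E ->
  inner theta ->
  maps_to_L0 (model_space 1%E (theta \* theta)) T ->
  sublinear mu (model_space 1%E (theta \* theta)) T ->
  solid mu X1 (model_space 1%E (theta \* theta)) T ->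
  maps_boundedly mu theta sigma%:E tau T ->
  forall (p : R) (q : \bar R), sigma < p -> (p%:E / q = sigma%:E / tau)%E ->
    maps_boundedly mu theta p%:E q T.
Proof.
move=> s1 tau1 ith HT0 HTs HTo HTb p q sp Eq.
have s0 : 0 < sigma by exact: lt_trans s1.
have p1 : 1 < p by exact: lt_trans sp.
have p0 : 0 < p by exact: lt_trans p1.
case: tau tau1 HTb Eq => [t t1 [C0 HC0] Eq|_ [C0 HC0] Eq|//].
  rewrite lee_fin in t1; have t0 : 0 < t by exact: lt_le_trans t1.
  (* The quotient is the one of extended reals, where [1 / 0] is [+oo] and [1 / +oo] is [0]; the
     degenerate values [0], [+oo] and [-oo] of [q] contradict the relation. *)
  have qE : q = (t / sigma * p)%:E.
    case: q Eq => [q| |].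
    - have [->|q0] := eqVneq q 0.
        rewrite inve0 gt0_muley ?lte_fin// inver gt_eqF//.
      rewrite !inver (negbTE q0) gt_eqF// -!EFinM => -[H]; congr (_%:E).
      have H' : p * t = sigma * q.
        rewrite (_ : p * t = p / q * (q * t)); last by field.
        by rewrite H; field; rewrite gt_eqF.
      rewrite (_ : q = sigma * q / sigma); last by field; rewrite gt_eqF.
      by rewrite -H'; field; rewrite gt_eqF.
    - rewrite invey mule0 inver gt_eqF// -EFinM => -[] /esym/eqP.
      by rewrite mulf_eq0 invr_eq0 !gt_eqF.
    - by rewrite inveNy gt0_muleNy ?lte_fin// inver gt_eqF.
  pose rho := t / sigma; have rho0 : 0 < rho by rewrite divr_gt0.
  have rs : rho * sigma = t by rewrite /rho divfK// gt_eqF.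
  have HB : Bnd mu theta T rho sigma (Num.max C0 0 `^ (rho * sigma)).
    by apply: Bnd_of_maps => //; rewrite rs.
  have [||A A0 HA] := @Bnd_all _ _ _ _ _ _ _ ith HT0 HTs HTo _ _ _ p s1 rho0 _ _ HB sp.
  - by rewrite rs.
  - exact: powR_ge0.
  by rewrite qE; apply: maps_of_Bnd HA.
(* For [tau = +oo] the right-hand side is [0], which forces [q = +oo]; what remains is that norms on
   a probability space grow with the exponent. *)
have qE : q = +oo%E.
  case: q Eq => [q| |]; rewrite invey mule0.
  - have [->|q0] := eqVneq q 0; first by rewrite inve0 gt0_muley ?lte_fin.
    rewrite inver (negbTE q0) -EFinM => -[] /eqP.
    by rewrite mulf_eq0 invr_eq0 gt_eqF// (negbTE q0).
  - by [].
  - by rewrite inveNy gt0_muleNy ?lte_fin.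
rewrite qE; exists (Num.max C0 0) => f /(KpP ith f p1) Kf.
have Kf' := Kp_mono s1 (ltW sp) Kf.
apply: (le_trans (HC0 f ((KpP ith f s1).2 Kf'))).
rewrite (hardy_normE p1 Kf.1) (hardy_normE s1 Kf'.1).
have [_ Lf _ _ _] := hp_rl p1 Kf.1.
have M0 : 0 <= Num.max C0 0 by rewrite le_max lexx orbT.
apply: (@le_trans _ _ ((Num.max C0 0)%:E * (pint sigma (rl f) `^ sigma^-1))%E).
  by apply: lee_wpmul2r; [exact: poweR_ge0|rewrite lee_fin le_max lexx].
apply: lee_wpmul2l; first by rewrite lee_fin.
exact: (pint_power_mean s0 (ltW sp) Lf).
Qed.
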